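(* Let $p>1$, $\alpha\in\mathbb{R}$, and $\lambda>|e_\alpha|$. Then the equation $$(-\Delta_\alpha+\lambda)u-|u|^{p-1}u=0,\qquad u\in H^1_\alpha(\mathbb{R}^2),$$ has at most one positive radial solution.
   Context: $\gamma$ is the Euler--Mascheroni constant. For $\alpha\in\mathbb{R}$ put $e_\alpha:=-4e^{-4\pi\alpha-2\gamma}<0$. For $\lambda>0$ put $\beta(\lambda):=\frac1{2\pi}\bigl(\gamma+\log\frac{\sqrt\lambda}{2}\bigr)$ and $G_\lambda(x):=\frac1{2\pi}K_0(\sqrt\lambda|x|)$, where $K_0$ is the modified Bessel function of the second kind of order zero; $G_\lambda$ satisfies $(-\Delta+\lambda)G_\lambda=\delta_0$ on $\mathbb{R}^2$ and $G_\lambda\notin H^1(\mathbb{R}^2)$. If $\lambda>|e_\alpha|$ then $\alpha+\beta(\lambda)>0$. $-\Delta_\alpha$ is the Schrödinger operator on $L^2(\mathbb{R}^2)$ with a point interaction of strength $\alpha$ at the origin. Its form domain is $H^1_\alpha(\mathbb{R}^2)=\{f+cG_\lambda : f\in H^1(\mathbb{R}^2),\ c\in\mathbb{C}\}$ (functions are complex valued; the space does not depend on $\lambda$, and for given $\lambda$ the decomposition is unique), with form, for $v=f+cG_\lambda$ and $w=g+dG_\lambda$, $$\langle(-\Delta_\alpha+\lambda)v,w\rangle=\operatorname{Re}\Bigl[\int_{\mathbb{R}^2}\nabla f\cdot\overline{\nabla g}\,dx+\lambda\int_{\mathbb{R}^2}f\overline g\,dx+(\alpha+\beta(\lambda))c\overline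 d\Bigr].$$ A solution of the equation is $u\in H^1_\alpha(\mathbb{R}^2)$ with $\langle(-\Delta_\alpha+\lambda)u,w\rangle=\operatorname{Re}\int_{\mathbb{R}^2}|u|^{p-1}u\,\overline w\,dx$ for all $w\in H^1_\alpha(\mathbb{R}^2)$. (One has $H^1_\alpha(\mathbb{R}^2)\hookrightarrow L^q(\mathbb{R}^2)$ for $2\le q<\infty$.) Positive means real valued and $>0$ on $\mathbb{R}^2\setminus\{0\}$ (solutions are continuous on $\mathbb{R}^2\setminus\{0\}$). *)

(* Defs.v *)
From HB Require Import structures.
From mathcomp Require Import all_boot all_order all_algebra.
From mathcomp Require Import all_classical all_reals all_analysis.
From mathcomp Require Import complex.

Set Implicit Arguments.
Unset Strict Implicit.
Unset Printing Implicit Defensive.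

Import Order.TTheory GRing.Theory Num.Theory.
Import numFieldNormedType.Exports.

Local Open Scope classical_set_scope.
Local Open Scope ring_scope.

Section Constants.
Variable R : realType.

(* Euler-Mascheroni: the limit of 1 + 1/2 + ... + 1/n - log n *)
Definition euler_gamma : R :=
  limn (fun n : nat => series harmonic n - ln n%:R).

Definition coshR (t : R) : R := (expR t + expR (- t)) / 2.

(* K_0(z), for z > 0, by its integral representation
   \int_0^oo exp (- z cosh t) dt *)
Definition besselK0 (z : R) : R :=
  \int[lebesgue_measure]_(t in `[0, +oo[) expR (- z * coshR t).

Definition e_ (alpha : R) : R :=
  - 4 * expR (- 4 * pi * alpha - 2 * euler_gamma).

Definition beta_ (lambda : R) : R :=
  (2 * pi)^-1 * (euler_gamma + ln (Num.sqrt lambda / 2)).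

End Constants.

Section Plane.
Variable R : realType.

(* The norm of the library on R * R is the sup norm. *)
Definition enorm (x : R * R) : R := Num.sqrt (x.1 ^+ 2 + x.2 ^+ 2).

Definition leb2 := (@lebesgue_measure R \x @lebesgue_measure R)%E.

(* The value at 0, where the integral diverges, is irrelevant: all functions
   are considered up to null sets. *)
Definition green (lambda : R) (x : R * R) : R :=
  (2 * pi)^-1 * besselK0 (Num.sqrt lambda * enorm x).

Definition cint (f : R * R -> R[i]) : R[i] :=
  Complex (\int[leb2]_x complex.Re (f x)) (\int[leb2]_x complex.Im (f x)).

Definition cmeasurable (f : R * R -> R[i]) : Prop :=
  measurable_fun [set: R * R] (fun x => complex.Re (f x)) /\
  measurable_fun [set: R * R] (fun x => complex.Im (f x)).

Definition L2 (f : R * R -> R[i]) : Prop :=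
  (fun x => complex.Re (f x)) \in Lfun leb2 2%:E /\
  (fun x => complex.Im (f x)) \in Lfun leb2 2%:E.

Definition basis_vec (i : 'I_2) : R * R := if i == ord0 then (1, 0) else (0, 1).

Fixpoint Ck (n : nat) (phi : R * R -> R) : Prop :=
  continuous phi /\
  if n is m.+1 then
    forall i : 'I_2, (forall x, derivable phi x (basis_vec i)) /\
                     Ck m (fun x => 'D_(basis_vec i) phi x)
  else True.

Definition test_function (phi : R * R -> R) : Prop :=
  (forall n, Ck n phi) /\ compact (closure [set x | phi x != 0]).

Definition weak_partial (i : 'I_2) (f h : R * R -> R[i]) : Prop :=
  forall phi, test_function phi ->
    cint (fun x => f x * ('D_(basis_vec i) phi x)%:C%C) =
    - cint (fun x => h x * (phi x)%:C%C).

(* f belongs to H^1 and its weak gradient is (df 0, df 1) *)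
Definition H1_grad (f : R * R -> R[i]) (df : 'I_2 -> R * R -> R[i]) : Prop :=
  L2 f /\ forall i, L2 (df i) /\ weak_partial i f (df i).

(* v = f + c G_lambda belongs to H^1_alpha, with f in H^1 of weak gradient df.
   Elements of H^1_alpha are classes of functions modulo equality almost
   everywhere, of which v is any measurable representative. *)
Definition H1alpha_dec (lambda : R) (v f : R * R -> R[i])
    (df : 'I_2 -> R * R -> R[i]) (c : R[i]) : Prop :=
  [/\ cmeasurable v, H1_grad f df
    & {ae leb2, forall x, v x = f x + c * (green lambda x)%:C%C}].

(* <(-Delta_alpha + lambda) v, w> for v = f + c G_lambda, w = g + d G_lambda *)
Definition alpha_form (alpha lambda : R)
    (f : R * R -> R[i]) (df : 'I_2 -> R * R -> R[i]) (c : R[i])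
    (g : R * R -> R[i]) (dg : 'I_2 -> R * R -> R[i]) (d : R[i]) : R :=
  complex.Re (cint (fun x => \sum_(i < 2) df i x * (dg i x)^*%C)
    + lambda%:C%C * cint (fun x => f x * (g x)^*%C)
    + (alpha + beta_ lambda)%:C%C * c * d^*%C).

Definition nonlin (p : R) (z : R[i]) : R[i] :=
  (Normc.normc z `^ (p - 1))%:C%C * z.

(* The decomposition (f, c) of a function is unique and the weak gradient is
   unique almost everywhere, so the value of the form depends on u and w only. *)
Definition is_solution (p alpha lambda : R) (u : R * R -> R[i]) : Prop :=
  exists f df c, H1alpha_dec lambda u f df c /\
  forall w g dg d, H1alpha_dec lambda w g dg d ->
    alpha_form alpha lambda f df c g dg d =
    complex.Re (cint (fun x => nonlin p (u x) * (w x)^*%C)).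

(* In the order of R[i], 0 < z means that z is real and positive. *)
Definition positive_off0 (u : R * R -> R[i]) : Prop :=
  forall x : R * R, x != 0 -> 0 < u x.

Definition radial (u : R * R -> R[i]) : Prop :=
  forall x y, enorm x = enorm y -> u x = u y.

End Plane.

(* Main.v *)
Require Import Defs.
From HB Require Import structures.
From mathcomp Require Import all_boot all_order all_algebra.
From mathcomp Require Import all_classical all_reals all_analysis.
From mathcomp Require Import complex.
From mathcomp Require Import measurable_realfun ring lra.

Set Implicit Arguments.
Unset Strict Implicit.
Unset Printing Implicit Defensive.

Import Order.TTheory GRing.Theory Num.Theory.
Import numFieldNormedType.Exports.
Local Open Scope classical_set_scope.
Local Open Scope ring_scope.

(** A positive radial solution u is a function of t = ln |x|. Testing the
equation with radial functions gives a weak equation on the half-line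
(s = |x|^2 = e^{2t}), whence u'' = e^{2t} (lambda u - u^p) in t, and
u' -> - c / (2 pi) at -oo, where c > 0 is the coefficient of the Green function
G in u. Testing with G itself shows that the limit at -oo of the Wronskian
G' u - u' G is the same multiple of c for every solution; since G' has a nonzero
limit at -oo, the Wronskian of two solutions tends to 0 at -oo.

Let W = u2' u1 - u1' u2, and let J[u] be the Pohozaev-type functional below,
which decreases to 0 at +oo and hence is positive. If W > 0 on a maximal
interval, then u1 / u2 decreases there, so J[u1] - (u1 / u2)^2 J[u2] increases;
but it is nonnegative (or tends to 0) at the left end and nonpositive (or tends
to 0) at the right end. Hence W = 0, and then u1 = u2. *)

(** * Uniqueness for the radial differential equation *)

(** The comparison rests on the derivative of J[u] being -a(t) u^2 with one positive function a for
    all solutions; b = 2 / (p + 3) is the exponent for which this happens. So in J[u1] - (u1 / u2)^2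
    J[u2] the derivatives of both J cancel and only that of u1 / u2 is left. At a zero of W this
    expression is a positive multiple of u1^(p-1) - u2^(p-1), and so is W'; the sign of W' at the
    ends of an interval where W > 0 thus fixes the boundary signs. At -oo the weight e^{-2bt} blows
    up, so W -> 0 has to be sharpened to an exponential rate.

    The passage to the equation meets another obstacle: integrals are total and a divergent one is
    0, so the weak identity does not by itself say that u^p times a test function is integrable;
    this is obtained by contradiction from u > 0. Tests are smooth functions of s = |x|^2, hence
    smooth at the origin without vanishing there: the Laplacian becomes 4 (s h')', planar measure
    becomes a multiple of ds, and tests constant near 0 exclude a flux at the origin. *)

Section RealDerivatives.
Variable R : realType.
Implicit Types (f df : R -> R) (a b x : R).

Lemma is_derive_continuous f x d : is_derive x 1 f d -> {for x, continuous f}.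
Proof.
by move=> h; apply: differentiable_continuous; apply/derivable1_diffP; exact: ex_derive.
Qed.

Lemma mean_value f df a b : a < b ->
  (forall x, a <= x <= b -> is_derive x 1 f (df x)) ->
  exists2 c, a < c < b & f b - f a = df c * (b - a).
Proof.
move=> ab h; have [x xab||c cab e] := @MVT R f df a b ab.
- by apply: h; move: xab; rewrite in_itv/= => /andP[/ltW-> /ltW->].
- suff : {in `[a, b]%classic, continuous f}.
    by move/continuous_in_subspaceT; exact.
  move=> y /set_mem /=; rewrite in_itv/= => yab.
  exact: is_derive_continuous (h y yab).
- by exists c; [move: cab; rewrite in_itv|].
Qed.

Lemma derive_ge0_le f df a b : a <= b ->
  (forall x, a <= x <= b -> is_derive x 1 f (df x)) ->
  (forall x, a < x < b -> 0 <= df x) -> f a <= f b.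
Proof.
rewrite le_eqVlt => /predU1P[->//|ab] h d0.
have [c cab e] := mean_value ab h.
by rewrite -subr_ge0 e mulr_ge0 ?d0// subr_ge0 ltW.
Qed.

Lemma derive_le0_ge f df a b : a <= b ->
  (forall x, a <= x <= b -> is_derive x 1 f (df x)) ->
  (forall x, a < x < b -> df x <= 0) -> f b <= f a.
Proof.
rewrite le_eqVlt => /predU1P[->//|ab] h d0.
have [c cab e] := mean_value ab h.
by rewrite -subr_le0 e mulr_le0_ge0 ?d0// subr_ge0 ltW.
Qed.

Lemma derive_gt0_lt f df a b : a < b ->
  (forall x, a <= x <= b -> is_derive x 1 f (df x)) ->
  (forall x, a < x < b -> 0 < df x) -> f a < f b.
Proof.
move=> ab h d0; have [c cab e] := mean_value ab h.
by rewrite -subr_gt0 e mulr_gt0 ?d0// subr_gt0.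
Qed.

Lemma derive_lt0_gt f df a b : a < b ->
  (forall x, a <= x <= b -> is_derive x 1 f (df x)) ->
  (forall x, a < x < b -> df x < 0) -> f b < f a.
Proof.
move=> ab h d0; have [c cab e] := mean_value ab h.
by rewrite -subr_lt0 e nmulr_rlt0 ?d0// subr_gt0.
Qed.

(** Provides the end of the maximal interval of positivity starting at [a]; applied to
    [fun t => W (- t)] it also provides the left end. *)
Lemma pos_or_first_zero f a : continuous f -> 0 < f a ->
  (forall t, a <= t -> 0 < f t) \/
  exists b, [/\ a < b, f b = 0 & forall t, a <= t < b -> 0 < f t].
Proof.
move=> cf fa; have [h|h] := pselect (forall t, a <= t -> 0 < f t); [by left|right].
have [t0 [at0 ft0]] : exists t, a <= t /\ f t <= 0.
  apply: contrapT => k; apply: h => t at_; rewrite ltNge; apply/negP => ft.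
  by apply: k; exists t.
pose S := [set t | a <= t /\ f t <= 0].
have hS : has_inf S by split; [exists t0|exists a => t []].
pose b := inf S.
have ab : a <= b by apply: lb_le_inf => //; [exact: (proj1 hS)|move=> t []].
have before t : a <= t < b -> 0 < f t.
  move=> /andP[at_ tb]; rewrite ltNge; apply/negP => ft.
  by move: tb; rewrite ltNge => /negP; apply; apply: ge_inf; [exact: (proj2 hS)|split].
have fb : f b <= 0.
  rewrite leNgt; apply/negP => fb.
  have := cf b; move/cvgrPdist_lt => /(_ (f b) fb)[e /= e0 he].
  have [s [as_ fs] sb] := inf_adherent e0 hS.
  have bs : b <= s by apply: ge_inf; [exact: (proj2 hS)|split].
  have := he s; rewrite /= -normrN opprB ger0_norm ?subr_ge0// ltrBlDl.
  rewrite /b => /(_ sb); rewrite ltr_norml => /andP[_].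
  by rewrite -/b ltrBlDr -ltrBlDl subrr => /lt_le_trans /(_ fs); rewrite ltxx.
exists b; have ltab : a < b.
  by rewrite lt_neqAle ab andbT; apply: contraTneq fb => <-; rewrite -ltNge.
split => //; apply/eqP; rewrite eq_le fb/= leNgt; apply/negP => fb0.
have := cf b; move/cvgrPdist_lt => /(_ (- f b)); rewrite oppr_gt0 => /(_ fb0)[e /= e0 he].
pose s := Num.max a (b - e / 2).
have sb : s < b by rewrite gt_max ltab/= ltrBlDr ltrDl divr_gt0.
have as_ : a <= s by rewrite le_max lexx.
have := he s; rewrite /= ger0_norm ?subr_ge0 ?(ltW sb)//.
have : b - s < e.
  rewrite ltrBlDr addrC -ltrBlDr; apply: (@lt_le_trans _ _ (b - e/2)); first lra.
  by rewrite le_max lexx orbT.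
move=> /[swap]/[apply]; rewrite ltr_norml => /andP[+ _].
rewrite opprK => fs.
have := before s; rewrite as_ sb => /(_ isT); lra.
Qed.

(** The difference quotients from the left are negative, since [f] is positive there and zero at
    [b]. Applied to the Wronskian, this gives the sign of W' at the end of a positivity interval. *)
Lemma derive_first_zero_le0 (f : R -> R) a b d : a < b ->
  (forall t, a <= t < b -> 0 < f t) -> f b = 0 -> is_derive b 1 f d -> d <= 0.
Proof.
move=> ab fp fb [df dfE]; rewrite leNgt; apply/negP => d0.
have : h^-1 *: (f (h *: 1 + b) - f b) @[h --> 0^'] --> d by rewrite -dfE; exact: df.
move/cvgrPdist_lt => /(_ _ d0); move=> -[e /= e0 he].
pose h := Num.min (e / 2) (b - a).
have h0 : 0 < h by rewrite lt_min divr_gt0//= subr_gt0.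
have he2 : h <= e / 2 by rewrite ge_min lexx.
have hba : h <= b - a by rewrite ge_min lexx orbT.
have := he (- h); rewrite /= sub0r opprK gtr0_norm// oppr_eq0 gt_eqF// => /(_ _ isT).
rewrite fb subr0 /GRing.scale/= mulr1 ltr_norml => k.
have {k} /andP[_] := k (ltac:(lra)).
have : 0 < f (- h + b) by apply: fp; apply/andP; split; lra.
move=> fh; rewrite invrN mulNr opprK => k.
have : 0 < h^-1 * f (- h + b) by rewrite mulr_gt0// invr_gt0.
lra.
Qed.

Lemma near_ninftyS (P : set R) : (\forall t \near -oo, P t) ->
  exists T, forall t, t <= T -> P t.
Proof.
by move=> [M [_ h]]; exists (M - 1) => t tM; apply: h; rewrite (le_lt_trans tM)// gtrBl.
Qed.

Lemma near_pinftyS (P : set R) : (\forall t \near +oo, P t) ->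
  exists T, forall t, T <= t -> P t.
Proof.
by move=> [M [_ h]]; exists (M + 1) => t tM; apply: h; rewrite (lt_le_trans _ tM)// ltrDl.
Qed.

Lemma cvgNy_le_ge0 (f : R -> R) t0 : f t @[t --> -oo] --> (0 : R) ->
  (forall s, s <= t0 -> f s <= f t0) -> 0 <= f t0.
Proof.
move=> f0 fm; apply: (cvgr_to_le f0).
by exists t0; split; [exact: num_real|move=> s /ltW; exact: fm].
Qed.

Lemma cvgy_le_ge0 (f : R -> R) t0 : f t @[t --> +oo] --> (0 : R) ->
  (forall s, t0 <= s -> f s <= f t0) -> 0 <= f t0.
Proof.
move=> f0 fm; apply: (cvgr_to_le f0).
by exists t0; split; [exact: num_real|move=> s /ltW; exact: fm].
Qed.

End RealDerivatives.

Section EmdenODE.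
Variables (R : realType) (p lambda : R).
Hypotheses (p1 : 1 < p) (l0 : 0 < lambda).

(* The radial equation in the variable t = ln r *)
Record emden_sol (u v : R -> R) : Prop := EmdenSol {
  emden_pos : forall t : R, 0 < u t;
  emden_du : forall t : R, is_derive t (1 : R) u (v t);
  emden_dv : forall t : R, is_derive t (1 : R) v (expR (2 * t) * (lambda * u t - u t `^ p)) }.

Let b : R := 2 / (p + 3).

(* With b = 2 / (p + 3), the terms in u `^ (p + 1) cancel in the derivative. *)
Definition pohozaev (u v : R -> R) (t : R) : R :=
  expR (- 2 * b * t) * (v t ^+ 2 / 2 + b * u t * v t + b ^+ 2 * u t ^+ 2
    + expR (2 * t) * (- lambda * u t ^+ 2 / 2 + u t `^ (p + 1) / (p + 1))).

Lemma is_derive_expRM (k t : R) :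
  is_derive t 1 (fun x => expR (k * x)) (k * expR (k * t)).
Proof.
have h : is_derive t 1 (fun x : R => k * x) k.
  by apply: is_derive_eq; rewrite /GRing.scale/= mulr1.
have := @is_derive1_comp R expR (fun x => k * x) t _ _ (is_derive_expR _) h.
by rewrite mulrC.
Qed.

Lemma is_derive_powR_comp (u : R -> R) (a t d : R) : 0 < u t -> is_derive t 1 u d ->
  is_derive t 1 (fun x => u x `^ a) (a * u t `^ (a - 1) * d).
Proof.
move=> u0 du.
exact: (@is_derive1_comp R (fun x => x `^ a) u t _ _ (is_derive1_powR _ u0) du).
Qed.

Lemma powR_split (x : R) : 0 < x ->
  x `^ p = x * x `^ (p - 1) /\ x `^ (p + 1) = x ^+ 2 * x `^ (p - 1).
Proof.
move=> x0; have p0 : 0 < p by rewrite (lt_trans _ p1).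
have e : x `^ p = x * x `^ (p - 1) by rewrite mulr_powRB1// ltW.
split => //; rewrite expr2 -mulrA -e.
by rewrite mulrC powRD ?powRr1 ?(ltW x0)// gt_eqF// addr_gt0.
Qed.

(** The result is u^2 times a negative function of [t] that does not depend on the solution, which
    is what makes the comparison of two solutions possible. *)
Lemma is_derive_pohozaev (u v : R -> R) t : emden_sol u v ->
  is_derive t (1 : R) (pohozaev u v)
    (- expR (- 2 * b * t) * u t ^+ 2 *
      (2 * b ^+ 3 + expR (2 * t) * lambda * (p - 1) / (p + 3))).
Proof.
move=> [u0 du dv].
have d1 := is_derive_expRM (- 2 * b) t.
have d2 := is_derive_expRM 2 t.
have d3 := @is_derive_powR_comp u (p + 1) t _ (u0 t) (du t).
have := du t; have := dv t => {}dv {}du.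
rewrite /pohozaev.
apply: is_derive_eq.
rewrite /GRing.scale/=.
have [-> e2] := powR_split (u0 t).
have -> : u t `^ (p + 1 - 1) = u t * u t `^ (p - 1).
  by rewrite addrK; case: (powR_split (u0 t)).
rewrite e2.
by have h1 := p1; rewrite /b; field; rewrite !gt_eqF//; lra.
Qed.

Lemma powR_le_root (x q M : R) : 0 < q -> 0 < M -> 0 < x -> x < M `^ q^-1 -> x `^ q <= M.
Proof.
move=> q0 M0 x0 xM; rewrite -[leRHS]powRr1 ?(ltW M0)// -(@mulVf _ q) ?gt_eqF// powRrM.
by rewrite ge0_ler_powR// ?nnegrE ?(ltW q0) ?(ltW x0) ?powR_ge0 ?(ltW xM).
Qed.

(** * Decay at +oo of square integrable solutions *)

Section Decay.
Implicit Types t s x y : R.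
Variables (u v I D : R -> R) (M : R).
Hypothesis uv : emden_sol u v.
Hypothesis dI : forall t : R, is_derive t (1 : R) I (D t).
Hypothesis Du : forall t : R, expR (2 * t) * u t ^+ 2 <= D t.
Hypothesis IM : forall t : R, I t <= M.

Let energy t : R := expR (- 2 * t) * v t ^+ 2 / 2
  + u t `^ (p + 1) / (p + 1) - lambda * u t ^+ 2 / 2.

(** In the variable r = e^t this is the mechanical energy u_r^2 / 2 + u^(p+1) / (p + 1) - lambda u^2
    / 2; the first order term u_r / r of the planar Laplacian acts as friction. *)
Lemma energy_le t : 0 <= t -> energy t <= energy 0.
Proof.
move=> t0; have [u0 du dv] := uv.
pose de t : R := - (expR (- 2 * t) * v t ^+ 2).
apply: (@derive_le0_ge R _ de) => [|x _|x _]; first exact: t0; last first.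
  by rewrite /de oppr_le0 mulr_ge0// ?expR_ge0 ?sqr_ge0.
have d1 := is_derive_expRM (- 2) x.
have d3 := @is_derive_powR_comp u (p + 1) x _ (u0 x) (du x).
have := du x; have := dv x => {}dv {}du.
apply: is_derive_eq.
rewrite /GRing.scale/= /de.
have [-> e2] := powR_split (u0 x).
have -> : u x `^ (p + 1 - 1) = u x * u x `^ (p - 1).
  by rewrite addrK; case: (powR_split (u0 x)).
have e3 : expR (2 * x) * expR (- 2 * x) = 1.
  by rewrite -expRD -mulrDl subrr mul0r expR0.
have pn : p + 1 != 0 by have h1 := p1; rewrite gt_eqF//; lra.
transitivity (- (expR (-2 * x) * v x ^+ 2) + (expR (2 * x) * expR (- 2 * x) - 1) *
  (lambda * u x - u x * u x `^ (p - 1)) * v x); first by field.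
by rewrite e3 subrr !mul0r addr0.
Qed.

Lemma emden_bounded : exists2 C : R, 0 < C & forall t, 0 <= t -> u t <= C /\ `|v t| <= C * expR t.
Proof.
have [u0 du dv] := uv.
have h1 := p1; have hl0 := l0.
pose E : R := `|energy 0|.
(* If u exceeds [C0], the first summand makes u^(p+1) / (p + 1) at least lambda u^2, so the energy
   bound gives lambda u^2 <= 2 E; the summand 1 gives u <= u^2, and the last summand is then
   contradicted. *)
pose C0 := (lambda * (p + 1)) `^ (p - 1)^-1 + 1 + 2 * E / lambda.
have E0 : 0 <= E by exact: normr_ge0.
have El : 0 <= 2 * E / lambda by rewrite divr_ge0 ?mulr_ge0// ltW.
have P0 : 0 <= (lambda * (p + 1)) `^ (p - 1)^-1 by rewrite powR_ge0.
have C01 : 1 <= C0 by rewrite /C0; lra.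
have uC t : 0 <= t -> u t <= C0.
  move=> /energy_le; rewrite /energy; have [_ ->] := powR_split (u0 t) => h.
  have {}h : u t ^+ 2 * u t `^ (p - 1) / (p + 1) - lambda * u t ^+ 2 / 2 <= E.
    have := ler_norm (energy 0); rewrite -/E.
    have : 0 <= expR (- 2 * t) * v t ^+ 2 / 2.
      by rewrite divr_ge0// mulr_ge0 ?expR_ge0 ?sqr_ge0.
    by move: h; rewrite /energy; lra.
  rewrite leNgt; apply/negP => Cu.
  have u1 : 1 <= u t by rewrite (le_trans C01)// ltW.
  have q1 : lambda * (p + 1) < u t `^ (p - 1).
    have p10 : 0 < p - 1 by lra.
    have lp : 0 < lambda * (p + 1) by rewrite mulr_gt0//; lra.
    rewrite -[ltLHS]powRr1 ?(ltW lp)// -[X in _ `^ X < _](@mulVf _ (p - 1)) ?gt_eqF// powRrM.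
    by rewrite gt0_ltr_powR// ?nnegrE ?powR_ge0// ?(ltW (u0 _))//; move: Cu; rewrite /C0; lra.
  have h2 : lambda * u t ^+ 2 <= u t ^+ 2 * u t `^ (p - 1) / (p + 1).
    rewrite ler_pdivlMr; last lra.
    by rewrite mulrAC mulrC ler_wpM2l ?sqr_ge0// ltW.
  have h3 : lambda * u t ^+ 2 <= 2 * E by lra.
  have h4 : lambda * u t <= lambda * u t ^+ 2.
    by rewrite ler_wpM2l ?(ltW l0)// expr2 ler_peMr// ltW.
  have : u t <= 2 * E / lambda by rewrite ler_pdivlMr// mulrC; lra.
  by move: Cu; rewrite /C0; lra.
have V t : 0 <= t -> v t ^+ 2 <= (2 * E + lambda * C0 ^+ 2) * expR t ^+ 2.
  move=> t0; have := energy_le t0.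
  have := ler_norm (energy 0); rewrite -/E => hE h2.
  have h3 : 0 <= u t `^ (p + 1) / (p + 1) by rewrite divr_ge0 ?powR_ge0//; lra.
  have h4 : lambda * u t ^+ 2 <= lambda * C0 ^+ 2.
    by rewrite ler_wpM2l ?(ltW l0)// lerXn2r ?nnegrE ?uC ?(ltW (u0 _))//; lra.
  have h5 : expR (- 2 * t) * v t ^+ 2 <= 2 * E + lambda * C0 ^+ 2.
    by move: h2; rewrite {1}/energy; lra.
  have -> : v t ^+ 2 = expR (- 2 * t) * v t ^+ 2 * expR t ^+ 2.
    have -> : expR (- 2 * t) = (expR t ^+ 2)^-1 by rewrite -expRM_natl -expRN mulNr.
    by field; rewrite gt_eqF// expR_gt0.
  by rewrite ler_wpM2r// sqr_ge0.
(* The added 1 gives K <= (K + 1)^2 for K = 2 E + lambda C0^2, so that the bound on v^2 yields one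
   on |v| without a square root. *)
exists (C0 + (2 * E + lambda * C0 ^+ 2 + 1)).
  have : 0 <= lambda * C0 ^+ 2 by rewrite mulr_ge0 ?sqr_ge0 ?ltW.
  lra.
have lC : 0 <= lambda * C0 ^+ 2 by rewrite mulr_ge0 ?sqr_ge0 ?ltW.
move=> t t0; split; first by have := uC _ t0; lra.
have : `|v t| ^+ 2 <= ((2 * E + lambda * C0 ^+ 2 + 1) * expR t) ^+ 2.
  rewrite real_normK ?num_real// (le_trans (V _ t0))// exprMn ler_wpM2r ?sqr_ge0//.
  by rewrite expr2; nra.
rewrite ler_pXn2r ?nnegrE// ?mulr_ge0 ?expR_ge0//; last lra.
by move/le_trans; apply; rewrite ler_wpM2r ?expR_ge0//; lra.
Qed.

Let D0 t : 0 <= D t.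
Proof. by rewrite (le_trans _ (Du t))// mulr_ge0 ?expR_ge0 ?sqr_ge0. Qed.

(** [I] is nondecreasing and bounded above, hence convergent. Square integrability of u over the
    plane, that is of u^2 against e^{2t} dt, enters the decay estimates in this form. *)
Lemma emden_incr_cvg0 : I t - I (t - 1) @[t --> +oo] --> (0 : R).
Proof.
have cI : I t @[t --> +oo] --> sup (range I).
  apply: nondecreasing_cvgr; last by exists M => _ [t _ <-].
  by move=> x y xy; apply: (derive_ge0_le xy (fun z _ => dI z)) => s _.
rewrite -(subrr (sup (range I))); apply: cvgB => //.
apply: cvg_comp cI; apply/cvgryPge => A; near=> t.
by rewrite lerBrDr; near: t; apply: nbhs_pinfty_ge; exact: num_real.
Unshelve. all: by end_near. Qed.

Lemma emden_incrE t : exists2 s, t - 1 < s < t & expR (2 * s) * u s ^+ 2 <= I t - I (t - 1).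
Proof.
have t1 : t - 1 < t by rewrite gtrBl.
have [s sP e] := mean_value t1 (fun x _ => dI x).
by exists s => //; rewrite e opprB addrCA subrr addr0 mulr1.
Qed.

(** The cube of u is used because, for t >= 0, its derivative 3 u^2 v is at most 3 C e^{2t} u^2,
    hence at most 3 C D: u^3 grows by at most 3 C times the increment of [I]. The mean value theorem
    provides a point of ]t - 1, t[ where u^3 is itself at most C times the increment of [I] over
    [t - 1, t]. *)
Lemma emden_cvg0 : u t @[t --> +oo] --> (0 : R).
Proof.
have [u0 du dv] := uv.
have [C C0 hC] := emden_bounded.
pose delta t := I t - I (t - 1).
have bnd t : 1 <= t -> u t ^+ 3 <= 4 * C * delta t.
  move=> t1; have [s /andP[s1 s2] e] := emden_incrE t; rewrite -/(delta t) in e.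
  have s0 : 0 <= s by lra.
  have us : u s ^+ 3 <= C * delta t.
    have [uC _] := hC s s0; rewrite exprS ler_pM ?sqr_ge0 ?(ltW (u0 _))// (le_trans _ e)//.
    by rewrite ler_peMl ?sqr_ge0// -expR0 ler_expR mulr_ge0.
  have : u t ^+ 3 - 3 * C * I t <= u s ^+ 3 - 3 * C * I s.
    pose df t := 3 * u t ^+ 2 * v t - 3 * C * D t.
    have ddf x : is_derive x (1 : R) (fun t => u t ^+ 3 - 3 * C * I t) (df x).
      have := dI x; have := du x => {}du dIx.
      by apply: is_derive_eq; rewrite /GRing.scale/= /df; ring.
    apply: (derive_le0_ge (ltW s2) (fun x _ => ddf x)) => x xs.
    have x0 : 0 <= x by lra.
    have [_ hv] := hC x x0.
    have : v x <= C * expR (2 * x).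
      rewrite (le_trans (ler_norm _))// (le_trans hv)// ler_wpM2l ?ler_expR//; lra.
    move=> vx; apply: (@le_trans _ _ (3 * u x ^+ 2 * v x - 3 * C * (expR (2 * x) * u x ^+ 2))).
      by rewrite /df lerD2l lerN2 ler_wpM2l// mulr_ge0// ltW.
    have -> : 3 * u x ^+ 2 * v x - 3 * C * (expR (2 * x) * u x ^+ 2) =
      3 * u x ^+ 2 * (v x - C * expR (2 * x)) by ring.
    by apply: mulr_ge0_le0; [rewrite mulr_ge0 ?sqr_ge0|lra].
  have Is : I (t - 1) <= I s.
    by apply: (derive_ge0_le (ltW s1) (fun z _ => dI z)) => x _.
  rewrite /delta in us *; nra.
apply/cvgrPdist_lt => e e0.
have e3 : 0 < e ^+ 3 / (4 * C) by rewrite divr_gt0 ?exprn_gt0 ?mulr_gt0.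
have /cvgrPdist_lt /(_ _ e3) := emden_incr_cvg0.
move=> h; near=> t.
have t1 : 1 <= t by near: t; exact: nbhs_pinfty_ge.
rewrite sub0r normrN ger0_norm ?(ltW (u0 _))//.
have : u t ^+ 3 < e ^+ 3.
  rewrite (le_lt_trans (bnd _ t1))// mulrC -ltr_pdivlMr ?mulr_gt0//.
  have : `|0 - (I t - I (t - 1))| < e ^+ 3 / (4 * C) by near: t; exact: h.
  by rewrite sub0r normrN; apply: le_lt_trans; rewrite /delta ler_norm.
by rewrite ltr_pXn2r// nnegrE ltW.
Unshelve. all: by end_near. Qed.

(** Once u^(p-1) <= lambda, v is nondecreasing; a positive value of v would then make u
    nondecreasing from there on, against u -> 0. So u is eventually nonincreasing, and its value at
    t is controlled by that at an intermediate point of ]t - 1, t[. *)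
Lemma emden_decay : [/\ exists T : R, forall t, T <= t -> v t <= 0,
  v t @[t --> +oo] --> (0 : R), expR (2 * t) * u t ^+ 2 @[t --> +oo] --> (0 : R) &
  \forall t \near +oo, u t `^ (p - 1) <= lambda].
Proof.
have [u0 du dv] := uv.
have uc := emden_cvg0.
have ql : \forall t \near +oo, u t `^ (p - 1) <= lambda.
  have : 0 < lambda `^ (p - 1)^-1 by rewrite powR_gt0.
  move/cvgrPdist_lt : uc => /[apply]; apply: filterS => t.
  rewrite sub0r normrN ger0_norm ?(ltW (u0 _))// => ?.
  by apply: powR_le_root => //; have := p1; lra.
have [T hT] := near_pinftyS ql.
have vmono x y : T <= x -> x <= y -> v x <= v y.
  move=> Tx xy; apply: (derive_ge0_le xy (fun z _ => dv z)) => z /andP[xz _].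
  rewrite mulr_ge0 ?expR_ge0//; have [-> _] := powR_split (u0 z).
  rewrite [lambda * _]mulrC -mulrBr mulr_ge0 ?(ltW (u0 _))// subr_ge0 hT//; lra.
have v0 t : T <= t -> v t <= 0.
  move=> Tt; rewrite leNgt; apply/negP => vt.
  have umono s : t <= s -> u t <= u s.
    move=> ts; apply: (derive_ge0_le ts (fun z _ => du z)) => z /andP[xz _].
    by rewrite (le_trans (ltW vt))// vmono// ltW.
  have : u t <= 0.
    apply: (cvgr_to_ge uc); exists t; split; first exact: num_real.
    by move=> s /ltW; exact: umono.
  by rewrite leNgt u0.
have uanti x y : T <= x -> x <= y -> u y <= u x.
  move=> Tx xy; apply: (derive_le0_ge xy (fun z _ => du z)) => z /andP[xz _].
  by rewrite v0//; lra.
split => //; first by exists T.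
- apply/cvgrPdist_lt => e e0.
  move/cvgrPdist_lt : uc => /(_ e e0) /near_pinftyS [S hS].
  exists (Num.max T S + 1); split; first exact: num_real.
  move=> t tM.
  have [tT tS] : T <= t - 1 /\ S <= t - 1.
    by have := le_max T T S; have := le_max S T S; rewrite !lexx orbT/= => ? ?; split; lra.
  rewrite sub0r normrN ler0_norm ?v0//; last lra.
  have tt : t - 1 < t by rewrite gtrBl.
  have [c cP ec] := mean_value tt (fun x _ => du x).
  have := hS _ tS; rewrite sub0r normrN ger0_norm ?(ltW (u0 _))//.
  have : v c <= v t by apply: vmono; lra.
  have := u0 t; lra.
(* The factor e^2 pays for replacing s by t in e^{2s}, as t - s < 1. *)
- pose g t := expR 2 * (I t - I (t - 1)).
  have g0 : g t @[t --> +oo] --> (0 : R).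
    by rewrite -(mulr0 (expR 2)); apply: cvgMr; exact: emden_incr_cvg0.
  apply: (squeeze_cvgr _ (cvg_cst 0) g0).
  exists (T + 1); split; first exact: num_real.
  move=> t tT; rewrite mulr_ge0 ?expR_ge0 ?sqr_ge0//=.
  rewrite /g; have [s /andP[s1 s2] e] := emden_incrE t.
  apply: (@le_trans _ _ (expR 2 * (expR (2 * s) * u s ^+ 2))); last by rewrite ler_wpM2l ?expR_ge0.
  rewrite mulrA -expRD ler_pM ?expR_ge0 ?sqr_ge0// ?ler_expR; first lra.
  by rewrite lerXn2r ?nnegrE ?(ltW (u0 _))// uanti//; lra.
Qed.

Lemma pohozaev_cvg0 : pohozaev u v t @[t --> +oo] --> (0 : R).
Proof.
have [u0 du dv] := uv.
have [_ v0 e0 ql] := emden_decay; have u1 := emden_cvg0.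
have b0 : 0 < b by have h1 := p1; rewrite /b divr_gt0//; lra.
(* With u^(p-1) <= lambda the two terms carrying e^{2t} are at most lambda / 2 and lambda / (p + 1)
   times e^{2t} u^2. *)
pose K := lambda / 2 + lambda / (p + 1).
have K0 : 0 <= K.
  by have h1 := p1; rewrite /K addr_ge0// divr_ge0// ?(ltW l0)//; lra.
pose g t := (v t ^+ 2 / 2 + b * u t * `|v t| + b ^+ 2 * u t ^+ 2
    + K * (expR (2 * t) * u t ^+ 2)).
have g0 : g t @[t --> +oo] --> (0 : R).
  suff : g t @[t --> +oo] --> (0 * 0 / 2 + b * 0 * `|0 : R| + b ^+ 2 * (0 * 0) + K * 0 : R).
    by rewrite !(mul0r, mulr0, addr0).
  apply: cvgD; last exact: cvgMr.
  apply: cvgD; last by apply: cvgMr; under eq_fun do rewrite expr2; exact: cvgM.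
  apply: cvgD.
    by apply: cvgMl; under eq_fun do rewrite expr2; exact: cvgM.
  by apply: cvgM; [exact: cvgMr|exact: cvg_norm].
have g0' : (- g t) @[t --> +oo] --> (0 : R) by rewrite -oppr0; exact: cvgN.
apply: (squeeze_cvgr _ g0' g0); near=> t.
have t0 : 0 <= t by near: t; exact: nbhs_pinfty_ge.
have qt : u t `^ (p - 1) <= lambda by near: t.
rewrite -ler_norml /pohozaev normrM.
have E1 : `|expR (-2 * b * t)| <= 1.
  rewrite ger0_norm ?expR_ge0// -[leRHS]expR0 ler_expR.
  have : 0 <= b * t by rewrite mulr_ge0// ltW.
  by lra.
rewrite -[leRHS]mul1r ler_pM//.
rewrite (le_trans (ler_normD _ _))// lerD//.
  rewrite (le_trans (ler_normD _ _))// lerD//.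
    rewrite (le_trans (ler_normD _ _))// lerD//.
      by rewrite ger0_norm// divr_ge0// sqr_ge0.
    by rewrite normrM ger0_norm// (mulr_ge0 (ltW b0) (ltW (u0 t))).
  by rewrite ger0_norm// (mulr_ge0 (sqr_ge0 b) (sqr_ge0 (u t))).
rewrite normrM (ger0_norm (expR_ge0 _)) [leRHS]mulrCA ler_wpM2l ?expR_ge0//.
rewrite (le_trans (ler_normD _ _))// /K mulrDl lerD//.
  have k : 0 <= lambda * u t ^+ 2 by rewrite mulr_ge0 ?sqr_ge0// ltW.
  by rewrite !mulNr normrN ger0_norm; lra.
have [_ ->] := powR_split (u0 t).
have h1 := p1.
have p10 : 0 <= (p + 1)^-1 by rewrite invr_ge0; lra.
rewrite ger0_norm ?mulr_ge0 ?sqr_ge0 ?powR_ge0//.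
have -> : lambda / (p + 1) * u t ^+ 2 = u t ^+ 2 * lambda / (p + 1) by ring.
by rewrite ler_wpM2r// ler_wpM2l// sqr_ge0.
Unshelve. all: try exact: (ltW (u0 _)). all: by end_near. Qed.

Lemma pohozaev_gt0 t : 0 < pohozaev u v t.
Proof.
have h1 := p1; have [u0 du dv] := uv.
have neg s : - expR (- 2 * b * s) * u s ^+ 2 *
      (2 * b ^+ 3 + expR (2 * s) * lambda * (p - 1) / (p + 3)) < 0.
  rewrite !mulNr oppr_lt0 !mulr_gt0// ?expR_gt0//.
  have : 0 < b by rewrite /b divr_gt0//; lra.
  move=> b0; rewrite addr_gt0//; first by rewrite mulr_gt0// exprn_gt0.
  by rewrite divr_gt0// ?mulr_gt0// ?expR_gt0//; lra.
have anti x y : x < y -> pohozaev u v y < pohozaev u v x.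
  by move=> xy; apply: (derive_lt0_gt xy (fun z _ => is_derive_pohozaev z uv)).
apply: (le_lt_trans _ (anti t (t + 1) _)); last by rewrite ltrDl.
apply: cvgy_le_ge0 pohozaev_cvg0 _ => s.
by rewrite le_eqVlt => /predU1P[->//|/anti/ltW].
Qed.

End Decay.

(** * The Wronskian and the Pohozaev gap of two solutions *)

Section Wronskian.
Variables (u1 v1 u2 v2 : R -> R).
Hypotheses (s1 : emden_sol u1 v1) (s2 : emden_sol u2 v2).

Definition wronskian (u v w z : R -> R) (t : R) : R := z t * u t - v t * w t.

Let W := wronskian u1 v1 u2 v2.
Let q (u : R -> R) (t : R) : R := u t `^ (p - 1).

(** The linear terms cancel. The factor [q u1 t - q u2 t] also occurs in [pohozaev_gapE], so W' and
    the gap have the same sign where W vanishes. *)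
Lemma is_derive_wronskian (t : R) : is_derive t (1 : R) W
  (expR (2 * t) * u1 t * u2 t * (q u1 t - q u2 t)).
Proof.
have [u10 du1 dv1] := s1; have [u20 du2 dv2] := s2.
have := du1 t; have := dv1 t; have := du2 t; have := dv2 t => {}dv2 {}du2 {}dv1 {}du1.
rewrite /W /wronskian; apply: is_derive_eq; rewrite /GRing.scale/= /q.
by have [-> _] := powR_split (u10 t); have [-> _] := powR_split (u20 t); ring.
Qed.

Definition pohozaev_gap (t : R) : R :=
  pohozaev u1 v1 t - (u1 t / u2 t) ^+ 2 * pohozaev u2 v2 t.

(** By [is_derive_pohozaev], the derivative of J[u1] equals (u1 / u2)^2 times that of J[u2]; what
    remains comes from (u1 / u2)' = - W / u2^2. *)
Lemma is_derive_pohozaev_gap (t : R) : is_derive t (1 : R) pohozaev_gap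
  (2 * (u1 t / u2 t) * (W t / u2 t ^+ 2) * pohozaev u2 v2 t).
Proof.
have h1 := p1.
have [u10 du1 dv1] := s1; have [u20 du2 dv2] := s2.
have := is_derive_pohozaev t s1; have := is_derive_pohozaev t s2.
have := du1 t; have := du2 t => {}du2 {}du1 dJ2 dJ1.
have n2 : u2 t != 0 by rewrite gt_eqF.
have dV := @is_deriveV R u2 t (v2 t) 1 n2 du2.
rewrite /pohozaev_gap; apply: is_derive_eq; rewrite /GRing.scale/=.
by rewrite /W /wronskian; field; rewrite !gt_eqF//; lra.
Qed.

(** The terms in u^2 of the two functionals cancel after scaling by (u1 / u2)^2, so every term but
    the last carries a factor W. *)
Lemma pohozaev_gapE (t : R) : pohozaev_gap t =
  expR (- 2 * b * t) * (W t ^+ 2 / u2 t ^+ 2 / 2 - W t * u1 t * v2 t / u2 t ^+ 2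
    - b * u1 t * W t / u2 t + expR (2 * t) * u1 t ^+ 2 * (q u1 t - q u2 t) / (p + 1)).
Proof.
have h1 := p1.
have [u10 _ _] := s1; have [u20 _ _] := s2.
rewrite /pohozaev_gap /pohozaev /W /wronskian /q.
have [_ ->] := powR_split (u10 t); have [_ ->] := powR_split (u20 t).
by rewrite /b; field; rewrite !gt_eqF//; lra.
Qed.

End Wronskian.

(** A limit - A of v makes u at most linear in - t, the logarithmic singularity in |x|. The linear
    bound is weakened to an arbitrarily slow exponential so that later estimates only compare
    exponents. *)
Lemma emden_log_bounds (u v : R -> R) (A e : R) : emden_sol u v -> 0 < A -> 0 < e ->
  v t @[t --> -oo] --> - A ->
  exists T C : R, [/\ T <= 0, 0 < C & forall t, t <= T ->
    [/\ C^-1 <= u t, u t <= C * expR (- e * t) & `|v t| <= C]].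
Proof.
move=> [u0 du dv] A0 e0 vA.
have A2 : 0 < A / 2 by rewrite divr_gt0.
move/cvgrPdist_lt : vA => /(_ _ A2) /near_ninftyS [T0 hT0].
pose T := Num.min T0 0.
have T00 : T <= 0 by rewrite /T ge_min lexx orbT.
have vb t : t <= T -> - (2 * A) <= v t <= 0.
  rewrite /T le_min => /andP[tT _]; have := hT0 t tT.
  by rewrite ltr_norml => /andP[] ? ?; apply/andP; split; lra.
pose D := u T + 2 * A / e.
have D0 : 0 < D by rewrite /D addr_gt0// divr_gt0// mulr_gt0.
have iu : 0 < (u T)^-1 by rewrite invr_gt0.
exists T, (D + (u T)^-1 + 2 * A); split => //; first lra.
move=> t tT; split.
- apply: (@le_trans _ _ (u T)).
    rewrite invf_ple ?posrE ?u0//; lra.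
  apply: (derive_le0_ge tT (fun z _ => du z)) => z /andP[_ zT].
  by have /andP[] := vb z (ltW zT).
- have h : u t + 2 * A * t <= u T + 2 * A * T.
    have dd z : is_derive z (1 : R) (fun t => u t + 2 * A * t) (v z + 2 * A).
      by have := du z => {}du; apply: is_derive_eq; rewrite /GRing.scale/=; ring.
    apply: (derive_ge0_le tT (fun z _ => dd z)) => z /andP[_ zT].
    by have /andP[] := vb z (ltW zT); lra.
  have AT : 2 * A * T <= 0 by rewrite mulr_ge0_le0//; lra.
  have t0 : 0 <= - e * t by rewrite mulNr -mulrN mulr_ge0 ?(ltW e0)// oppr_ge0 (le_trans tT).
  have E1 := expR_ge1Dx (- e * t).
  have E0 : 1 <= expR (- e * t) by lra.
  have h2 : 2 * A * - t <= 2 * A / e * expR (- e * t).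
    rewrite -[leLHS](@mulfVK _ e) ?gt_eqF//.
    rewrite [_ * e]mulrC [2 * A * - t / e]mulrAC mulrCA ler_wpM2l ?divr_ge0 ?mulr_ge0 ?ltW//.
    by rewrite mulrN -mulNr; lra.
  have h3 : u T <= u T * expR (- e * t) by rewrite ler_peMr// ltW.
  rewrite (@le_trans _ _ (D * expR (- e * t)))//.
    by rewrite /D mulrDl; lra.
  rewrite ler_wpM2r ?expR_ge0//; lra.
- have /andP[v1 v2] := vb t tT; rewrite ler0_norm//; lra.
Qed.

(** The weight e^{-2bt} is unbounded at -oo, so W -> 0 alone does not suffice, but it is at most
    e^{-t} for t <= 0 since b <= 1/2. The derivative of W is O(e^{3t/2}); with W -> 0 this gives W
    the same rate, and each term that the weight multiplies in [pohozaev_gapE] becomes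
    O(e^{5t/4}). *)
Lemma pohozaev_gap_cvg0 (u1 v1 u2 v2 : R -> R) (A1 A2 : R) :
  emden_sol u1 v1 -> emden_sol u2 v2 -> 0 < A1 -> 0 < A2 ->
  v1 t @[t --> -oo] --> - A1 -> v2 t @[t --> -oo] --> - A2 ->
  wronskian u1 v1 u2 v2 t @[t --> -oo] --> (0 : R) ->
  pohozaev_gap u1 v1 u2 v2 t @[t --> -oo] --> (0 : R).
Proof.
move=> s1 s2 A10 A20 vA1 vA2 W0; have h1 := p1.
have b00 : 0 <= b by rewrite /b divr_ge0//; lra.
have b12 : b <= 2^-1 by rewrite /b ler_pdivrMr; lra.
have b11 : b <= 1 by lra.
(* With this rate p + 1 factors e^{-et} together cost e^{-t/2}, which leaves e^{3t/2} of e^{2t}. *)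
pose e := (2 * (p + 1))^-1.
have e4 : e <= 4^-1 by rewrite /e lef_pV2 ?posrE//; lra.
have e0 : 0 < e by rewrite /e invr_gt0; lra.
have [T1 [C1 [T10 C10 hb1]]] := emden_log_bounds s1 A10 e0 vA1.
have [T2 [C2 [T20 C20 hb2]]] := emden_log_bounds s2 A20 e0 vA2.
pose C := C1 + C2; pose T := Num.min T1 T2.
have C0 : 0 < C by rewrite addr_gt0.
have T0 : T <= 0 by rewrite /T ge_min T10.
have b1 t : t <= T -> [/\ C^-1 <= u1 t, u1 t <= C * expR (- e * t) & `|v1 t| <= C].
  rewrite /T le_min => /andP[/hb1 [a1 a2 a3] _]; split.
  - by apply: le_trans a1; rewrite lef_pV2 ?posrE// /C lerDl ltW.
  - by rewrite (le_trans a2)// ler_wpM2r ?expR_ge0// /C lerDl ltW.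
  - by rewrite (le_trans a3)// /C lerDl ltW.
have b2 t : t <= T -> [/\ C^-1 <= u2 t, u2 t <= C * expR (- e * t) & `|v2 t| <= C].
  rewrite /T le_min => /andP[_ /hb2 [a1 a2 a3]]; split.
  - by apply: le_trans a1; rewrite lef_pV2 ?posrE// /C lerDr ltW.
  - by rewrite (le_trans a2)// ler_wpM2r ?expR_ge0// /C lerDr ltW.
  - by rewrite (le_trans a3)// /C lerDr ltW.
have [u10 _ _] := s1; have [u20 _ _] := s2.
pose D := C `^ (p - 1).
have D0 : 0 < D by rewrite powR_gt0.
have qb (x t : R) : 0 < x -> x <= C * expR (- e * t) ->
    x `^ (p - 1) <= D * expR (- (p - 1) * e * t).
  move=> x0 xC; have -> : - (p - 1) * e * t = (- e * t) * (p - 1) by ring.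
  rewrite expRM /D -powRM ?expR_ge0 ?(ltW C0)//.
  by rewrite ge0_ler_powR ?nnegrE ?mulr_ge0 ?expR_ge0 ?(ltW C0) ?(ltW x0)//; lra.
pose W := wronskian u1 v1 u2 v2.
pose K := 2 * C ^+ 2 * D.
have K0 : 0 <= K by rewrite /K !mulr_ge0// ltW.
have E2 t : expR (2 * t) * (expR (- e * t) * (expR (- e * t) * expR (- (p - 1) * e * t)))
    = expR (3 / 2 * t).
  by rewrite -!expRD; congr expR; rewrite /e; field; rewrite gt_eqF//; lra.
(* Bounds both the derivative of W, with x = z = u1 and y = w = u2, and the last term of the gap,
   with x = y = z = u1 and w = u2. *)
have nl t x y z w : t <= T -> 0 < x -> x <= C * expR (- e * t) ->
    0 < y -> y <= C * expR (- e * t) ->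
    0 < z -> z <= C * expR (- e * t) ->
    0 < w -> w <= C * expR (- e * t) ->
    `|expR (2 * t) * x * y * (z `^ (p - 1) - w `^ (p - 1))| <= K * expR (3 / 2 * t).
  move=> tT x0 xC y0 yC z0 zC w0 wC.
  rewrite normrM ger0_norm; last by rewrite !mulr_ge0 ?expR_ge0// ltW.
  have hq : `|z `^ (p - 1) - w `^ (p - 1)| <= 2 * (D * expR (- (p - 1) * e * t)).
    rewrite (le_trans (ler_normB _ _))// !ger0_norm ?powR_ge0// mulr_natl mulr2n lerD//; exact: qb.
  rewrite -E2.
  have -> : forall a, expR (2 * t) * x * y * a = expR (2 * t) * (x * (y * a)) by move=> a; ring.
  apply: (@le_trans _ _ (expR (2 * t) * ((C * expR (- e * t)) * ((C * expR (- e * t)) *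
    (2 * (D * expR (- (p - 1) * e * t))))))).
    rewrite ler_wpM2l ?expR_ge0//.
    by rewrite ler_pM ?mulr_ge0 ?(ltW x0) ?(ltW y0)//; rewrite ler_pM ?(ltW y0).
  by rewrite /K le_eqVlt; apply/orP; left; apply/eqP; ring.
have dW := is_derive_wronskian s1 s2.
have dE (k : R) (z : R) : is_derive z (1 : R) (fun t => k * expR (3 / 2 * t))
    (k * (3 / 2 * expR (3 / 2 * z))).
  have := is_derive_expRM (3 / 2) z => h.
  by apply: is_derive_eq; rewrite /GRing.scale/=; ring.
have cE (k : R) : k * expR (3 / 2 * t) @[t --> -oo] --> (0 : R).
  rewrite -[X in _ --> X](mulr0 k); apply: cvgMr.
  have -> : (fun t : R => expR (3 / 2 * t)) = (fun t => expR (- (- (3 / 2 * t)))) by apply/funext => t; rewrite opprK.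
  apply: cvg_comp (@cvgr_expR R); apply/cvgryPge => M; near=> t.
  have : t <= - (2 / 3 * M).
    by near: t; apply: nbhs_ninfty_le; exact: num_real.
  by lra.
(* Both K e^{3t/2} + W and K e^{3t/2} - W tend to 0 at -oo and are nondecreasing up to [T]: the
   derivative of K e^{3t/2} is 3/2 times the bound on that of W. *)
have Wb t : t <= T -> `|W t| <= K * expR (3 / 2 * t).
  move=> tT; rewrite ler_norml; apply/andP; split.
  - rewrite -subr_ge0 opprK.
    apply: (@cvgNy_le_ge0 _ (fun t => W t + K * expR (3 / 2 * t))).
      by rewrite -[X in _ --> X](addr0 (0 : R)); apply: cvgD => //; exact: cE.
    move=> s st.
    have dd z : is_derive z (1 : R) (fun t => W t + K * expR (3 / 2 * t)) _ :=
      @is_deriveD _ _ _ _ _ _ _ _ _ (dW z) (dE K z).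
    apply: (derive_ge0_le st (fun z _ => dd z)) => z /andP[_ zt].
    have zT : z <= T by rewrite (le_trans (ltW zt)).
    have [_ u1C _] := b1 z zT; have [_ u2C _] := b2 z zT.
    have := nl z _ _ _ _ zT (u10 z) u1C (u20 z) u2C (u10 z) u1C (u20 z) u2C.
    have : 0 <= K * expR (3 / 2 * z) by rewrite mulr_ge0 ?expR_ge0.
    by rewrite ler_norml => ? /andP[]; lra.
  - rewrite -subr_ge0.
    apply: (@cvgNy_le_ge0 _ (fun t => K * expR (3 / 2 * t) - W t)).
      by rewrite -[X in _ --> X](subr0 (0 : R)); apply: cvgB => //; exact: cE.
    move=> s st.
    have dd z : is_derive z (1 : R) (fun t => K * expR (3 / 2 * t) - W t) _ :=
      @is_deriveB _ _ _ _ _ _ _ _ _ (dE K z) (dW z).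
    apply: (derive_ge0_le st (fun z _ => dd z)) => z /andP[_ zt].
    have zT : z <= T by rewrite (le_trans (ltW zt)).
    have [_ u1C _] := b1 z zT; have [_ u2C _] := b2 z zT.
    have := nl z _ _ _ _ zT (u10 z) u1C (u20 z) u2C (u10 z) u1C (u20 z) u2C.
    have : 0 <= K * expR (3 / 2 * z) by rewrite mulr_ge0 ?expR_ge0.
    by rewrite ler_norml => ? /andP[]; lra.
pose M := K ^+ 2 * C ^+ 2 + K * C ^+ 4 + K * C ^+ 2 + K.
have cM (k : R) : k * expR (t / 4) @[t --> -oo] --> (0 : R).
  rewrite -[X in _ --> X](mulr0 k); apply: cvgMr.
  have -> : (fun t : R => expR (t / 4)) = (fun t => expR (- (- (t / 4)))) by apply/funext => t; rewrite opprK.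
  apply: cvg_comp (@cvgr_expR R); apply/cvgryPge => N; near=> t.
  have : t <= - (4 * N) by near: t; apply: nbhs_ninfty_le; exact: num_real.
  by lra.
have cM' : - (M * expR (t / 4)) @[t --> -oo] --> (0 : R) by rewrite -oppr0; apply: cvgN; exact: cM.
apply: (squeeze_cvgr _ cM' (cM M)); near=> t; rewrite -ler_norml.
have tT : t <= T by near: t; apply: nbhs_ninfty_le; exact: num_real.
have t0 : t <= 0 by rewrite (le_trans tT).
rewrite pohozaev_gapE// -/W.
have [a1 a2 a3] := b1 t tT; have [c1 c2 c3] := b2 t tT; have Wt := Wb t tT.
have i2 : (u2 t)^-1 <= C by rewrite -[leRHS]invrK lef_pV2// ?posrE ?invr_gt0.
have i20 : 0 <= (u2 t)^-1 by rewrite invr_ge0 ltW.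
set y := expR (- e * t) in a2 c2; set w := expR (3 / 2 * t) in Wt.
(* e^{5t/4} is a common bound for e^{3t/2}, e^{3t} and e^{3t/2} e^{-et}, the last since e <= 1/4;
   times e^{-t} it leaves e^{t/4}. *)
set z := expR (5 / 4 * t).
have y0 : 0 <= y := expR_ge0 _; have w0 : 0 <= w := expR_ge0 _; have z0 : 0 <= z := expR_ge0 _.
have yw : w * y <= z by rewrite /y /w /z -expRD ler_expR; nra.
have wz : w <= z by rewrite ler_expR; nra.
have wwz : w ^+ 2 <= z by rewrite /w -expRM_natl ler_expR; nra.
have -> : expR (t / 4) = expR (- t) * z by rewrite /z -expRD; congr expR; field.
rewrite normrM ger0_norm ?expR_ge0// [leRHS]mulrCA ler_pM ?expR_ge0//.
  by rewrite ler_expR; nra.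
have -> : M * z = K ^+ 2 * C ^+ 2 * z + K * C ^+ 4 * z + K * C ^+ 2 * z + K * z by rewrite /M; ring.
have n1 := normr_ge0 (W t); have n2 := normr_ge0 (v2 t).
rewrite (le_trans (ler_normD _ _))// lerD//; last first.
  rewrite normrM normfV (gtr0_norm (_ : 0 < p + 1)); last lra.
  rewrite ler_pdivrMr; last lra.
  have := nl t _ _ _ _ tT (u10 t) a2 (u10 t) a2 (u10 t) a2 (u20 t) c2.
  rewrite (expr2 (u1 t)) mulrA => /le_trans; apply.
  rewrite -/w -[leRHS]mulrA ler_wpM2l// (le_trans wz)// ler_peMr//; lra.
rewrite (le_trans (ler_normB _ _))// lerD//; last first.
  rewrite (@le_trans _ _ (1 * (C * y) * (K * w) * C))//.
    rewrite 3!normrM (ger0_norm b00) (ger0_norm (ltW (u10 t))) (ger0_norm i20).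
    have bu : 0 <= b * u1 t := mulr_ge0 b00 (ltW (u10 t)).
    apply: ler_pM => //; first exact: mulr_ge0.
    apply: ler_pM => //.
    by apply: ler_pM => //; rewrite (ltW (u10 t)).
  have -> : 1 * (C * y) * (K * w) * C = K * C ^+ 2 * (w * y) by ring.
  by rewrite ler_wpM2l// mulr_ge0// sqr_ge0.
have i22 : (u2 t ^+ 2)^-1 <= C ^+ 2 by rewrite -exprVn lerXn2r// ?nnegrE// ltW.
have i220 : 0 <= (u2 t ^+ 2)^-1 by rewrite invr_ge0 sqr_ge0.
rewrite (le_trans (ler_normB _ _))// lerD//; last first.
  rewrite !normrM (ger0_norm (ltW (u10 _))) (ger0_norm i220).
  rewrite (@le_trans _ _ (K * w * (C * y) * C * C ^+ 2))//.
    have Wu : 0 <= `|W t| * u1 t := mulr_ge0 n1 (ltW (u10 t)).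
    apply: ler_pM => //; first exact: mulr_ge0.
    apply: ler_pM => //.
    by apply: ler_pM => //; rewrite (ltW (u10 t)).
  have -> : K * w * (C * y) * C * C ^+ 2 = K * C ^+ 4 * (w * y) by ring.
  by rewrite ler_wpM2l// mulr_ge0// exprn_ge0// ltW.
have P0 : 0 <= W t ^+ 2 / u2 t ^+ 2 := mulr_ge0 (sqr_ge0 _) i220.
rewrite ger0_norm; last exact: divr_ge0.
have W2 : W t ^+ 2 <= K ^+ 2 * w ^+ 2.
  by rewrite -real_normK ?num_real// -exprMn lerXn2r// nnegrE mulr_ge0.
rewrite (@le_trans _ _ (K ^+ 2 * w ^+ 2 * C ^+ 2 * 1))//.
  apply: ler_pM => //; last by rewrite invf_le1// ler1n.
  by apply: ler_pM => //; exact: sqr_ge0.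
have KC : 0 <= K ^+ 2 * C ^+ 2 := mulr_ge0 (sqr_ge0 K) (sqr_ge0 C).
by rewrite mulr1 [_ * C ^+ 2]mulrAC ler_wpM2l.
Unshelve. all: by end_near. Qed.

(** * Contradictory signs of the Pohozaev gap where W > 0 *)

Section Uniqueness.
Variables (u1 v1 u2 v2 I1 D1 I2 D2 : R -> R) (M A1 A2 : R).
Hypotheses (s1 : emden_sol u1 v1) (s2 : emden_sol u2 v2).
Hypotheses (dI1 : forall t : R, is_derive t (1 : R) I1 (D1 t))
  (dI2 : forall t : R, is_derive t (1 : R) I2 (D2 t))
  (Du1 : forall t : R, expR (2 * t) * u1 t ^+ 2 <= D1 t)
  (Du2 : forall t : R, expR (2 * t) * u2 t ^+ 2 <= D2 t)
  (I1M : forall t : R, I1 t <= M) (I2M : forall t : R, I2 t <= M).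
Hypotheses (A10 : 0 < A1) (A20 : 0 < A2)
  (vA1 : v1 t @[t --> -oo] --> - A1) (vA2 : v2 t @[t --> -oo] --> - A2)
  (W0 : wronskian u1 v1 u2 v2 t @[t --> -oo] --> (0 : R)).

Let W := wronskian u1 v1 u2 v2.
Let Y := pohozaev_gap u1 v1 u2 v2.
Let q (u : R -> R) (t : R) : R := u t `^ (p - 1).

Lemma pohozaev_gap_incr (x y : R) : x < y -> (forall z, x < z < y -> 0 < W z) -> Y x < Y y.
Proof.
move=> xy Wp; apply: (derive_gt0_lt xy (fun z _ => is_derive_pohozaev_gap s1 s2 z)) => z zxy.
have [u10 _ _] := s1; have [u20 _ _] := s2.
rewrite mulr_gt0 ?(pohozaev_gt0 s2 dI2 Du2 I2M)// !mulr_gt0 ?invr_gt0 ?exprn_gt0//.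
exact: Wp.
Qed.

Lemma pohozaev_gap_zero (t : R) : W t = 0 ->
  Y t = expR (- 2 * b * t) * (expR (2 * t) * u1 t ^+ 2 * (q u1 t - q u2 t) / (p + 1)).
Proof.
move=> Wt; rewrite /Y pohozaev_gapE// -/W Wt.
by rewrite expr0n/= !mul0r !mulr0 !mul0r !subrr !add0r.
Qed.

Lemma wronskian_continuous : continuous W.
Proof. by move=> x; apply: is_derive_continuous (is_derive_wronskian s1 s2 x). Qed.

(** The gap increases from [t0] up to the end of the interval where W > 0. At a finite end W' <= 0,
    so the last term of [pohozaev_gapE], the only one left, is nonpositive; if there is no end, the
    gap tends to 0 at +oo. *)
Lemma pohozaev_gap_lt0 t0 : 0 < W t0 -> Y t0 < 0.
Proof.
move=> W1; have [u10 du1 _] := s1; have [u20 du2 _] := s2; have h1 := p1.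
have [Wp|[c [tc Wc Wp]]] := pos_or_first_zero wronskian_continuous W1.
- have Y0 : Y t @[t --> +oo] --> (0 : R).
    have j1 := pohozaev_cvg0 s1 dI1 Du1 I1M; have j2 := pohozaev_cvg0 s2 dI2 Du2 I2M.
    (* As long as W > 0 the ratio u1 / u2 decreases, so freezing it at [t0] bounds the gap from
       below by an expression tending to 0. *)
    pose g t := pohozaev u1 v1 t - (u1 t0 / u2 t0) ^+ 2 * pohozaev u2 v2 t.
    have g0 : g t @[t --> +oo] --> (0 : R).
      rewrite -(subrr (0 : R)) -[X in _ - X](mulr0 ((u1 t0 / u2 t0) ^+ 2)).
      by apply: cvgB => //; exact: cvgMr.
    apply: (squeeze_cvgr _ g0 j1); near=> t.
    have t0t : t0 <= t by near: t; apply: nbhs_pinfty_ge; exact: num_real.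
    have P2 := pohozaev_gt0 s2 dI2 Du2 I2M t.
    rewrite /g /Y /pohozaev_gap lerD2l lerN2 gerBl; apply/andP; split; last first.
      by rewrite mulr_ge0 ?sqr_ge0// ltW.
    rewrite ler_wpM2r ?(ltW P2)// lerXn2r ?nnegrE ?divr_ge0 ?(ltW (u10 _)) ?(ltW (u20 _))//.
    have dv z : is_derive z (1 : R) (fun t => u1 t / u2 t) (- (W z / u2 z ^+ 2)).
      have := du1 z; have := du2 z => {}du2 {}du1.
      have n2 : u2 z != 0 by rewrite gt_eqF.
      have dV := @is_deriveV R u2 z (v2 z) 1 n2 du2.
      by apply: is_derive_eq; rewrite /GRing.scale/= /W /wronskian; field; rewrite gt_eqF.
    apply: (derive_le0_ge t0t (fun z _ => dv z)) => z /andP[tz _].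
    by rewrite oppr_le0 divr_ge0 ?sqr_ge0// ltW// Wp// ltW.
  have lt : Y t0 < Y (t0 + 1).
    by apply: pohozaev_gap_incr => [|z /andP[zt _]]; [rewrite ltrDl|exact/Wp/ltW].
  rewrite (lt_le_trans lt)// -oppr_ge0.
  apply: (@cvgy_le_ge0 _ (fun t => - Y t)).
    by rewrite -oppr0; exact: cvgN.
  move=> s; rewrite lerN2 le_eqVlt => /predU1P[->//|ts]; apply/ltW/pohozaev_gap_incr => // z /andP[zt _].
  by apply/Wp; lra.
- rewrite (lt_le_trans (pohozaev_gap_incr tc _))//; first by move=> z /andP[/ltW tz zc]; rewrite Wp// tz.
  rewrite pohozaev_gap_zero// pmulr_rle0 ?expR_gt0// ler_pdivrMr; last lra.
  rewrite mul0r pmulr_rle0 ?mulr_gt0 ?expR_gt0 ?exprn_gt0// leNgt; apply/negP => qp.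
  have := derive_first_zero_le0 tc Wp Wc (is_derive_wronskian s1 s2 c).
  by rewrite leNgt !mulr_gt0 ?expR_gt0.
Unshelve. all: by end_near. Qed.

Lemma pohozaev_gap_gt0 t0 : 0 < W t0 -> 0 < Y t0.
Proof.
move=> W1; have [u10 du1 _] := s1; have [u20 du2 _] := s2; have h1 := p1.
(* Reversing time turns the left end of the interval into a first zero. *)
pose V t := W (- t).
have V1 : 0 < V (- t0) by rewrite /V opprK.
have dV (t : R) : is_derive t (1 : R) V (- (expR (2 * - t) * u1 (- t) * u2 (- t) * (q u1 (- t) - q u2 (- t)))).
  have dN : is_derive t (1 : R) -%R (- 1 : R) by apply: is_derive_eq.
  have := @is_derive1_comp R W -%R t _ _ (is_derive_wronskian s1 s2 (- t)) dN.
  by rewrite mulrN1.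
have cV : continuous V by move=> x; exact: is_derive_continuous (dV x).
have [Vp|[c [tc Vc Vp]]] := pos_or_first_zero cV V1.
- have Wp t : t <= t0 -> 0 < W t by rewrite -lerN2 => /Vp; rewrite /V opprK.
  have Y0 : Y t @[t --> -oo] --> (0 : R) by exact: pohozaev_gap_cvg0 s1 s2 A10 A20 vA1 vA2 W0.
  have lt : Y (t0 - 1) < Y t0.
    by apply: pohozaev_gap_incr => [|z /andP[_ zt]]; [rewrite gtrBl|exact/Wp/ltW].
  rewrite (le_lt_trans _ lt)//.
  apply: cvgNy_le_ge0 Y0 _ => s.
  rewrite le_eqVlt => /predU1P[->//|ts]; apply/ltW/pohozaev_gap_incr => // z /andP[_ zt].
  by apply/Wp; lra.
- have Wp t : - c < t <= t0 -> 0 < W t.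
    by move=> /andP[ct tt]; rewrite -(opprK t); apply: Vp; rewrite lerN2 tt ltrNl.
  have Wc : W (- c) = 0 by rewrite -Vc.
  have ct : - c < t0 by rewrite ltrNl.
  rewrite (le_lt_trans _ (pohozaev_gap_incr ct _))//; last first.
    by move=> z /andP[tz zc]; rewrite Wp// tz ltW.
  rewrite pohozaev_gap_zero// pmulr_rge0 ?expR_gt0// divr_ge0//; last lra.
  rewrite pmulr_rge0 ?mulr_gt0 ?expR_gt0 ?exprn_gt0// leNgt; apply/negP => qp.
  have := derive_first_zero_le0 tc Vp Vc (dV c).
  rewrite oppr_le0 leNgt; have : 0 < expR (2 * - c) * u1 (- c) * u2 (- c) by rewrite !mulr_gt0 ?expR_gt0.
  by move=> k; rewrite nmulr_llt0 ?k.
Qed.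

Lemma wronskian_le0 t : W t <= 0.
Proof.
by rewrite leNgt; apply/negP => Wt; have := lt_trans (pohozaev_gap_gt0 Wt) (pohozaev_gap_lt0 Wt); rewrite ltxx.
Qed.

End Uniqueness.

Theorem emden_unique (u1 v1 u2 v2 I1 D1 I2 D2 : R -> R) (M A1 A2 : R) :
  emden_sol u1 v1 -> emden_sol u2 v2 ->
  (forall t : R, is_derive t (1 : R) I1 (D1 t)) ->
  (forall t : R, is_derive t (1 : R) I2 (D2 t)) ->
  (forall t : R, expR (2 * t) * u1 t ^+ 2 <= D1 t) ->
  (forall t : R, expR (2 * t) * u2 t ^+ 2 <= D2 t) ->
  (forall t : R, I1 t <= M) -> (forall t : R, I2 t <= M) ->
  0 < A1 -> 0 < A2 ->
  v1 t @[t --> -oo] --> - A1 -> v2 t @[t --> -oo] --> - A2 ->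
  wronskian u1 v1 u2 v2 t @[t --> -oo] --> (0 : R) ->
  u1 = u2.
Proof.
move=> s1 s2 dI1 dI2 Du1 Du2 I1M I2M A10 A20 vA1 vA2 W0; have h1 := p1.
have W0' : wronskian u2 v2 u1 v1 t @[t --> -oo] --> (0 : R).
  rewrite -oppr0 (_ : wronskian u2 v2 u1 v1 = \- wronskian u1 v1 u2 v2).
    exact: cvgN.
  by apply/funext => t; rewrite /wronskian/=; ring.
have W00 : wronskian u1 v1 u2 v2 = cst 0.
  apply/funext => t; apply/eqP; rewrite eq_le.
  rewrite (wronskian_le0 s1 s2 dI1 dI2 Du1 Du2 I1M I2M A10 A20 vA1 vA2 W0)/=.
  have := wronskian_le0 s2 s1 dI2 dI1 Du2 Du1 I2M I1M A20 A10 vA2 vA1 W0' t.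
  by rewrite /wronskian; lra.
have [u10 _ _] := s1; have [u20 _ _] := s2.
(* A vanishing Wronskian has a vanishing derivative, whence u1^(p-1) = u2^(p-1). *)
apply/funext => t; have := is_derive_wronskian s1 s2 t.
rewrite W00 => h.
have /eqP := @derive_val _ _ _ _ _ _ _ h; rewrite derive_cst eq_sym mulf_eq0 subr_eq0.
rewrite gt_eqF ?mulr_gt0 ?expR_gt0//= => /eqP.
by apply: powR_injective; rewrite ?nnegrE ?(ltW (u10 _)) ?(ltW (u20 _))//; lra.
Qed.

End EmdenODE.

(** * The Bessel function K_0 *)

Section BesselK0.
Variable R : realType.
Notation mu := (@lebesgue_measure R).
Implicit Types (z t : R).

Lemma integral0y_FTC (f F : R -> R) (l : R) : continuous f ->
  (forall t, is_derive t (1 : R) F (f t)) -> (forall t, 0 <= t -> 0 <= f t) ->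
  F t @[t --> +oo] --> l ->
  mu.-integrable `[0, +oo[ (EFin \o f) /\ \int[mu]_(t in `[0, +oo[) f t = l - F 0.
Proof.
move=> cf dF f0 Fl.
have dd t : derivable F t 1 by exact: ex_derive.
have cF : F x @[x --> 0^'+] --> F 0.
  by apply: cvg_at_right_filter; exact: is_derive_continuous (dF 0).
have dE : {in `]0, +oo[, derive1 F =1 f}.
  by move=> t _; rewrite derive1E; exact: derive_val.
have wf : {within `[0, +oo[, continuous f} by exact: continuous_subspaceT.
split; last exact: Rintegral_ge0_continuous_FTC2y.
apply/integrableP; split.
  by apply/measurable_EFinP; apply: measurable_funTS; exact: continuous_measurable_fun.
rewrite (@eq_integral _ _ _ mu _ (EFin \o f)); last first.
  by move=> t; rewrite inE/= in_itv/= andbT => t0; rewrite /= ger0_norm ?f0.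
by rewrite (ge0_continuous_FTC2y f0 wf Fl (fun t _ => dd t) cF dE) ltry.
Qed.

Lemma coshR_ge t : 2^-1 * expR t <= coshR t.
Proof. by rewrite /coshR mulrC ler_wpM2r// lerDl expR_ge0. Qed.

Lemma coshR_ge1 t : 1 <= coshR t.
Proof.
rewrite /coshR ler_pdivlMr// mul1r.
have e : expR t * expR (- t) = 1 by rewrite -expRD subrr expR0.
have := sqr_ge0 (expR t - expR (- t)); have := expR_gt0 t; have := expR_gt0 (- t).
set x := expR t in e *; set y := expR (- t) in e *; nra.
Qed.

Definition sinhR (t : R) : R := (expR t - expR (- t)) / 2.

Lemma is_derive_coshR t : is_derive t (1 : R) (@coshR R) (sinhR t).
Proof.
have h := is_derive_expRM (-1) t; rewrite /coshR.
have -> : (fun t : R => (expR t + expR (- t)) / 2) = (fun t => (expR t + expR (-1 * t)) / 2).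
  by apply/funext => x; rewrite mulN1r.
apply: is_derive_eq; rewrite /GRing.scale/= /sinhR mulN1r; by field.
Qed.

Lemma is_derive_sinhR t : is_derive t (1 : R) sinhR (coshR t).
Proof.
have h := is_derive_expRM (-1) t; rewrite /sinhR.
have -> : (fun t : R => (expR t - expR (- t)) / 2) = (fun t => (expR t - expR (-1 * t)) / 2).
  by apply/funext => x; rewrite mulN1r.
apply: is_derive_eq; rewrite /GRing.scale/= /coshR mulN1r; by field.
Qed.

Lemma cosh2_sinh2 t : coshR t ^+ 2 - sinhR t ^+ 2 = 1.
Proof.
have e : expR t * expR (- t) = 1 by rewrite -expRD subrr expR0.
by rewrite /coshR /sinhR -[RHS]e; field.
Qed.

Definition bessel_int (n : nat) z t : R := coshR t ^+ n * expR (- z * coshR t).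

Lemma is_derive_bessel_intz n z t :
  is_derive z (1 : R) (fun z => bessel_int n z t) (- bessel_int n.+1 z t).
Proof.
have h := is_derive_expRM (- coshR t) z; rewrite /bessel_int.
have -> : (fun z => coshR t ^+ n * expR (- z * coshR t)) = (fun z => coshR t ^+ n * expR (- coshR t * z)).
  by apply/funext => x; congr (_ * expR _); ring.
apply: is_derive_eq; rewrite /GRing.scale/= exprS.
by rewrite (_ : - z * coshR t = - coshR t * z); ring.
Qed.

Lemma is_derive_bessel_intt z t : is_derive t (1 : R) (fun t => expR (- z * coshR t))
  (- z * sinhR t * expR (- z * coshR t)).
Proof.
have h : is_derive t (1 : R) (fun t => - z * coshR t) (- z * sinhR t).
  by have := is_derive_coshR t => ?; apply: is_derive_eq; rewrite /GRing.scale/=; ring.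
have := @is_derive1_comp R expR (fun t => - z * coshR t) t _ _ (is_derive_expR _) h.
by rewrite mulrC.
Qed.

Lemma continuous_coshR : continuous (@coshR R).
Proof. by move=> t; exact: is_derive_continuous (is_derive_coshR t). Qed.

Lemma continuous_sinhR : continuous sinhR.
Proof. by move=> t; exact: is_derive_continuous (is_derive_sinhR t). Qed.

Lemma continuous_bessel_int n z : continuous (bessel_int n z).
Proof.
move=> t; apply: (@continuousM _ _ (fun t => coshR t ^+ n)).
  by apply: (@continuous_comp _ _ _ (@coshR R) (fun x => x ^+ n)); [exact: continuous_coshR|exact: exprn_continuous].
exact: is_derive_continuous (is_derive_bessel_intt z t).
Qed.

(** The inequality 1 + x <= e^x at x = z y / (n + 1), raised to the power n + 1. The spare factor 1
    / y gives integrability for y = [coshR t], and the order of vanishing of [flat] at 0 for y = 1 /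
    x. *)
Lemma pow_expR_le (n : nat) z y : 0 < z -> 0 < y ->
  y ^+ n * expR (- z * y) <= (n.+1%:R / z) ^+ n.+1 / y.
Proof.
move=> z0 y0.
rewrite ler_pdivlMr// mulrAC -exprSr.
rewrite mulNr expRN ler_pdivrMr ?expR_gt0//.
have -> : z * y = n.+1%:R * (z * y / n.+1%:R) by rewrite mulrCA divff ?mulr1// pnatr_eq0.
rewrite expRM_natl -exprMn lerXn2r ?nnegrE ?(ltW y0) ?mulr_ge0 ?expR_ge0 ?invr_ge0 ?(ltW z0)//.
rewrite mulrC -ler_pdivrMr ?divr_gt0// invf_div.
rewrite mulrA (mulrC y); apply: le_trans (expR_ge1Dx _); by rewrite lerDr.
Qed.

Lemma integral_expRN : mu.-integrable `[0, +oo[ (EFin \o (fun t => expR (- t))) /\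
  \int[mu]_(t in `[0, +oo[) expR (- t) = 1.
Proof.
have -> : 1 = 0 - (- expR (- 0)) :> R by rewrite sub0r opprK oppr0 expR0.
apply: (@integral0y_FTC _ (fun t => - expR (- t))).
- by move=> t; apply: (@continuous_comp _ _ _ -%R expR); [exact: opp_continuous|exact: continuous_expR].
- move=> t; have h := is_derive_expRM (-1) t.
  have -> : (fun t : R => - expR (- t)) = (fun t => - expR (-1 * t)).
    by apply/funext => x; rewrite mulN1r.
  by apply: is_derive_eq; rewrite mulN1r mulN1r opprK.
- by move=> t _; rewrite expR_ge0.
- by rewrite -oppr0; apply: cvgN; exact: cvgr_expR.
Qed.

Lemma bessel_int_le n z t : 0 < z ->
  bessel_int n z t <= 2 * (n.+1%:R / z) ^+ n.+1 * expR (- t).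
Proof.
move=> z0; rewrite (le_trans (pow_expR_le n z0 (lt_le_trans ltr01 (coshR_ge1 t))))//.
rewrite [2 * _]mulrC -mulrA ler_wpM2l ?exprn_ge0 ?divr_ge0 ?(ltW z0)//.
have c0 : 0 < coshR t := lt_le_trans ltr01 (coshR_ge1 t).
have e0 : 0 < 2 * expR (- t) by rewrite mulr_gt0 ?expR_gt0.
rewrite -(invrK (2 * expR (- t))) lef_pV2 ?posrE ?invr_gt0//.
by rewrite invfM -expRN opprK coshR_ge.
Qed.

Lemma bessel_int_ge0 n z t : 0 <= bessel_int n z t.
Proof. by rewrite mulr_ge0 ?expR_ge0// exprn_ge0// (le_trans _ (coshR_ge1 t)). Qed.

Lemma bessel_int_cvg0 n z : 0 < z -> bessel_int n z t @[t --> +oo] --> (0 : R).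
Proof.
move=> z0; have h : 2 * (n.+1%:R / z) ^+ n.+1 * expR (- t) @[t --> +oo] --> (0 : R).
  by rewrite -[X in _ --> X](mulr0 (2 * (n.+1%:R / z) ^+ n.+1)); apply: cvgMr; exact: cvgr_expR.
apply: (squeeze_cvgr _ (cvg_cst 0) h); near=> t.
by rewrite bessel_int_ge0 bessel_int_le.
Unshelve. all: by end_near. Qed.

Lemma integrable_bessel_int n z : 0 < z -> mu.-integrable `[0, +oo[ (EFin \o bessel_int n z).
Proof.
move=> z0; pose C := 2 * (n.+1%:R / z) ^+ n.+1.
have C0 : 0 <= C by rewrite mulr_ge0// exprn_ge0// divr_ge0// ltW.
have [iE _] := integral_expRN.
have {}iE := @integrableZl _ _ _ mu _ (measurable_itv _) C _ iE.
apply: le_integrable iE => //.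
  by apply/measurable_EFinP; apply: measurable_funTS; apply: continuous_measurable_fun; exact: continuous_bessel_int.
move=> t _; rewrite /= lee_fin ger0_norm ?bessel_int_ge0//.
rewrite ger0_norm; first exact: bessel_int_le.
by rewrite mulr_ge0 ?expR_ge0.
Qed.

(** This is (-1)^n times the n-th derivative of K_0, not the Bessel function K_n: [besselK 1] is
    K_1, but [besselK 2] is K_0''. *)
Definition besselK (n : nat) z : R := \int[mu]_(t in `[0, +oo[) bessel_int n z t.

Lemma besselK_0 z : besselK0 z = besselK 0 z.
Proof. by apply: eq_Rintegral => t _; rewrite /bessel_int expr0 mul1r. Qed.

(** Differentiation under the integral sign: on a neighbourhood of [z] the derivative of the
    integrand is dominated by the integrable function [bessel_int n.+1 (z / 2)]. *)
Lemma is_derive_besselK n z : 0 < z -> is_derive z (1 : R) (besselK n) (- besselK n.+1 z).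
Proof.
move=> z0.
have Ia : `](z / 2), (z + 1)[%classic z by rewrite /= in_itv/=; apply/andP; split; lra.
have pos x : `](z / 2), (z + 1)[%classic x -> 0 < x.
  by rewrite /= in_itv/= => /andP[+ _]; apply: lt_trans; rewrite divr_gt0.
have iF x : `](z / 2), (z + 1)[%classic x -> mu.-integrable `[0, +oo[ (EFin \o bessel_int n x).
  by move=> /pos; exact: integrable_bessel_int.
have dF x y : `](z / 2), (z + 1)[%classic x -> `[0, +oo[%classic y ->
    derivable ((bessel_int n) ^~ y) x 1.
  by move=> _ _; apply: ex_derive; exact: is_derive_bessel_intz.
have z20 : 0 < z / 2 by rewrite divr_gt0.
have G0 y : 0 <= bessel_int n.+1 (z / 2) y.
  by rewrite mulr_ge0 ?expR_ge0// exprn_ge0// (le_trans _ (coshR_ge1 y)).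
have dE x y : partial1of2 (bessel_int n) x y = - bessel_int n.+1 x y.
  by rewrite /partial1of2 derive1E; apply: derive_val; exact: is_derive_bessel_intz.
have Gub x y : `](z / 2), (z + 1)[%classic x -> `[0, +oo[%classic y ->
    `|partial1of2 (bessel_int n) x y| <= bessel_int n.+1 (z / 2) y.
  rewrite /= in_itv/= => /andP[zx _] _; rewrite dE normrN ger0_norm.
    rewrite ler_wpM2l ?exprn_ge0 ?(le_trans _ (coshR_ge1 y))// ler_expR.
    by rewrite ler_wpM2r ?(le_trans _ (coshR_ge1 y))// lerN2 ltW.
  by rewrite mulr_ge0 ?expR_ge0// exprn_ge0// (le_trans _ (coshR_ge1 y)).
have := @derivable_under_integral R _ _ mu (bessel_int n) `[0, +oo[%classic (measurable_itv _)
  z _ _ Ia iF dF _ G0 (integrable_bessel_int n.+1 z20) Gub.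
have := @differentiation_under_integral R _ _ mu (bessel_int n) `[0, +oo[%classic (measurable_itv _)
  z _ _ Ia iF dF _ G0 (integrable_bessel_int n.+1 z20) Gub.
move=> e d; apply: DeriveDef; first exact: d.
rewrite -derive1E e /besselK.
transitivity (\int[mu]_(y in `[0, +oo[) (-1 * bessel_int n.+1 z y)).
  by apply: eq_Rintegral => y _; rewrite dE mulN1r.
by rewrite RintegralZl ?mulN1r//; exact: integrable_bessel_int.
Qed.

(** The function z sinh t e^{- z cosh t} has an elementary primitive and integral e^{-z}; cosh t
    exceeds sinh t by e^{-t}, whose contribution lies between 0 and z e^{-z}. The bounds give the
    limits of z K_1(z) at 0 and at +oo. *)
Lemma besselK_bounds z : 0 < z ->
  expR (- z) <= z * besselK 1 z <= (1 + z) * expR (- z).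
Proof.
move=> z0; have [iE E1] := integral_expRN.
have i1 := integrable_bessel_int 1 z0.
have [iS S1] : mu.-integrable `[0, +oo[ (EFin \o (fun t => z * sinhR t * expR (- z * coshR t))) /\
    \int[mu]_(t in `[0, +oo[) (z * sinhR t * expR (- z * coshR t)) = 0 - (- expR (- z * coshR 0)).
  apply: (@integral0y_FTC _ (fun t => - expR (- z * coshR t))).
  - move=> t; apply: (@continuousM _ _ (fun t => z * sinhR t)).
      by apply: (@continuousM _ _ (fun=> z)); [exact: cst_continuous|exact: continuous_sinhR].
    exact: is_derive_continuous (is_derive_bessel_intt z t).
  - move=> t; have h := is_derive_bessel_intt z t.
    by apply: is_derive_eq; rewrite ?mulNr ?opprK.
  - move=> t t0; rewrite mulr_ge0 ?expR_ge0// mulr_ge0 ?(ltW z0)// /sinhR.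
    by rewrite divr_ge0// subr_ge0 ler_expR; lra.
  - rewrite -oppr0; apply: cvgN; have := bessel_int_cvg0 0 z0.
    by rewrite /bessel_int; under eq_fun do rewrite expr0 mul1r.
have c0 : coshR 0 = 1 :> R by rewrite /coshR oppr0 expR0; field.
have {}S1 : \int[mu]_(t in `[0, +oo[) (z * sinhR t * expR (- z * coshR t)) = expR (- z).
  by rewrite S1 c0 mulr1 sub0r opprK.
have sc t : sinhR t + expR (- t) = coshR t by rewrite /sinhR /coshR; field.
have iz1 : mu.-integrable `[0, +oo[ (EFin \o (fun t => z * bessel_int 1 z t)).
  exact: (@integrableZl _ _ _ mu _ (measurable_itv _) z _ i1).
have -> : z * besselK 1 z = \int[mu]_(t in `[0, +oo[) (z * bessel_int 1 z t).
  by rewrite RintegralZl.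
have izE : mu.-integrable `[0, +oo[ (EFin \o (fun t => z * expR (- z) * expR (- t))).
  exact: (@integrableZl _ _ _ mu _ (measurable_itv _) (z * expR (- z)) _ iE).
apply/andP; split.
  rewrite -S1; apply: le_Rintegral => // t _.
  rewrite /bessel_int expr1 -mulrA ler_wpM2l ?(ltW z0)// ler_wpM2r ?expR_ge0//.
  by rewrite -(sc t) lerDl expR_ge0.
have -> : (1 + z) * expR (- z) = \int[mu]_(t in `[0, +oo[)
    (z * sinhR t * expR (- z * coshR t) + z * expR (- z) * expR (- t)).
  by rewrite RintegralD// S1 RintegralZl// E1; ring.
apply: le_Rintegral => //; first exact: (@integrableD _ _ _ mu _ (measurable_itv _) _ _ iS izE).
move=> t _; rewrite /bessel_int expr1 -(sc t) mulrDl mulrDr -!mulrA lerD2l.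
rewrite ler_wpM2l ?(ltW z0)// [leRHS]mulrC ler_wpM2l ?expR_ge0// ler_expR sc.
by rewrite mulNr lerN2 ler_peMr ?coshR_ge1// ltW.
Qed.

(** Bessel's equation of order 0, obtained by integrating the derivative of sinh t e^{- z cosh
    t}. *)
Lemma besselK_recurrence z : 0 < z -> z * besselK 2 z = besselK 1 z + z * besselK 0 z.
Proof.
move=> z0; have [iE E1] := integral_expRN.
have i0 := integrable_bessel_int 0 z0.
have i1 := integrable_bessel_int 1 z0.
have i2 := integrable_bessel_int 2 z0.
(* That derivative changes sign, whereas [integral0y_FTC] asks for a nonnegative integrand; by
   [bessel_int_le] the term [C] e^{-t} compensates, and its integral [C] cancels at the end. *)
pose C := z * (2 * (3%:R / z) ^+ 3).
have C0 : 0 <= C by rewrite /C mulr_ge0 ?(ltW z0)// mulr_ge0// exprn_ge0// divr_ge0// ltW.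
pose h t := bessel_int 1 z t - z * bessel_int 2 z t + z * bessel_int 0 z t + C * expR (- t).
have [_ H1] : mu.-integrable `[0, +oo[ (EFin \o h) /\
    \int[mu]_(t in `[0, +oo[) h t = 0 - (sinhR 0 * expR (- z * coshR 0) - C * expR (- 0)).
  apply: (@integral0y_FTC _ (fun t => sinhR t * expR (- z * coshR t) - C * expR (- t))).
  - move=> t; apply: cvgD.
      apply: cvgD; last by apply: cvgMr; exact: continuous_bessel_int.
      by apply: cvgB; [|apply: cvgMr]; exact: continuous_bessel_int.
    apply: cvgMr.
    by apply: (@continuous_comp _ _ _ -%R expR); [exact: opp_continuous|exact: continuous_expR].
  - move=> t; have h1 := is_derive_bessel_intt z t; have h2 := is_derive_sinhR t.
    have h3 := is_derive_expRM (-1) t.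
    have -> : (fun t => sinhR t * expR (- z * coshR t) - C * expR (- t)) =
      (fun t => sinhR t * expR (- z * coshR t) - C * expR (-1 * t)).
      by apply/funext => x; rewrite mulN1r.
    apply: is_derive_eq; rewrite /GRing.scale/= /h /bessel_int !mulN1r expr1 expr0.
    have -> : coshR t ^+ 2 = 1 + sinhR t ^+ 2 by rewrite -(cosh2_sinh2 t); ring.
    ring.
  - move=> t _; have := bessel_int_le 2 t z0; have := bessel_int_ge0 1 z t.
    have := bessel_int_ge0 0 z t; rewrite /h /C => b0 b1 b2.
    have zb0 : 0 <= z * bessel_int 0 z t by rewrite mulr_ge0 ?(ltW z0).
    have : z * bessel_int 2 z t <= z * (2 * (3 / z) ^+ 3 * expR (- t)).
      by rewrite ler_wpM2l ?(ltW z0).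
    by lra.
  - rewrite -[X in _ --> X](subr0 (0 : R)); apply: cvgB; last first.
      by rewrite -[X in _ --> X](mulr0 C); apply: cvgMr; exact: cvgr_expR.
    have b1 := bessel_int_cvg0 1 z0.
    have b1' : - bessel_int 1 z t @[t --> +oo] --> (0 : R) by rewrite -oppr0; exact: cvgN.
    apply: (squeeze_cvgr _ b1' b1); near=> t.
    rewrite -ler_norml normrM /bessel_int expr1.
    rewrite (ger0_norm (expR_ge0 _)) ler_wpM2r ?expR_ge0// /sinhR /coshR normrM.
    rewrite (ger0_norm (_ : 0 <= 2^-1)) ?invr_ge0// ler_wpM2r ?invr_ge0//.
    by rewrite (le_trans (ler_normB _ _))// !ger0_norm ?expR_ge0.
have s0 : sinhR 0 = 0 :> R by rewrite /sinhR oppr0 expR0 subrr mul0r.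
move: H1; rewrite s0 mul0r oppr0 expR0 mulr1 !sub0r opprK.
have iz (n : nat) : mu.-integrable `[0, +oo[ (EFin \o (fun t => z * bessel_int n z t)).
  exact: (@integrableZl _ _ _ mu _ (measurable_itv _) z _ (integrable_bessel_int n z0)).
have iC : mu.-integrable `[0, +oo[ (EFin \o (fun t => C * expR (- t))).
  exact: (@integrableZl _ _ _ mu _ (measurable_itv _) C _ iE).
have i3 := @integrableB _ _ _ mu _ (measurable_itv _) _ _ i1 (iz 2).
have i4 := @integrableD _ _ _ mu _ (measurable_itv _) _ _ i3 (iz 0).
have EC : \int[mu]_(t in `[0, +oo[) (C * expR (- t)) = C.
  by rewrite RintegralZl// E1 mulr1.
have EZ n : \int[mu]_(t in `[0, +oo[) (z * bessel_int n z t) = z * besselK n z.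
  by rewrite RintegralZl//; exact: integrable_bessel_int.
rewrite /h RintegralD// RintegralD// RintegralB// EC !EZ -/(besselK 1 z).
by lra.
Unshelve. all: by end_near. Qed.

Lemma besselK_ge0 n z : 0 <= besselK n z.
Proof. by apply: Rintegral_ge0 => t _; exact: bessel_int_ge0. Qed.

Lemma besselK1_gt0 z : 0 < z -> 0 < besselK 1 z.
Proof.
move=> z0; have /andP[+ _] := besselK_bounds z0.
by move/(lt_le_trans (expR_gt0 _)); rewrite pmulr_rgt0.
Qed.

Lemma besselK0_gt0 z : 0 < z -> 0 < besselK 0 z.
Proof.
move=> z0; apply: (le_lt_trans (besselK_ge0 0 (z + 1))).
have zz : z < z + 1 by rewrite ltrDl.
apply: (derive_lt0_gt zz (df := fun x => - besselK 1 x)) => x /andP[zx _].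
  by apply: is_derive_besselK; rewrite (lt_le_trans z0).
by rewrite oppr_lt0 besselK1_gt0// (lt_trans z0).
Qed.

Lemma besselK_le z : 0 < z -> besselK 0 z <= besselK 1 z.
Proof.
move=> z0; apply: le_Rintegral => //; try exact: integrable_bessel_int.
by move=> t _; rewrite /bessel_int expr0 expr1 ler_wpM2r ?expR_ge0 ?coshR_ge1.
Qed.

End BesselK0.

(** * The Green function in logarithmic radius *)

Section GreenProfile.
Variables (R : realType) (lambda : R).
Hypothesis l0 : 0 < lambda.
Implicit Types t : R.

Let z t : R := Num.sqrt lambda * expR t.

Let z_gt0 t : 0 < z t.
Proof. by rewrite mulr_gt0 ?sqrtr_gt0 ?expR_gt0. Qed.

Let z_sqr t : z t ^+ 2 = lambda * expR (2 * t).
Proof. by rewrite /z exprMn sqr_sqrtr ?(ltW l0)// expRM_natl. Qed.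

Let dz t : is_derive t (1 : R) z (z t).
Proof. by rewrite /z; apply: is_derive_eq; rewrite /GRing.scale/=; ring. Qed.

(* The Green function in the variable t = ln |x|, and its derivative *)
Definition glog t : R := (2 * pi)^-1 * besselK 0 (z t).
Definition dglog t : R := - ((2 * pi)^-1 * (z t * besselK 1 (z t))).

Let pi2_gt0 : 0 < (2 * pi)^-1 :> R.
Proof. by rewrite invr_gt0 mulr_gt0 ?pi_gt0. Qed.

Lemma is_derive_glog t : is_derive t (1 : R) glog (dglog t).
Proof.
have h := @is_derive1_comp R (besselK 0) z t _ _ (is_derive_besselK 0 (z_gt0 t)) (dz t).
by rewrite /glog; apply: is_derive_eq; rewrite /GRing.scale/= /dglog; ring.
Qed.

(** In t = ln |x| the first order term of Bessel's equation disappears; [besselK_recurrence] is that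
    equation. *)
Lemma is_derive_dglog t : is_derive t (1 : R) dglog (expR (2 * t) * (lambda * glog t)).
Proof.
have h := @is_derive1_comp R (besselK 1) z t _ _ (is_derive_besselK 1 (z_gt0 t)) (dz t).
have dzt := dz t.
rewrite /dglog; apply: is_derive_eq; rewrite /GRing.scale/= /glog.
have e := besselK_recurrence (z_gt0 t).
transitivity ((2 * pi)^-1 * (z t * (z t * besselK 2 (z t) - besselK 1 (z t)))); first ring.
rewrite e addrAC subrr add0r mulrA -expr2 z_sqr; ring.
Qed.

Lemma glog_gt0 t : 0 < glog t.
Proof. by rewrite mulr_gt0// besselK0_gt0. Qed.

Lemma dglog_cvgNy : dglog t @[t --> -oo] --> - (2 * pi)^-1.
Proof.
apply: cvgN; rewrite -[X in _ --> X]mulr1; apply: cvgMr.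
have e0 : expR t @[t --> -oo] --> (0 : R).
  have -> : (fun t : R => expR t) = (fun t => expR (- (- t))) by apply/funext => t; rewrite opprK.
  apply: cvg_comp (@cvgr_expR R); apply/cvgryPge => A; near=> t.
  by rewrite lerNr; near: t; apply: nbhs_ninfty_le; exact: num_real.
have z0 : z t @[t --> -oo] --> (0 : R).
  by rewrite -[X in _ --> X](mulr0 (Num.sqrt lambda)); apply: cvgMr.
have ez : expR (- z t) @[t --> -oo] --> (1 : R).
  rewrite -expR0 -oppr0; apply: continuous_cvg; first exact: continuous_expR.
  exact: cvgN.
have ez' : (1 + z t) * expR (- z t) @[t --> -oo] --> (1 : R).
  suff : (1 + z t) * expR (- z t) @[t --> -oo] --> ((1 + 0) * 1 : R) by rewrite addr0 mulr1.
  by apply: cvgM => //; apply: cvgD => //; exact: cvg_cst.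
apply: (squeeze_cvgr _ ez ez'); near=> t.
exact: besselK_bounds.
Unshelve. all: by end_near. Qed.

Lemma zbesselK1_cvg0 : z t * besselK 1 (z t) @[t --> +oo] --> (0 : R).
Proof.
have zoo : z t @[t --> +oo] --> +oo.
  apply/cvgryPge => A; near=> t.
  have sl : 0 < Num.sqrt lambda by rewrite sqrtr_gt0.
  rewrite /z -ler_pdivrMl// (le_trans _ (expR_ge1Dx t))//.
  have : (Num.sqrt lambda)^-1 * A <= t by near: t; apply: nbhs_pinfty_ge; exact: num_real.
  lra.
have h : 2 * expR (- (z t / 2)) @[t --> +oo] --> (0 : R).
  rewrite -[X in _ --> X](mulr0 (2 : R)); apply: cvgMr.
  apply: cvg_comp (@cvgr_expR R); apply/cvgryPge => A; near=> t.
  rewrite ler_pdivlMr//; near: t.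
  by move/cvgryPge : zoo; apply.
apply: (squeeze_cvgr _ (cvg_cst 0) h); near=> t.
have /andP[h1 h2] := besselK_bounds (z_gt0 t).
rewrite (le_trans (expR_ge0 _) h1)/= (le_trans h2)//.
have -> : expR (- z t) = expR (- (z t / 2)) * expR (- (z t / 2)).
  by rewrite -expRD; congr expR; field.
rewrite mulrA ler_wpM2r ?expR_ge0// expRN ler_pdivrMr ?expR_gt0//.
have := expR_ge1Dx (z t / 2); lra.
Unshelve. all: by end_near. Qed.

Lemma dglog_cvg0 : dglog t @[t --> +oo] --> (0 : R).
Proof.
rewrite -oppr0 -[X in _ --> - X](mulr0 ((2 * pi)^-1)); apply: cvgN; apply: cvgMr.
exact: zbesselK1_cvg0.
Qed.

Lemma expR_glog_cvg0 : expR t * glog t @[t --> +oo] --> (0 : R).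
Proof.
pose k := (2 * pi)^-1 / Num.sqrt lambda.
have h : k * (z t * besselK 1 (z t)) @[t --> +oo] --> (0 : R).
  by rewrite -[X in _ --> X](mulr0 k); apply: cvgMr; exact: zbesselK1_cvg0.
have sl : 0 < Num.sqrt lambda by rewrite sqrtr_gt0.
apply: (squeeze_cvgr _ (cvg_cst 0) h); near=> t.
rewrite mulr_ge0 ?expR_ge0 ?(ltW (glog_gt0 t))//=.
have -> : k * (z t * besselK 1 (z t)) = expR t * ((2 * pi)^-1 * besselK 1 (z t)).
  by rewrite /k /z -!mulrA mulKf ?gt_eqF// mulrCA.
by rewrite ler_wpM2l ?expR_ge0// ler_wpM2l ?(ltW pi2_gt0)// besselK_le.
Unshelve. all: by end_near. Qed.

Lemma glog_cvg0 : glog t @[t --> +oo] --> (0 : R).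
Proof.
apply: (squeeze_cvgr _ (cvg_cst 0) expR_glog_cvg0); near=> t.
rewrite (ltW (glog_gt0 t))/= ler_peMl ?(ltW (glog_gt0 t))// -expR0 ler_expR.
by near: t; exact: nbhs_pinfty_ge.
Unshelve. all: by end_near. Qed.

(** A primitive of e^{2t} g^2 in closed form, which the equation g'' = lambda e^{2t} g makes
    available. It tends to 0 at +oo; its upper bound 0 is how the square integrability of the Green
    function at infinity enters. *)
Definition glog_sqr_primitive t : R :=
  expR (2 * t) * glog t ^+ 2 / 2 - dglog t ^+ 2 / (2 * lambda).

Lemma is_derive_glog_sqr_primitive t : is_derive t (1 : R) glog_sqr_primitive (expR (2 * t) * glog t ^+ 2).
Proof.
have h1 := is_derive_glog t; have h2 := is_derive_dglog t.
have h3 := is_derive_expRM 2 t.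
rewrite /glog_sqr_primitive; apply: is_derive_eq; rewrite /GRing.scale/=.
by field; rewrite gt_eqF.
Qed.

Lemma glog_sqr_primitive_le0 t : glog_sqr_primitive t <= 0.
Proof.
rewrite -oppr_ge0; apply: (@cvgy_le_ge0 _ (fun t => - glog_sqr_primitive t)).
  rewrite -oppr0; apply: cvgN.
  suff : glog_sqr_primitive t @[t --> +oo] --> (0 * 0 / 2 - 0 * 0 / (2 * lambda) : R).
    by rewrite !mul0r subrr.
  apply: cvgB; apply: cvgMl.
    have -> : (fun t => expR (2 * t) * glog t ^+ 2) = (fun t => (expR t * glog t) * (expR t * glog t)).
      by apply/funext => s; rewrite expRM_natl; ring.
    by apply: cvgM; exact: expR_glog_cvg0.
  by under eq_fun do rewrite expr2; apply: cvgM; exact: dglog_cvg0.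
move=> s ts; rewrite lerN2.
apply: (derive_ge0_le ts (fun x _ => is_derive_glog_sqr_primitive x)) => x _.
by rewrite mulr_ge0 ?expR_ge0 ?sqr_ge0.
Qed.

End GreenProfile.

(** * Smooth test functions *)

Section Smooth.
Variable R : realType.
Implicit Types (f g : R -> R) (s t x : R).

Lemma is_derive_exprn f k x (d : R) : is_derive x (1 : R) f d ->
  is_derive x (1 : R) (fun y => f y ^+ k) (k%:R * f x ^+ k.-1 * d).
Proof.
move=> df; elim: k => [|k IH].
  by under eq_fun do rewrite expr0; rewrite !mul0r; exact: is_derive_cst.
under eq_fun do rewrite exprS.
apply: is_derive_eq; rewrite /GRing.scale/= -[k.+1%:R]natr1.
by case: k {IH} => [|k]; rewrite ?mul0r ?expr0 /= ?exprS; ring.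
Qed.

Lemma is_derive_sqr_bound f (C e : R) : 0 < e -> f 0 = 0 ->
  (forall x, `|x| < e -> `|f x| <= C * x ^+ 2) -> is_derive (0 : R) (1 : R) f (0 : R).
Proof.
move=> e0 f0 fC.
have h : h^-1 *: ((f \o shift 0) (h *: (1:R)) - f 0) @[h --> 0^'] --> (0 : R).
  apply/cvgrPdist_le => d d0; near=> h.
  have h0 : h != 0 by near: h; exact: nbhs_dnbhs_neq.
  have he : `|h| < e.
    near: h; apply: nbhs_dnbhs; exists e => //= y /=; by rewrite sub0r normrN.
  rewrite sub0r normrN /= f0 subr0 addr0 /GRing.scale/= mulr1 normrM normfV.
  rewrite ler_pdivrMl ?normr_gt0// (le_trans (fC _ he))//.
  have : `|h| < d / (`|C| + 1).
    near: h; apply: nbhs_dnbhs; exists (d / (`|C| + 1)) => /=.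
      by rewrite divr_gt0// ltr_wpDl.
    by move=> y /=; rewrite sub0r normrN.
  have c0 : 0 < `|C| + 1 by rewrite ltr_wpDl.
  rewrite ltr_pdivlMr// => hd.
  have -> : h ^+ 2 = `|h| * `|h| by rewrite -normrM ger0_norm ?expr2// -expr2 sqr_ge0.
  rewrite mulrA [C * _]mulrC -mulrA ler_wpM2l// mulrC.
  apply: le_trans (ltW hd); rewrite ler_wpM2l//.
  by have := ler_norm C; lra.
apply: DeriveDef; first by apply/cvg_ex; exists 0.
exact/cvg_lim.
Unshelve. all: by end_near. Qed.

(* flat k for k > 0 occurs in the derivatives of flat 0 *)
Definition flat (k : nat) x : R := if 0 < x then x^-1 ^+ k * expR (- x^-1) else 0.

Lemma flat_ge0 k x : 0 <= flat k x.
Proof. by rewrite /flat; case: ifPn => // x0; rewrite mulr_ge0 ?expR_ge0// exprn_ge0// invr_ge0 ltW. Qed.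

Lemma flat_gt0 k x : 0 < x -> 0 < flat k x.
Proof. by move=> x0; rewrite /flat x0 mulr_gt0 ?expR_gt0// exprn_gt0// invr_gt0. Qed.

Lemma flat_le0 k x : x <= 0 -> flat k x = 0.
Proof. by rewrite /flat leNgt => /negbTE ->. Qed.

Lemma is_derive_flat k x :
  is_derive x (1 : R) (flat k) (flat k.+2 x - k%:R * flat k.+1 x).
Proof.
have [x0|x0|->] := ltgtP x 0.
- rewrite !flat_le0 ?(ltW x0)// mulr0 subr0.
  apply: (@near_eq_is_derive _ _ _ (cst (0 : R))).
  exists (- x) => /=; first by rewrite oppr_gt0.
  move=> y /=; rewrite ltr_norml => /andP[h1 h2].
  by rewrite flat_le0//; lra.
- have xn : x != 0 by rewrite gt_eqF.
  have dV0 : is_derive x (1 : R) (fun y => y^-1) (- x^-1 ^+ 2).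
    have h := @is_deriveV R id x 1 1 xn (is_derive_id _ _).
    by apply: is_derive_eq; rewrite /GRing.scale/= mulr1 exprVn.
  have dV : is_derive x (1 : R) (fun y => - y^-1) (x^-1 ^+ 2).
    by apply: is_derive_eq; rewrite opprK.
  have dE := @is_derive1_comp R expR (fun y => - y^-1) x _ _ (is_derive_expR _) dV.
  suff dF : is_derive x (1 : R) (fun y => y^-1 ^+ k * expR (- y^-1))
      (flat k.+2 x - k%:R * flat k.+1 x).
    apply: near_eq_is_derive dF; exists x => //= y /=; rewrite ltr_norml => /andP[h1 h2].
    by rewrite /flat ifT//; lra.
  have dP := is_derive_exprn k dV0.
  apply: is_derive_eq.
  rewrite /GRing.scale/= /flat x0.
  by case: k {dP} => [|k]; rewrite ?mul0r ?expr0 /= !exprS; ring.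
- rewrite !flat_le0// mulr0 subr0.
  (* At 0, [pow_expR_le] with 1 / y for y and n = k + 1 bounds [flat k y] by [C] y^2. *)
  pose C : R := (k.+2%:R) ^+ k.+2.
  apply: (@is_derive_sqr_bound _ C 1) => //; first by rewrite flat_le0.
  move=> y _; have [y0|y0] := leP y 0.
    by rewrite flat_le0// normr0 mulr_ge0 ?sqr_ge0// exprn_ge0.
  rewrite ger0_norm ?flat_ge0// /flat y0.
  have iy : 0 < y^-1 by rewrite invr_gt0.
  have := pow_expR_le k.+1 ltr01 iy.
  rewrite divr1 invrK exprS -/C mulN1r -mulrA => h.
  by rewrite expr2 mulrA -ler_pdivrMr// mulrC.
Qed.

(* The quotient is smooth because its numerator vanishes on a neighbourhood of
   ]-oo, 0]; the convention 0^-1 = 0 makes it 0 at 0. *)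
Inductive smooth : (R -> R) -> Prop :=
| smooth_cst c : smooth (cst c)
| smooth_add f g : smooth f -> smooth g -> smooth (fun x => f x + g x)
| smooth_mul f g : smooth f -> smooth g -> smooth (fun x => f x * g x)
| smooth_flat k a b : smooth (fun x => flat k (a * x + b))
| smooth_primitive f g : smooth g -> (forall x, is_derive x (1 : R) f (g x)) -> smooth f
| smooth_quotient f a : smooth f -> 0 < a -> (forall x, x < a -> f x = 0) ->
    smooth (fun x => f x / x).

(** Each constructor differentiates into the same class, so derivatives of all orders exist. In the
    quotient case the derivative of the numerator vanishes on the same half-line, which keeps the
    side condition of [smooth_quotient]. *)
Lemma smooth_derive f : smooth f ->
  exists2 g, smooth g & forall x, is_derive x (1 : R) f (g x).
Proof.
elim => {f} [c|f g sf [f' sf' df] sg [g' sg' dg]|f g sf [f' sf' df] sg [g' sg' dg]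
  |k a b|f g sg _ df|f a sf [f' sf' df] a0 fa].
- by exists (cst 0) => [|x]; [exact: smooth_cst|exact: is_derive_cst].
- exists (fun x => f' x + g' x) => [|x]; first exact: smooth_add.
  by have := df x; have := dg x => ? ?; apply: is_derive_eq.
- exists (fun x => f' x * g x + f x * g' x) => [|x].
    by apply: smooth_add; apply: smooth_mul.
  by have := df x; have := dg x => ? ?; apply: is_derive_eq; rewrite /GRing.scale/=; ring.
- exists (fun x => (flat k.+2 (a * x + b) + (- k%:R) * flat k.+1 (a * x + b)) * a) => [|x].
    apply: smooth_mul; last exact: smooth_cst.
    apply: smooth_add; first exact: smooth_flat.
    by apply: smooth_mul; [exact: smooth_cst|exact: smooth_flat].
  have h : is_derive x (1 : R) (fun x => a * x + b) a.
    by apply: is_derive_eq; rewrite /GRing.scale/=; ring.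
  have := @is_derive1_comp R (flat k) (fun x => a * x + b) x _ _ (is_derive_flat _ _) h.
  by rewrite mulNr.
- by exists g.
- have f'a x : x < a -> f' x = 0.
    move=> xa; have := @derive_val _ _ _ _ _ _ _ (df x) => <-.
    rewrite (@near_eq_derive _ _ _ f (cst 0)) ?derive_cst//.
    exists (a - x) => /=; first by rewrite subr_gt0.
    move=> y /=; rewrite ltr_norml => /andP[h1 h2]; apply: fa; lra.
  exists (fun x => f' x / x + (-1) * (f x / x / x)) => [|x].
    apply: smooth_add; first exact: (smooth_quotient sf' a0).
    apply: smooth_mul; first exact: smooth_cst.
    apply: (smooth_quotient _ a0); first exact: (smooth_quotient sf a0).
    by move=> x xa; rewrite fa// mul0r.
  have [xa|ax] := ltP x a.
    rewrite f'a// fa// !mul0r mulr0 addr0.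
    apply: (@near_eq_is_derive _ _ _ (cst (0 : R))).
    exists (a - x) => /=; first by rewrite subr_gt0.
    by move=> y /=; rewrite ltr_norml => /andP[h1 h2]; rewrite fa ?mul0r//; lra.
  have xn : x != 0 by rewrite gt_eqF// (lt_le_trans a0).
  have dV := @is_deriveV R id x 1 1 xn (is_derive_id _ _).
  have := df x => {}df.
  by apply: is_derive_eq; rewrite /GRing.scale/=; field.
Qed.

Lemma smooth_continuous f : smooth f -> continuous f.
Proof. by move=> /smooth_derive[g _ df] x; exact: is_derive_continuous (df x). Qed.

Lemma flat_le1 x : flat 0 x <= 1.
Proof.
rewrite /flat; case: ifP => // x0.
by rewrite expr0 mul1r -expR0 ler_expR oppr_le0 invr_ge0 ltW.
Qed.

Lemma le_flat0 s t : s <= t -> flat 0 s <= flat 0 t.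
Proof.
move=> st; have [s0|s0] := leP s 0; first by rewrite (@flat_le0 0 s)// flat_ge0.
rewrite /flat s0 (lt_le_trans s0)// !expr0 !mul1r ler_expR lerN2 lef_pV2//.
by rewrite posrE (lt_le_trans s0).
Qed.

Definition bump x r s : R := flat 0 ((s - x) / r + 1) * flat 0 (1 - (s - x) / r).

Lemma smooth_bump x r : smooth (bump x r).
Proof.
apply: smooth_mul.
  have -> : (fun s => flat 0 ((s - x) / r + 1)) = (fun s => flat 0 (r^-1 * s + (1 - x / r))).
    by apply/funext => s; congr flat; ring.
  exact: smooth_flat.
have -> : (fun s => flat 0 (1 - (s - x) / r)) = (fun s => flat 0 ((- r^-1) * s + (1 + x / r))).
  by apply/funext => s; congr flat; ring.
exact: smooth_flat.
Qed.

Lemma bump_ge0 x r s : 0 <= bump x r s.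
Proof. by rewrite mulr_ge0 ?flat_ge0. Qed.

Lemma bump_le1 x r s : bump x r s <= 1.
Proof. by rewrite -[leRHS]mulr1 ler_pM ?flat_ge0 ?flat_le1. Qed.

Lemma bump_gt0 x r s : 0 < r -> `|s - x| < r -> 0 < bump x r s.
Proof.
move=> r0; rewrite ltr_norml => /andP[h1 h2].
have e1 : - 1 < (s - x) / r by rewrite ltr_pdivlMr//; lra.
have e2 : (s - x) / r < 1 by rewrite ltr_pdivrMr//; lra.
by rewrite mulr_gt0// flat_gt0//; lra.
Qed.

Lemma bump_eq0 x r s : 0 < r -> r <= `|s - x| -> bump x r s = 0.
Proof.
move=> r0; rewrite ler_normr => /orP[h|h].
  have e : 1 <= (s - x) / r by rewrite ler_pdivlMr//; lra.
  by rewrite /bump (@flat_le0 _ (_ - _)) ?mulr0//; lra.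
have e : (s - x) / r <= - 1 by rewrite ler_pdivrMr//; lra.
by rewrite /bump flat_le0 ?mul0r//; lra.
Qed.

(** A lower bound for every bump on the middle half of its support, the same for all centres and
    radii: the Lebesgue point argument lets the radius shrink. *)
Definition bump_floor : R := flat 0 2^-1 * flat 0 2^-1.

Lemma bump_floor_gt0 : 0 < bump_floor.
Proof. by rewrite mulr_gt0// flat_gt0 ?invr_gt0. Qed.

Lemma bump_floor_le x r s : 0 < r -> `|s - x| <= r / 2 -> bump_floor <= bump x r s.
Proof.
move=> r0; rewrite ler_norml => /andP[h1 h2].
have e1 : - 2^-1 <= (s - x) / r by rewrite ler_pdivlMr//; lra.
have e2 : (s - x) / r <= 2^-1 by rewrite ler_pdivrMr//; lra.
by apply: ler_pM; rewrite ?flat_ge0//; apply: le_flat0; lra.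
Qed.

End Smooth.

(** * Smooth functions on the plane *)

Section PlaneCalculus.
Variable R : realType.
Implicit Types (f : R * R -> R) (x v : R * R).

(** Reduces derivatives along a vector to derivatives in one variable, where the chain rule
    applies. *)
Lemma is_derive_lineP f x v (d : R) :
  is_derive (0 : R) (1 : R) (fun t => f (t *: v + x)) d <-> is_derive x v f d.
Proof.
have e : (fun h : R => h^-1 *: ((f \o shift x) (h *: v) - f x)) =
    (fun h => h^-1 *: (((fun t => f (t *: v + x)) \o shift 0) (h *: (1 : R)) - f (0 *: v + x))).
  by apply/funext => h; rewrite /= scale0r add0r addr0 [h *: 1]mulr1.
split=> -[h1 h2].
  by apply: DeriveDef; rewrite ?/derivable ?/derive e.
by apply: DeriveDef; move: h1 h2; rewrite /derivable /derive e.
Qed.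

Inductive smooth2 : (R * R -> R) -> Prop :=
| smooth2_cst c : smooth2 (cst c)
| smooth2_fst : smooth2 fst
| smooth2_snd : smooth2 snd
| smooth2_add f g : smooth2 f -> smooth2 g -> smooth2 (fun x => f x + g x)
| smooth2_mul f g : smooth2 f -> smooth2 g -> smooth2 (fun x => f x * g x)
| smooth2_comp (h : R -> R) f : smooth h -> smooth2 f -> smooth2 (fun x => h (f x)).

Lemma smooth2_continuous f : smooth2 f -> continuous f.
Proof.
elim => {f} [c|||f g _ cf _ cg|f g _ cf _ cg|h f sh _ cf] x.
- exact: cst_continuous.
- exact: cvg_fst.
- exact: cvg_snd.
- exact: (cvgD (cf x) (cg x)).
- exact: (cvgM (cf x) (cg x)).
- by apply: continuous_comp; [exact: cf|exact: smooth_continuous].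
Qed.

Lemma smooth2_derive f v : smooth2 f ->
  exists2 g, smooth2 g & forall x, is_derive x v f (g x).
Proof.
elim => {f} [c|||f g sf [f' sf' df] sg [g' sg' dg]|f g sf [f' sf' df] sg [g' sg' dg]
  |h f sh sf [f' sf' df]].
- by exists (cst 0) => [|x]; [exact: smooth2_cst|exact: is_derive_cst].
- exists (cst v.1) => [|x]; first exact: smooth2_cst.
  by apply/is_derive_lineP => /=; apply: is_derive_eq; rewrite /GRing.scale/=; ring.
- exists (cst v.2) => [|x]; first exact: smooth2_cst.
  by apply/is_derive_lineP => /=; apply: is_derive_eq; rewrite /GRing.scale/=; ring.
- exists (fun x => f' x + g' x) => [|x]; first exact: smooth2_add.
  by have := df x; have := dg x => ? ?; apply: is_derive_eq.
- exists (fun x => f' x * g x + f x * g' x) => [|x].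
    by apply: smooth2_add; apply: smooth2_mul.
  by have := df x; have := dg x => ? ?; apply: is_derive_eq; rewrite /GRing.scale/=; ring.
- have [h' sh' dh] := smooth_derive sh.
  exists (fun x => h' (f x) * f' x) => [|x].
    by apply: smooth2_mul => //; exact: smooth2_comp.
  apply/is_derive_lineP; have /is_derive_lineP k := df x.
  have := @is_derive1_comp R h (fun t => f (t *: v + x)) 0 _ _ (dh _) k.
  by rewrite scale0r add0r.
Qed.

Lemma smooth2_Ck f n : smooth2 f -> Ck n f.
Proof.
elim: n f => [|n IH] f sf; split => //; try exact: smooth2_continuous.
move=> i; have [g sg dg] := smooth2_derive (basis_vec R i) sf; split.
  by move=> x; exact: ex_derive.
have -> : (fun x => 'D_(basis_vec R i) f x) = g by apply/funext => x; exact: derive_val.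
exact: IH.
Qed.

Lemma test_function_smooth2 f (M : R) : smooth2 f ->
  (forall x, M <= x.1 ^+ 2 + x.2 ^+ 2 -> f x = 0) -> test_function f.
Proof.
move=> sf fM; split; first by move=> n; exact: smooth2_Ck.
pose m := `|M| + 1.
have cm : compact (`[- m, m]%classic `*` `[- m, m]%classic : set (R * R)).
  by apply: compact_setX; exact: segment_compact.
have clm : closed (`[- m, m]%classic `*` `[- m, m]%classic : set (R * R)).
  apply: compact_closed => //.
apply: (subclosed_compact _ cm); first exact: closed_closure.
rewrite ((closure_id _).1 clm); apply: closure_subset => x /=.
move=> fx; have : x.1 ^+ 2 + x.2 ^+ 2 < M.
  by rewrite ltNge; apply: contra fx => /fM ->.
have := ler_norm M; rewrite -/m => h1 h2.
have [m0 m2] : 1 <= m /\ M <= m ^+ 2 by rewrite /m; split; have := normr_ge0 M; nra.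
have := sqr_ge0 x.1; have := sqr_ge0 x.2 => h3 h4.
rewrite /= !in_itv/=; split; rewrite -ler_norml -(@ler_pXn2r _ 2)// ?nnegrE//; try lra.
  by rewrite real_normK ?num_real//; lra.
by rewrite real_normK ?num_real//; lra.
Qed.

End PlaneCalculus.

(** * Radial integration *)

Section IntegralComplements.
Context d (T : measurableType d) (R : realType) (mu : {measure set T -> \bar R}).
Implicit Types (D : set T) (f g : T -> R).

(** One of the positive and negative parts has infinite integral, so their difference is infinite,
    by convention also for oo - oo, and [fine] sends it to 0. A divergent right-hand side of the
    weak equation is therefore silently 0. *)
Lemma Rintegral_nonintegrable D f : measurable D -> measurable_fun D f ->
  ~ mu.-integrable D (EFin \o f) -> \int[mu]_(x in D) f x = 0.
Proof.
move=> mD mf nif; have mF : measurable_fun D (EFin \o f) by exact/measurable_EFinP.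
rewrite /Rintegral integralE.
have h : (\int[mu]_(x in D) (EFin \o f)^\+ x + \int[mu]_(x in D) (EFin \o f)^\- x = +oo)%E.
  rewrite -ge0_integralD//; [|exact: measurable_funepos|exact: measurable_funeneg].
  apply/eqP; rewrite eq_le leey/= leye_eq; apply/negPn/negP => h; apply: nif.
  apply/integrableP; split => //; rewrite ltey; apply: contra h => /eqP <-.
  by apply/eqP; apply: eq_integral => x _; rewrite -[RHS]/((abse \o (EFin \o f)) x) fune_abse.
have h1 : (0 <= \int[mu]_(x in D) (EFin \o f)^\+ x)%E by exact: integral_ge0.
have h2 : (0 <= \int[mu]_(x in D) (EFin \o f)^\- x)%E by exact: integral_ge0.
move: h h1 h2; change (fun x => (f x)%:E) with (EFin \o f).
by case: (\int[mu]_(x in D) _)%E => [a| |]; case: (\int[mu]_(x in D) _)%E => [b| |].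
Qed.

Lemma measurable_sqr_fun f : measurable_fun setT f -> measurable_fun setT (fun x => f x ^+ 2).
Proof. by move=> mf; apply: measurable_funX. Qed.

Lemma measurable_mul_fun f g : measurable_fun setT f -> measurable_fun setT g ->
  measurable_fun setT (fun x => f x * g x).
Proof. by move=> mf mg; apply: measurable_funM. Qed.

Lemma ae_eq_Rintegral f g : measurable_fun setT f -> measurable_fun setT g ->
  {ae mu, forall x, f x = g x} -> \int[mu]_x f x = \int[mu]_x g x.
Proof.
move=> mf mg fg; congr fine; apply: ae_eq_integral => //; [exact/measurable_EFinP|exact/measurable_EFinP|].
by apply: (@filterS _ _ (ae_filter_ringOfSetsType mu)) fg => x /= -> _.
Qed.

Lemma ae_eq_integrable f g : measurable_fun setT f -> measurable_fun setT g ->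
  {ae mu, forall x, f x = g x} -> mu.-integrable setT (EFin \o f) ->
  mu.-integrable setT (EFin \o g).
Proof.
move=> mf mg fg /integrableP[_ fi]; apply/integrableP; split; first exact/measurable_EFinP.
rewrite (_ : integral _ _ _ = \int[mu]_x `|(f x)%:E|)%E//.
apply: ae_eq_integral => //.
- by apply: measurableT_comp => //; exact/measurable_EFinP.
- by apply: measurableT_comp => //; exact/measurable_EFinP.
by apply: (@filterS _ _ (ae_filter_ringOfSetsType mu)) fg => x /= -> _.
Qed.

End IntegralComplements.

(** * The image of planar Lebesgue measure under |x|^2 *)

Section PolarMeasure.
Variable R : realType.
Notation mu := (@lebesgue_measure R).
Local Notation leb2 := (mu \x mu)%E.
Local Notation RB := (measurableTypeR R).
Local Notation R2 := (measurableTypeR R * measurableTypeR R)%type.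
Implicit Types (s t : R) (x : R * R).

(** The square of the norm is preferred to the norm because it is smooth at the origin and carries
    planar Lebesgue measure to a constant multiple of Lebesgue measure on the half-line, with no
    weight. *)
Definition sqnorm x : R := x.1 ^+ 2 + x.2 ^+ 2.

Lemma sqnorm_ge0 x : 0 <= sqnorm x.
Proof. by rewrite addr_ge0 ?sqr_ge0. Qed.

Lemma sqnorm_eq0 x : (sqnorm x == 0) = (x == 0).
Proof. by rewrite /sqnorm paddr_eq0 ?sqr_ge0// !sqrf_eq0; case: x. Qed.

Lemma smooth2_sqnorm : smooth2 sqnorm.
Proof.
apply: smooth2_add; under eq_fun do rewrite expr2; apply: smooth2_mul.
- exact: smooth2_fst.
- exact: smooth2_fst.
- exact: smooth2_snd.
- exact: smooth2_snd.
Qed.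

Lemma measurable_sqnorm : measurable_fun (setT : set R2) (sqnorm : R2 -> RB).
Proof.
by apply: measurable_funD; apply: measurable_funX; [exact: measurable_fst|exact: measurable_snd].
Qed.

Let disc s : set R2 := [set x | sqnorm x <= s].

Let mdisc s : measurable (disc s).
Proof.
have := measurable_sqnorm measurableT (measurable_itv `]-oo, s]).
by rewrite setTI; congr measurable; apply/seteqP; split => x; rewrite /= in_itv.
Qed.

Let chord s t : R := 2 * Num.sqrt (s - t ^+ 2).

Let xsection_disc s t : mu (xsection (disc s) t) = (chord s t)%:E.
Proof.
have [h|h] := leP 0 (s - t ^+ 2).
  have -> : xsection (disc s) t = `[- Num.sqrt (s - t ^+ 2), Num.sqrt (s - t ^+ 2)]%classic.
    apply/seteqP; split => y; rewrite /xsection /= inE /disc /= in_itv/= -ler_norml /sqnorm/=.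
      move=> k; rewrite -(@ler_pXn2r _ 2)// ?nnegrE// ?sqrtr_ge0// real_normK ?num_real// sqr_sqrtr//; lra.
    rewrite -(@ler_pXn2r _ 2)// ?nnegrE// ?sqrtr_ge0// real_normK ?num_real// sqr_sqrtr//; lra.
  rewrite lebesgue_measure_itv/= lte_fin /chord; case: ifPn => k.
    by rewrite -EFinB opprK mulr_natl mulr2n.
  have : Num.sqrt (s - t ^+ 2) = 0.
    by apply/eqP; rewrite eq_le sqrtr_ge0 andbT; move: k; rewrite -leNgt; lra.
  by move=> ->; rewrite mulr0.
have -> : xsection (disc s) t = set0.
  apply/seteqP; split => y //; rewrite /xsection /= inE /disc /= /sqnorm/=.
  by have := sqr_ge0 y; lra.
by rewrite measure0 /chord ler0_sqrtr ?mulr0// ltW.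
Qed.

Let disc_area s : leb2 (disc s) = (\int[mu]_t (chord s t)%:E)%E.
Proof. by apply: eq_integral => t _; rewrite /= xsection_disc. Qed.

(** The area of the unit disc, kept as a constant that enters both solutions alike. *)
Definition polar_const : R := fine (leb2 [set x : R2 | sqnorm x <= 1]).

Let K := polar_const.

Let square (a b : R) : (mu \x mu)%E ((`[a, b]%classic : set RB) `*` (`[a, b]%classic : set RB)) =
  (mu `[a, b] * mu `[a, b])%E.
Proof. by apply: product_measure1E. Qed.

Let disc1E : leb2 (disc 1) = K%:E.
Proof.
rewrite fineK// ge0_fin_numE//.
apply: (@le_lt_trans _ _ (leb2 ((`[-1, 1]%classic : set RB) `*` (`[-1, 1]%classic : set RB)))).
  apply: le_measure; rewrite ?inE; [exact: (mdisc 1)|by apply: measurableX|].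
  move=> x; rewrite /sqnorm /= => h; rewrite !in_itv/= -!ler_norml.
  have h1 := sqr_ge0 x.1; have h2 := sqr_ge0 x.2.
  by split; rewrite -(@ler_pXn2r _ 2)// ?nnegrE// expr1n real_normK ?num_real//; lra.
rewrite square lebesgue_measure_itv/=.
by case: ifPn => _; rewrite -?EFinB -?EFinM ?mule0 ltry.
Qed.

Lemma polar_const_gt0 : 0 < polar_const.
Proof.
rewrite -lte_fin -disc1E.
apply: (@lt_le_trans _ _ (leb2 ((`[0, 2^-1]%classic : set RB) `*` (`[0, 2^-1]%classic : set RB)))).
  rewrite square lebesgue_measure_itv/= lte_fin invr_gt0 ltr0n/=.
  by rewrite -EFinB -EFinM lte_fin mulr_gt0 ?subr0.
apply: le_measure; rewrite ?inE//; first by apply: measurableX.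
move=> x; rewrite /disc /sqnorm /= !in_itv/= => -[/andP[h1 h2] /andP[h3 h4]].
by nra.
Qed.

(** The substitution t = sqrt(s) y turns the chord length at radius sqrt(s) into s times the one at
    radius 1, Jacobian included. *)
Let disc_areaE s : 0 <= s -> leb2 (disc s) = (K * s)%:E.
Proof.
rewrite le_eqVlt => /predU1P[<-|s0].
  rewrite disc_area mulr0 integral0_eq// => t _; rewrite /chord ler0_sqrtr ?mulr0//.
  by rewrite sub0r oppr_le0 sqr_ge0.
have ss : 0 < Num.sqrt s by rewrite sqrtr_gt0.
have cc r : continuous (chord r).
  move=> t; apply: cvgMr; apply: continuous_comp.
    by apply: cvgB; [exact: cvg_cst|exact: exprn_continuous].
  exact: sqrt_continuous.
have dF : derive1 (fun y => Num.sqrt s * y) = cst (Num.sqrt s).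
  apply/funext => y; rewrite derive1E; apply: derive_val.
  by apply: is_derive_eq; rewrite /GRing.scale/= mulr1.
rewrite disc_area.
rewrite (@increasing_ge0_integration_by_substitutionT _ (fun y => Num.sqrt s * y) (chord s)).
- rewrite dF.
  transitivity (\int[mu]_x (s%:E * (chord 1 x)%:E))%E.
    apply: eq_integral => t _; rewrite -EFinM; congr EFin.
    transitivity (chord s (Num.sqrt s * t) * Num.sqrt s) => //.
    rewrite /chord exprMn sqr_sqrtr ?(ltW s0)//.
    have -> : s - s * t ^+ 2 = s * (1 - t ^+ 2) by ring.
    by rewrite sqrtrM ?(ltW s0)// -[in X in _ = X * _](sqr_sqrtr (ltW s0)); ring.
  rewrite ge0_integralZl//.
  + by rewrite -disc_area disc1E -EFinM mulrC.
  + by apply/measurable_EFinP; exact: continuous_measurable_fun.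
  + by move=> t _; rewrite lee_fin mulr_ge0 ?sqrtr_ge0.
  + by rewrite lee_fin ltW.
- by move=> x y xy; rewrite ltr_pM2l.
- by rewrite dF => x; exact: cst_continuous.
- by rewrite dF; exact: is_cvg_cst.
- by rewrite dF; exact: is_cvg_cst.
- by move=> x; apply: ex_derive.
- apply/cvgrNyPle => M; near=> t.
  rewrite -ler_pdivlMl//; near: t; apply: nbhs_ninfty_le; exact: num_real.
- apply/cvgryPge => M; near=> t.
  rewrite -ler_pdivrMl//; near: t; apply: nbhs_pinfty_ge; exact: num_real.
- exact: cc.
- by move=> t; rewrite mulr_ge0 ?sqrtr_ge0.
Unshelve. all: by end_near. Qed.

Let mpre (A : set RB) : measurable A -> measurable (sqnorm @^-1` A : set R2).
Proof. by move=> mA; rewrite -[X in measurable X]setTI; exact: measurable_sqnorm. Qed.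

Let push_itv (a b : R) : a < b ->
  leb2 (sqnorm @^-1` `]a, b]) = (K * (Num.max b 0 - Num.max a 0))%:E.
Proof.
move=> ab.
have [b0|b0] := leP b 0.
  have /max_idPr -> : a <= 0 by rewrite (le_trans (ltW ab)).
  rewrite subrr mulr0; apply/eqP; rewrite -measure_le0.
  rewrite -[leRHS](_ : leb2 (disc 0) = _); last by rewrite disc_areaE// mulr0.
  apply: le_measure; rewrite ?inE//; first exact: mpre.
  by move=> x; rewrite /disc /= in_itv/= => /andP[_ /le_trans]; apply.
have -> : sqnorm @^-1` `]a, b] = disc b `\` disc a.
  apply/seteqP; split => x; rewrite /disc /= in_itv/=.
    by move=> /andP[h1 h2]; split => //; apply/negP; rewrite -ltNge.
  by move=> [-> /negP]; rewrite -ltNge => ->.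
have -> : leb2 (disc b `\` disc a) = (leb2 (disc b) - leb2 (disc b `&` disc a))%E.
  by apply: measureD => //; rewrite -[ltLHS]/(leb2 (disc b)) disc_areaE ?ltry// ltW.
have -> : disc b `&` disc a = disc a.
  by apply/setIidr => x; rewrite /disc /= => /le_trans; apply; exact: ltW.
rewrite disc_areaE ?(ltW b0)//; have [a0|a0] := leP a 0; last first.
  by rewrite disc_areaE ?(ltW a0)// -EFinB -mulrBr.
have -> : leb2 (disc a) = 0%E.
  apply/eqP; rewrite -measure_le0.
  rewrite -[leRHS](_ : leb2 (disc 0) = _); last by rewrite disc_areaE// mulr0.
  apply: le_measure; rewrite ?inE//.
  by move=> x; rewrite /disc /= => /le_trans; apply.
by rewrite sube0 subr0.
Qed.

Let push : {measure set RB -> \bar R} :=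
  measure_function_pushforward__canonical__measure_function_Measure leb2 measurable_sqnorm.

Let Ki0 : 0 <= K^-1.
Proof. by rewrite invr_ge0 ltW// polar_const_gt0. Qed.

(** Uniqueness of Lebesgue measure concerns measures on the whole line, while the normalised image
    measure charges only [0, +oo[; Lebesgue measure on ]-oo, 0] is added to complete it. *)
Let m' : {measure set RB -> \bar R} :=
  measure_add (mscale (NngNum Ki0) push) (mrestr mu (measurable_itv `]-oo, 0])).

Let m'E (A : set RB) : m' A = (K^-1%:E * leb2 (sqnorm @^-1` A) + mu (A `&` `]-oo, 0%R]))%E.
Proof. exact: (@measure_addE _ _ _ (mscale (NngNum Ki0) push) (mrestr mu (measurable_itv `]-oo, 0])) A). Qed.

Lemma polar_measure (A : set RB) : measurable A -> A `<=` `]0, +oo[%classic ->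
  leb2 (sqnorm @^-1` A) = (K%:E * mu A)%E.
Proof.
move=> mA A0; have K0 := polar_const_gt0.
have h : mu A = m' A.
  apply: lebesgue_measure_unique => // _ [[a b] _ <-] /=; rewrite m'E.
  have [ba|ab] := leP b a.
    by rewrite set_itv_ge ?bnd_simp -?leNgt// preimage_set0 set0I !measure0 mule0 adde0.
  rewrite push_itv// -EFinM mulrA mulVf ?gt_eqF// mul1r.
  have -> : `]a, b]%classic `&` `]-oo, 0]%classic = `]a, Num.min b 0]%classic.
    apply/seteqP; split => x; rewrite /= !in_itv/= le_min.
      by move=> [/andP[-> ->] ->].
    by move=> /and3P[-> -> ->].
  rewrite !lebesgue_measure_itv/= !lte_fin ab -EFinB.
  have [b0|b0] := leP b 0.
    by rewrite ab -EFinB (max_idPr (_ : a <= 0)) ?subrr ?add0e// (le_trans (ltW ab)).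
  have [a0|a0] := ltP a 0.
    by rewrite -EFinB -EFinD; congr EFin; ring.
  by rewrite adde0.
rewrite h m'E.
have -> : A `&` `]-oo, 0]%classic = set0.
  apply/seteqP; split => x //= -[/A0]; rewrite /= !in_itv/= andbT => x0.
  by rewrite leNgt x0.
rewrite measure0 adde0 muleA -EFinM divff ?mul1e// gt_eqF//.
Qed.

Let measurable_origin : measurable ([set 0] : set R2).
Proof.
rewrite (_ : [set 0] = ([set 0] : set RB) `*` ([set 0] : set RB)).
  by apply: measurableX; exact: measurable_set1.
by apply/seteqP; split => [x ->//|[x y] [/= -> ->]].
Qed.

Lemma polar_null0 : leb2 [set 0] = 0%E.
Proof.
apply/eqP; rewrite -measure_le0.
rewrite -[leRHS](_ : leb2 (disc 0) = _); last by rewrite disc_areaE// mulr0.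
apply: le_measure; rewrite ?inE//.
by move=> x /= ->; rewrite /disc /= /sqnorm /= expr0n /= addr0.
Qed.

Let pre0 : sqnorm @^-1` `]0, +oo[ = ~` [set 0].
Proof.
apply/seteqP; split => x /=; rewrite in_itv/= andbT => h.
  by move=> x0; move: h; rewrite x0 /sqnorm /= expr0n /= addr0 ltxx.
by rewrite lt_neqAle sqnorm_ge0 andbT eq_sym sqnorm_eq0; apply/eqP.
Qed.

Lemma polar_ge0_integral (f : R -> \bar R) : measurable_fun (setT : set RB) f ->
  (forall s, 0 <= f s)%E ->
  (\int[leb2]_x f (sqnorm x) = K%:E * \int[mu]_(s in `]0%R, +oo[) f s)%E.
Proof.
move=> mf f0; have K0 := polar_const_gt0.
have mD : measurable (`]0, +oo[%classic : set RB) by exact: measurable_itv.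
have h := @ge0_integral_pushforward _ _ _ _ _ _ measurable_sqnorm leb2 `]0, +oo[%classic f mD
  (measurable_funTS mf) (fun y _ => f0 y).
have mN := measurable_origin.
have mfq : measurable_fun (setT : set R2) (f \o sqnorm).
  by apply: measurableT_comp mf measurable_sqnorm.
rewrite (@ge0_negligible_integral _ _ _ leb2 setT [set 0])//; last exact: polar_null0.
rewrite setTD -pre0 -h.
rewrite -(@ge0_integral_mscale _ _ _ mu _ mD (NngNum (ltW K0)) _ (measurable_funTS mf))//.
apply: (@eq_measure_integral _ _ _ _ _ push) => A mA A0.
by rewrite /mscale /=; exact: polar_measure.
Qed.

Lemma polar_integrable (f : R -> R) : measurable_fun (setT : set RB) (f : RB -> RB) ->
  leb2.-integrable setT (EFin \o (f \o sqnorm)) <-> mu.-integrable `]0, +oo[ (EFin \o f).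
Proof.
move=> mf; have K0 := polar_const_gt0.
have mnf : measurable_fun (setT : set RB) (fun s => `|(f s)%:E|%E).
  by apply: measurableT_comp => //; exact/measurable_EFinP.
have h := polar_ge0_integral mnf (fun s => abse_ge0 _).
have mfq : measurable_fun (setT : set R2) (EFin \o (f \o sqnorm)).
  by apply/measurable_EFinP; apply: measurableT_comp mf measurable_sqnorm.
split=> /integrableP [_ fi]; apply/integrableP; split => //.
- by apply/measurable_EFinP; exact: measurable_funTS.
- have := fi; rewrite [X in (X < _)%E](_ : _ = (\int[leb2]_x `|(f (sqnorm x))%:E|)%E)// h.
  by rewrite !ltey; apply: contraNneq => ->; rewrite mulry gtr0_sg// mul1e.
- rewrite [X in (X < _)%E](_ : _ = (\int[leb2]_x `|(f (sqnorm x))%:E|)%E)// h.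
  by rewrite lte_mul_pinfty// lee_fin ltW.
Qed.

Let polar_Rintegral_integrable (f : R -> R) : measurable_fun (setT : set RB) (f : RB -> RB) ->
  mu.-integrable `]0, +oo[ (EFin \o f) ->
  \int[leb2]_x f (sqnorm x) = polar_const * \int[mu]_(s in `]0, +oo[) f s.
Proof.
move=> mf fi; have fqi := (polar_integrable mf).2 fi.
have mF : measurable_fun (setT : set RB) (EFin \o f) by exact/measurable_EFinP.
rewrite /Rintegral -[polar_const]/(fine polar_const%:E) -fineM//; last exact: integrable_fin_num.
congr fine; rewrite integralE [in RHS]integralE.
have P := polar_ge0_integral (measurable_funepos mF) (funepos_ge0 _).
have N := polar_ge0_integral (measurable_funeneg mF) (funeneg_ge0 _).
rewrite [X in (X - _)%E](_ : _ = (\int[leb2]_x ((EFin \o f)^\+ (sqnorm x)))%E).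
rewrite [X in (_ - X)%E](_ : _ = (\int[leb2]_x ((EFin \o f)^\- (sqnorm x)))%E); last first.
  by apply: eq_integral => x _; rewrite !funenegE.
have ad := @integrable_add_def _ _ _ mu _ (measurable_itv _) _ fi.
  by rewrite P N -(@muleBr _ K%:E _ _ isT ad).
by apply: eq_integral => x _; rewrite !funeposE.
Qed.

(** Both sides diverge together, and both are then 0 by convention. *)
Lemma polar_Rintegral (f : R -> R) : measurable_fun (setT : set RB) (f : RB -> RB) ->
  \int[leb2]_x f (sqnorm x) = polar_const * \int[mu]_(s in `]0, +oo[) f s.
Proof.
move=> mf; have [fi|nfi] := pselect (mu.-integrable `]0, +oo[ (EFin \o f)).
  exact: polar_Rintegral_integrable.
rewrite (@Rintegral_nonintegrable _ _ _ mu)//; last exact: measurable_funTS.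
rewrite mulr0; apply: Rintegral_nonintegrable => //.
  by apply: (measurableT_comp mf); exact: measurable_sqnorm.
by move=> h; apply: nfi; exact: (polar_integrable mf).1.
Qed.

Lemma ae_neq0 : {ae leb2, forall x, x != 0}.
Proof.
exists ([set 0] : set R2); split; [exact: measurable_origin|exact: polar_null0|].
by move=> x /= /negP; rewrite negbK => /eqP.
Qed.

Lemma polar_ae (P : set R) : {ae mu, forall s, 0 < s -> P s} ->
  {ae leb2, forall x, x != 0 -> P (sqnorm x)}.
Proof.
move=> [N [mN N0 NP]].
have mD : measurable (`]0, +oo[%classic : set RB) by exact: measurable_itv.
exists (sqnorm @^-1` (N `&` `]0, +oo[)); split.
- by apply: mpre; exact: measurableI.
- rewrite polar_measure; [|exact: measurableI|by move=> x []].
  have -> : mu (N `&` `]0, +oo[%classic) = 0%E.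
    by apply: (subset_measure0 _ mN _ N0); [exact: measurableI|move=> x []].
  by rewrite mule0.
- move=> x /= h; have [x0 Px] : x != 0 /\ ~ P (sqnorm x).
    by split; [apply/negP => x0; apply: h; rewrite x0|move=> Px; apply: h].
  have q0 : 0 < sqnorm x by rewrite lt_neqAle sqnorm_ge0 andbT eq_sym sqnorm_eq0.
  by split; [apply: NP => /= k; apply: Px; exact: k|rewrite /= in_itv/= q0].
Qed.

End PolarMeasure.

(** * Weak derivatives in the plane *)

Section PlaneIntegration.
Variable R : realType.
Notation mu := (@lebesgue_measure R).
Local Notation leb2 := (mu \x mu)%E.
Local Notation RB := (measurableTypeR R).
Local Notation R2 := (measurableTypeR R * measurableTypeR R)%type.
Implicit Types (f g : R * R -> R) (x : R * R).

(** Pairs carry the product sigma-algebra; an open set belongs to it as a countable union of boxes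
    with rational ends. *)
Lemma open_measurable2 (U : set (R * R)) : open U -> measurable (U : set R2).
Proof.
move=> oU.
pose box (a b c d : rat) : set R2 :=
  (`]ratr a, ratr b[%classic : set RB) `*` (`]ratr c, ratr d[%classic : set RB).
pose F a b c d := if `[< box a b c d `<=` U >] then box a b c d else set0.
have -> : U = \bigcup_a \bigcup_b \bigcup_c \bigcup_d F a b c d.
  apply/seteqP; split => x; last first.
    by move=> [a _ [b _ [c _ [d _]]]]; rewrite /F; case: ifPn => // /asboolP; apply.
  move=> Ux; have /nbhs_ballP[e /= e0 eU] := open_nbhs_nbhs (conj oU Ux).
  have [a] := @rat_in_itvoo R (x.1 - e) x.1 ltac:(lra).
  have [b] := @rat_in_itvoo R x.1 (x.1 + e) ltac:(lra).
  have [c] := @rat_in_itvoo R (x.2 - e) x.2 ltac:(lra).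
  have [d] := @rat_in_itvoo R x.2 (x.2 + e) ltac:(lra).
  rewrite !in_itv/= => /andP[d1 d2] /andP[c1 c2] /andP[b1 b2] /andP[a1 a2].
  exists a => //; exists b => //; exists c => //; exists d => //.
  rewrite /F asboolT; first by split; rewrite /= in_itv/= ?a2 ?b1 ?c2 ?d1.
  move=> y [] /=; rewrite !in_itv/= => /andP[h1 h2] /andP[h3 h4].
  by apply: eU; split; rewrite /ball/= ltr_distl; lra.
do 4 (apply: bigcupT_measurable_rat => ?).
rewrite /F; case: ifPn => _; last exact: measurable0.
by apply: measurableX; exact: measurable_itv.
Qed.

Lemma continuous_measurable_fun2 f :
  continuous f -> measurable_fun (setT : set R2) (f : R2 -> RB).
Proof.
move=> /continuousP cf; apply: (measurability _ (RGenOpens.measurableE R)) => //.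
move=> _ [_ [a [b ->] <-]]; rewrite setTI.
by apply: open_measurable2; apply/cf/interval_open.
Qed.

Lemma continuous_slicel f (y : R) : continuous f -> continuous (fun t => f (t, y)).
Proof.
move=> cf t; apply: continuous_comp (cf _).
exact: (cvg_pair (@cvg_id _ (nbhs t)) (@cvg_cst _ y _ _ _)).
Qed.

Lemma continuous_slicer f (y : R) : continuous f -> continuous (fun t => f (y, t)).
Proof.
move=> cf t; apply: continuous_comp (cf _).
exact: (cvg_pair (@cvg_cst _ y _ _ _) (@cvg_id _ (nbhs t))).
Qed.

Section Vanishing.
Variables (M : R).

Let m : R := `|M| + 1.

Let m0 : 0 < m.
Proof. by rewrite /m; have := normr_ge0 M; lra. Qed.

Let mM x : m <= `|x.1| \/ m <= `|x.2| -> M <= sqnorm x.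
Proof.
have h : M <= m ^+ 2 by rewrite /m; have := normr_ge0 M; have := ler_norm M; nra.
rewrite /sqnorm -(real_normK (num_real x.1)) -(real_normK (num_real x.2)).
have := sqr_ge0 `|x.1|; have := sqr_ge0 `|x.2|; have h0 := m0.
by move=> h1 h2 [] h3; nra.
Qed.

Let box : set R2 := (`[- m, m]%classic : set RB) `*` (`[- m, m]%classic : set RB).

Let mbox : measurable box.
Proof. by apply: measurableX; exact: measurable_itv. Qed.

Let boxN x : ~ box x -> M <= sqnorm x.
Proof.
move=> h; apply: mM; apply: contrapT => /not_orP[/negP h1 /negP h2]; apply: h.
move: h1 h2; rewrite -!ltNge !ltr_norml => /andP[h1 h2] /andP[h3 h4].
by split; rewrite /= in_itv/= !ltW.
Qed.

Lemma vanishing_bounded f : continuous f -> (forall x, M <= sqnorm x -> f x = 0) ->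
  exists2 C, 0 < C & forall x, `|f x| <= C.
Proof.
move=> cf f0.
have cb : compact (box : set (R * R)) by apply: compact_setX; exact: segment_compact.
have := compact_bounded (continuous_compact (continuous_subspaceT cf) cb).
move=> [B [_ /(_ (`|B| + 1))]]; rewrite (le_lt_trans (ler_norm B)) ?ltrDl// => /(_ isT) hB.
exists (`|B| + 1); first by have := normr_ge0 B; lra.
move=> x; have [bx|/boxN/f0 ->] := pselect (box x); first by apply: hB; exists x.
by rewrite normr0; have := normr_ge0 B; lra.
Qed.

Lemma vanishing_integrable f : continuous f -> (forall x, M <= sqnorm x -> f x = 0) ->
  leb2.-integrable (setT : set R2) (EFin \o f).
Proof.
move=> cf f0; have [C C0 fC] := vanishing_bounded cf f0.
have -> : EFin \o f = ((EFin \o f) \_ box).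
  by apply/funext => x; rewrite /patch; case: ifPn => // /negP h; rewrite /= f0//; apply: boxN => b; apply: h; rewrite inE.
apply/(@integrable_mkcond _ _ _ leb2 box (EFin \o f) mbox).
apply: (@measurable_bounded_integrable _ _ _ leb2 f box mbox).
- suff : (mu `[(- m)%R, m] * mu `[(- m)%R, m] < +oo)%E.
    by congr (_ < _)%E; symmetry; apply: product_measure1E; exact: measurable_itv.
  by rewrite !lebesgue_measure_itv/=; case: ifPn => _; rewrite -?EFinB -?EFinM ?mule0 ltry.
- exact: measurable_funTS (continuous_measurable_fun2 cf).
- exists C; split; first exact: num_real.
  by move=> B CB x _ /=; exact: le_trans (fC x) (ltW CB).
Qed.

Lemma vanishing_integral_eq0 (h k : R -> R) : (forall t, is_derive t (1 : R) h (k t)) ->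
  continuous k -> (forall t, m <= `|t| -> h t = 0) -> (forall t, m <= `|t| -> k t = 0) ->
  (\int[mu]_t (k t)%:E = 0)%E.
Proof.
move=> dh ck h0 k0.
have mm : - m < m by have := m0; lra.
have -> : (\int[mu]_t (k t)%:E = \int[mu]_(t in `[(- m)%R, m]) (k t)%:E)%E.
  rewrite [RHS]integral_mkcond; apply: eq_integral => t _; rewrite /patch; case: ifPn => //.
  rewrite notin_setE /= in_itv/= -ler_norml => /negP; rewrite -ltNge => /ltW/k0 -> //.
rewrite (@continuous_FTC2 _ k h)//.
- by rewrite !h0 ?subee// ?normrN ler_norm.
- exact: continuous_subspaceT.
- split => [t _||].
  + exact: ex_derive.
  + by apply: cvg_at_right_filter; exact: (is_derive_continuous (dh _)).
  + by apply: cvg_at_left_filter; exact: (is_derive_continuous (dh _)).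
- by move=> t _; rewrite derive1E; exact: derive_val.
Qed.

Lemma vanishing_integral_slice1 f g (y : R) : continuous g ->
  (forall x, is_derive x ((1, 0) : R * R) f (g x)) ->
  (forall x, M <= sqnorm x -> f x = 0) -> (forall x, M <= sqnorm x -> g x = 0) ->
  (\int[mu]_t (g (t, y))%:E = 0)%E.
Proof.
move=> cg df f0 g0.
apply: (@vanishing_integral_eq0 (fun t => f (t, y)) (fun t => g (t, y))).
- move=> t; have h := (@is_derive_lineP _ f (t, y) _ _).2 (df (t, y)).
  have := @is_derive1_comp R (fun s => f (s *: (1, 0) + (t, y))) (fun s => s - t) t (g (t, y)) 1.
  rewrite subrr mulr1 => /(_ h) k.
  have -> : (fun t => f (t, y)) = (fun s => f (s *: (1, 0) + (t, y))) \o (fun s => s - t).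
    apply/funext => s /=; congr f.
    by transitivity ((s - t) * 1 + t, (s - t) * 0 + y) => //; congr pair; ring.
  by apply: k; apply: is_derive_eq; ring.
- exact: (continuous_slicel cg).
- by move=> t mt; apply: f0; apply: mM; left.
- by move=> t mt; apply: g0; apply: mM; left.
Qed.

Lemma vanishing_integral_slice2 f g (y : R) : continuous g ->
  (forall x, is_derive x ((0, 1) : R * R) f (g x)) ->
  (forall x, M <= sqnorm x -> f x = 0) -> (forall x, M <= sqnorm x -> g x = 0) ->
  (\int[mu]_t (g (y, t))%:E = 0)%E.
Proof.
move=> cg df f0 g0.
apply: (@vanishing_integral_eq0 (fun t => f (y, t)) (fun t => g (y, t))).
- move=> t; have h := (@is_derive_lineP _ f (y, t) _ _).2 (df (y, t)).
  have := @is_derive1_comp R (fun s => f (s *: (0, 1) + (y, t))) (fun s => s - t) t (g (y, t)) 1.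
  rewrite subrr mulr1 => /(_ h) k.
  have -> : (fun t => f (y, t)) = (fun s => f (s *: (0, 1) + (y, t))) \o (fun s => s - t).
    apply/funext => s /=; congr f.
    by transitivity ((s - t) * 0 + y, (s - t) * 1 + t) => //; congr pair; ring.
  by apply: k; apply: is_derive_eq; ring.
- exact: (continuous_slicer cg).
- by move=> t mt; apply: f0; apply: mM; right.
- by move=> t mt; apply: g0; apply: mM; right.
Qed.

(** By Fubini the integral may be taken first along the direction of differentiation, where it is 0
    on every line. *)
Lemma vanishing_integral_partial (i : 'I_2) f g : continuous g ->
  (forall x, is_derive x (basis_vec R i) f (g x)) ->
  (forall x, M <= sqnorm x -> f x = 0) -> (forall x, M <= sqnorm x -> g x = 0) ->
  \int[leb2]_x g x = 0.
Proof.
move=> cg df f0 g0; rewrite /Rintegral.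
have gi := vanishing_integrable cg g0.
have -> : (\int[leb2]_x (g x)%:E = 0)%E; last by [].
move: df; rewrite /basis_vec; case: ifP => _ df.
  rewrite -(integral21_prod_meas1 gi); apply: integral0_eq => y _.
  exact: (vanishing_integral_slice1 y cg df).
rewrite -(integral12_prod_meas1 gi); apply: integral0_eq => y _.
exact: (vanishing_integral_slice2 y cg df).
Qed.

End Vanishing.

Lemma Lfun2_integrable f : measurable_fun (setT : set R2) (f : R2 -> RB) ->
  leb2.-integrable (setT : set R2) (fun x => (f x ^+ 2)%:E) -> f \in Lfun leb2 2%:E.
Proof.
move=> mf fi; rewrite inE; apply/andP; split; rewrite inE//=.
rewrite /finite_norm unlock /Lnorm.
apply: poweR_lty; move/integrableP: fi => [_]; congr (_ < _)%E.
apply: eq_integral => x _; rewrite /=; congr EFin.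
by rewrite normrX powR_mulrn.
Qed.

Lemma vanishing_Lfun2 (M : R) f : continuous f -> (forall x, M <= sqnorm x -> f x = 0) ->
  f \in Lfun leb2 2%:E.
Proof.
move=> cf f0; apply: Lfun2_integrable; first exact: continuous_measurable_fun2.
apply: (@vanishing_integrable M (fun x => f x ^+ 2)).
- by move=> x; apply: (@continuous_comp _ _ _ f (fun y => y ^+ 2)); [exact: cf|exact: exprn_continuous].
- by move=> x /f0 ->; rewrite expr0n.
Qed.

Lemma smooth_derive_vanishing (h k : R -> R) (M : R) :
  (forall s, M <= s -> h s = 0) -> (forall s, is_derive s (1 : R) h (k s)) ->
  forall s, M < s -> k s = 0.
Proof.
move=> h0 dh s Ms; have dhs := dh s; rewrite -(@derive_val _ _ _ _ _ _ _ dhs).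
rewrite (@near_eq_derive _ _ _ h (cst 0)) ?derive_cst ?oner_neq0//.
near=> t; apply: h0; apply: ltW; near: t; exact: lt_nbhsr.
Unshelve. all: by end_near. Qed.

Lemma cint_real f : cint (fun x => (f x)%:C%C) = (\int[leb2]_x f x)%:C%C.
Proof. by congr Complex; rewrite /Rintegral/= integral0. Qed.

Lemma L2_real f : f \in Lfun leb2 2%:E -> L2 (fun x => (f x)%:C%C).
Proof.
move=> hf; split => //=.
rewrite (_ : (fun x => _) = cst 0); last by [].
by apply: (@vanishing_Lfun2 0) => // x; exact: cvg_cst.
Qed.

Lemma is_derive_radial (h k : R -> R) (i : 'I_2) x : (forall s, is_derive s (1 : R) h (k s)) ->
  is_derive x (basis_vec R i) (fun x => h (sqnorm x))
    (2 * (if i == ord0 then x.1 else x.2) * k (sqnorm x)).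
Proof.
move=> dh; apply/is_derive_lineP.
have := @is_derive1_comp R h (fun t => sqnorm (t *: basis_vec R i + x)) 0 _ _ (dh _).
rewrite scale0r add0r mulrC; apply.
rewrite /sqnorm /basis_vec; case: ifP => _ /=.
  by apply: is_derive_eq; rewrite /GRing.scale/=; ring.
by apply: is_derive_eq; rewrite /GRing.scale/=; ring.
Qed.

Lemma is_derive_coord (i : 'I_2) x :
  is_derive x (basis_vec R i) (fun x : R * R => if i == ord0 then x.1 else x.2) 1.
Proof.
apply/is_derive_lineP; rewrite /basis_vec; case: ifP => _ /=.
  by apply: is_derive_eq; rewrite /GRing.scale/=; ring.
by apply: is_derive_eq; rewrite /GRing.scale/=; ring.
Qed.

Lemma smooth2_coord (i : 'I_2) : smooth2 (fun x : R * R => if i == ord0 then x.1 else x.2).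
Proof. by case: (i == ord0); [exact: smooth2_fst|exact: smooth2_snd]. Qed.

Lemma smooth2_radial (h : R -> R) : smooth h -> smooth2 (fun x : R * R => h (sqnorm x)).
Proof. by move=> sh; apply: smooth2_comp => //; exact: smooth2_sqnorm. Qed.

(** The derivative of the product of h(|x|^2) with [phi] has integral 0, because h vanishes far out;
    this is the weak formula. *)
Lemma radial_H1_grad (h k : R -> R) (M : R) : smooth h -> smooth k ->
  (forall s, is_derive s (1 : R) h (k s)) -> (forall s, M <= s -> h s = 0) ->
  (forall s, M <= s -> k s = 0) ->
  H1_grad (fun x => (h (sqnorm x))%:C%C)
    (fun i x => (2 * (if i == ord0 then x.1 else x.2) * k (sqnorm x))%:C%C).
Proof.
move=> sh sk dh h0 k0.
have s2 := smooth2_radial sh.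
have sk2 (i : 'I_2) : smooth2 (fun x => 2 * (if i == ord0 then x.1 else x.2) * k (sqnorm x)).
  apply: smooth2_mul; last exact: smooth2_radial.
  by apply: smooth2_mul; [exact: smooth2_cst|exact: smooth2_coord].
split.
  apply: L2_real; apply: (@vanishing_Lfun2 M); first exact: smooth2_continuous.
  by move=> x /h0.
move=> i; split.
  apply: L2_real; apply: (@vanishing_Lfun2 M); first exact: smooth2_continuous.
  by move=> x /k0 ->; rewrite mulr0.
move=> phi [Cphi _].
have [cphi dphi] := Cphi 1%N; have [dphi1 [cdphi _]] := dphi i.
pose K x := 2 * (if i == ord0 then x.1 else x.2) * k (sqnorm x).
have dpi x : is_derive x (basis_vec R i) phi ('D_(basis_vec R i) phi x) by exact: derivableP.
have A0 x : M <= sqnorm x -> h (sqnorm x) * 'D_(basis_vec R i) phi x = 0 by move=> /h0 ->; rewrite mul0r.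
have B0 x : M <= sqnorm x -> K x * phi x = 0 by move=> Mx; rewrite /K k0// mulr0 mul0r.
have cA : continuous (fun x => h (sqnorm x) * 'D_(basis_vec R i) phi x).
  by move=> x; apply: cvgM; [exact: smooth2_continuous|exact: cdphi].
have cB : continuous (fun x => K x * phi x).
  by move=> x; apply: cvgM; [exact: (smooth2_continuous (sk2 i))|exact: cphi].
have e0 : \int[leb2]_x (h (sqnorm x) * 'D_(basis_vec R i) phi x + K x * phi x) = 0.
  apply: (@vanishing_integral_partial M i (fun x => h (sqnorm x) * phi x)).
  - by move=> x; apply: cvgD; [exact: cA|exact: cB].
  - move=> x; have d1 := is_derive_radial i x dh; have d2 := dpi x.
    by apply: is_derive_eq; rewrite /GRing.scale/= /K; ring.
  - by move=> x /h0 ->; rewrite mul0r.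
  - by move=> x Mx; rewrite A0// B0// addr0.
have iA := vanishing_integrable cA A0; have iB := vanishing_integrable cB B0.
move: e0; rewrite (RintegralD measurableT iA iB) => /eqP; rewrite addr_eq0 => /eqP e0.
under eq_fun do rewrite -rmorphM; under [in RHS]eq_fun do rewrite -rmorphM.
by rewrite !cint_real -rmorphN; congr (_%:C)%C; exact: e0.
Qed.

End PlaneIntegration.

(** * The du Bois-Reymond lemma *)

Section Primitive.
Variable R : realType.
Notation mu := (@lebesgue_measure R).
Implicit Types (f h k : R -> R) (a b s t x : R).

Lemma continuous_itv_integrable k a b : continuous k -> mu.-integrable `[a, b] (EFin \o k).
Proof.
move=> ck; apply: continuous_compact_integrable; first exact: segment_compact.
exact: continuous_subspaceT.
Qed.

Lemma Rintegral_FTC2 h k a b : a <= b -> continuous k ->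
  (forall t, is_derive t (1 : R) h (k t)) -> \int[mu]_(t in `[a, b]) k t = h b - h a.
Proof.
rewrite le_eqVlt => /predU1P[<- _ _|ab ck dh].
  by rewrite set_itv1 Rintegral_set1 subrr.
rewrite /Rintegral (@continuous_FTC2 _ k h)//.
- exact: continuous_subspaceT.
- split => [t _||].
  + exact: ex_derive.
  + by apply: cvg_at_right_filter; exact: (is_derive_continuous (dh _)).
  + by apply: cvg_at_left_filter; exact: (is_derive_continuous (dh _)).
- by move=> t _; rewrite derive1E; exact: derive_val.
Qed.

Lemma is_derive_int k a x : continuous k -> a < x ->
  is_derive x (1 : R) (fun y => \int[mu]_(t in `[a, y]) k t) (k x).
Proof.
move=> ck ax.
have [] := @continuous_FTC1_closed R k a x (x + 1) _ (continuous_itv_integrable a (x + 1) ck) ax (ck x).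
  by rewrite ltrDl.
by move=> d <-; rewrite derive1E; exact: derivableP.
Qed.

(** The fundamental theorem differentiates the integral only to the right of its base point. The
    base point [- n] therefore recedes with t, and subtracting the integral up to 0 makes the
    choices of n agree. *)
Lemma continuous_primitive k : continuous k -> exists K, forall t, is_derive t (1 : R) K (k t).
Proof.
move=> ck.
pose A n y := \int[mu]_(t in `[- n, y]) k t - \int[mu]_(t in `[- n, 0]) k t.
have dA (n y : R) : - n < y -> is_derive y (1 : R) (A n) (k y).
  move=> ny; have d := is_derive_int ck ny.
  by apply: is_derive_eq; rewrite subr0.
have AE (n m y : R) : 0 < n -> n <= m -> - n < y -> A n y = A m y.
  move=> n0 nm ny.
  have dB (z : R) : - n < z -> is_derive z (1 : R) (fun z => A n z - A m z) 0.
    move=> nz; have d1 := dA n z nz; have d2 : is_derive z (1 : R) (A m) (k z) by apply: dA; lra.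
    by apply: is_derive_eq; rewrite subrr.
  have B0 : A n 0 - A m 0 = 0 by rewrite /A !subrr.
  apply/eqP; rewrite -subr_eq0; apply/eqP; rewrite -B0.
  have [y0|y0] := leP y 0.
    apply/eqP; rewrite eq_le; apply/andP; split.
      apply: (@derive_ge0_le _ (fun z => A n z - A m z) (cst 0)) => // z /andP[h1 h2]; apply: dB; lra.
    apply: (@derive_le0_ge _ (fun z => A n z - A m z) (cst 0)) => // z /andP[h1 h2]; apply: dB; lra.
  apply/eqP; rewrite eq_le; apply/andP; split.
    apply: (@derive_le0_ge _ (fun z => A n z - A m z) (cst 0)) => //; first exact: ltW.
    by move=> z /andP[h1 h2]; apply: dB; lra.
  apply: (@derive_ge0_le _ (fun z => A n z - A m z) (cst 0)) => //; first exact: ltW.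
  by move=> z /andP[h1 h2]; apply: dB; lra.
exists (fun t => A (`|t| + 1) t) => t.
have d : is_derive t (1 : R) (A (`|t| + 2)) (k t).
  by apply: dA; have := ler_norm (- t); rewrite normrN; lra.
apply: near_eq_is_derive d; exists 1 => //= z tz.
have h1 : `|z| < `|t| + 1.
  by have := ler_normD t (z - t); rewrite subrKC (distrC z t); move: tz; rewrite /ball_ /=; lra.
symmetry; apply: AE; first by have := normr_ge0 z; lra.
  lra.
by have := ler_norm (- z); rewrite normrN; lra.
Qed.

End Primitive.

Section DuBoisReymond.
Variable R : realType.
Notation mu := (@lebesgue_measure R).
Implicit Types (h k : R -> R) (a b s t x : R).

Lemma derive_eq0_cst h a b : (forall z, is_derive z (1 : R) h (0 : R)) -> h a = h b.
Proof.
move=> dh; wlog ab : a b / a <= b.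
  by move=> H; have [/H//|/ltW/H] := leP a b.
apply/eqP; rewrite eq_le; apply/andP; split.
  exact: (@derive_ge0_le _ h (cst 0)).
exact: (@derive_le0_ge _ h (cst 0)).
Qed.

Lemma bump_primitive x r : 0 < r -> exists B,
  [/\ smooth B, forall s, is_derive s (1 : R) B (bump x r s),
      forall s, s <= x - r -> B s = 0,
      forall s, x + r <= s -> B s = B (x + r)
    & r * bump_floor R <= B (x + r)].
Proof.
move=> r0; have [B0 dB0] := continuous_primitive (smooth_continuous (smooth_bump x r)).
pose B s := B0 s + (- B0 (x - r)).
have dB s : is_derive s (1 : R) B (bump x r s).
  by have := is_deriveD (dB0 s) (is_derive_cst (- B0 (x - r)) s (1 : R)); rewrite addr0.
have incr a b : a <= b -> B a <= B b.
  by move=> ab; apply: (derive_ge0_le ab (fun z _ => dB z)) => z _; exact: bump_ge0.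
exists B; split => //.
- exact: smooth_primitive (smooth_bump x r) dB.
- move=> s sx; transitivity (B (x - r)); last by rewrite /B subrr.
  apply/eqP; rewrite eq_le incr//=.
  apply: (derive_le0_ge sx (fun z _ => dB z)) => z /andP[_ h].
  by rewrite bump_eq0// ler_normr; apply/orP; right; lra.
- move=> s sx; apply/eqP; rewrite eq_le (incr _ _ sx) andbT.
  apply: (derive_le0_ge sx (fun z _ => dB z)) => z /andP[h _].
  by rewrite bump_eq0// ler_normr; apply/orP; left; lra.
(* The middle half of the support, of length r, already carries the required mass. *)
- have h2 : x - r / 2 < x + r / 2 by lra.
  have [c cab e] := mean_value h2 (fun z _ => dB z).
  have h1 : B (x - r) = 0 by rewrite /B subrr.
  have h3 : B (x - r) <= B (x - r / 2) by apply: incr; lra.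
  have h4 : B (x + r / 2) <= B (x + r) by apply: incr; lra.
  have h5 : bump_floor R <= bump x r c.
    by apply: bump_floor_le => //; rewrite ler_norml; lra.
  have h6 : r * bump_floor R <= bump x r c * (x + r / 2 - (x - r / 2)).
    by rewrite mulrC (_ : x + r / 2 - (x - r / 2) = r); [rewrite ler_wpM2r// ltW|field].
  lra.
Qed.

Lemma Rintegral_support (A B : set R) h : A `<=` B ->
  (forall x, B x -> ~ A x -> h x = 0) -> \int[mu]_(x in B) h x = \int[mu]_(x in A) h x.
Proof.
move=> AB h0; rewrite Rintegral_mkcond [RHS]Rintegral_mkcond.
apply: eq_Rintegral => x _; rewrite /patch.
case: (pselect (A x)) => [Ax|nA].
  by rewrite !mem_set//; exact: AB.
rewrite [in RHS]memNset//; case: ifPn => //; rewrite inE => Bx; exact: h0.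
Qed.

Lemma integrable_mul_bounded (A : set R) (f g : R -> R) (C : R) :
  measurable (A : set (measurableTypeR R)) -> mu.-integrable A (EFin \o f) ->
  measurable_fun A g -> (forall x, A x -> `|g x| <= C) ->
  mu.-integrable A (EFin \o (fun x => f x * g x)).
Proof.
move=> mA fi mg gC.
have iC : mu.-integrable A (fun x => (C%:E * `|(EFin \o f) x|)%E).
  by apply: integrableZl => //; exact: integrable_abse.
apply: le_integrable iC => //.
  apply/measurable_EFinP; apply: measurable_funM => //.
  by case/integrableP: fi => /measurable_EFinP.
move=> x Ax; change (`|(f x * g x)%:E| <= `|(C * `|f x|)%:E|)%E; rewrite !lee_fin normrM [leRHS]ger0_norm; last first.
  by rewrite mulr_ge0// (le_trans _ (gC _ Ax)).
by rewrite mulrC ler_wpM2r// gC.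
Qed.

(** At a Lebesgue point x with f x nonzero, orthogonality equates |f x| times the mass of the bump
    with |\int (f - f x) bump|. This is at most the integral of |f - f x|, which for small r is less
    than |f x| r [bump_floor]; but the mass is at least r [bump_floor]. *)
Lemma bump_orthogonal_ae0 (f : R -> R) :
  (forall a b, 0 < a -> mu.-integrable `[a, b] (EFin \o f)) ->
  (forall x r, 0 < r -> r < x ->
     \int[mu]_(s in `[x - r, x + r]) (f s * bump x r s) = 0) ->
  {ae mu, forall s, 0 < s -> f s = 0}.
Proof.
move=> fi key.
have mb x r := continuous_measurable_fun (smooth_continuous (smooth_bump x r)).
(* [f] is integrable only away from 0, so the differentiation theorem is applied to truncations. *)
pose g (n : nat) : R -> R := f \_ `[n.+1%:R^-1, n.+1%:R].
have gi n : mu.-integrable setT (EFin \o g n).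
  have n0 : 0 < n.+1%:R^-1 :> R by rewrite invr_gt0.
  rewrite /g -restrict_EFin -integrable_mkcond//.
  exact: fi.
have /ae_foralln : forall n, {ae mu, forall s, lebesgue_pt (g n) s}.
  move=> n; apply: lebesgue_differentiation.
  by apply: open_integrable_locally => //; exact: openT.
apply: filterS => x lx x0.
have [n nx1 nx2] : exists2 n : nat, n.+1%:R^-1 < x & x < n.+1%:R.
  have [n1 h1] : exists n1 : nat, x < n1.+1%:R.
    by exists (Num.truncn x); have /andP[] := truncn_itv (ltW x0).
  have [n2 h2] : exists n2 : nat, x^-1 < n2.+1%:R.
    by exists (Num.truncn x^-1); have /andP[] := @truncn_itv _ x^-1 ltac:(by rewrite invr_ge0 ltW).
  exists (maxn n1 n2).
    rewrite -[x]invrK ltf_pV2 ?posrE ?invr_gt0//; apply: lt_le_trans h2 _.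
    by rewrite ler_nat ltnS leq_maxr.
  by apply: lt_le_trans h1 _; rewrite ler_nat ltnS leq_maxl.
have gE s : n.+1%:R^-1 <= s <= n.+1%:R -> g n s = f s.
  by move=> h; rewrite /g patchE mem_set//= in_itv/=.
suff : g n x = 0 by rewrite gE ?ltW// nx1 nx2.
apply: contrapT => /eqP gx0.
have e0 : 0 < `|g n x| * bump_floor R / 2.
  by rewrite divr_gt0// mulr_gt0 ?normr_gt0// (bump_floor_gt0 R).
have [r [r0 rx1 rx2 rd]] : exists r : R,
    [/\ 0 < r, n.+1%:R^-1 < x - r, x + r < n.+1%:R & (davg (g n) x r < (`|g n x| * bump_floor R / 2)%:E)%E].
  have : \forall r \near (0 : R)^'+, (davg (g n) x r < (`|g n x| * bump_floor R / 2)%:E)%E.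
    apply: (lx n [set y | (y < (`|g n x| * bump_floor R / 2)%:E)%E]); apply: open_nbhs_nbhs; split; last by rewrite /= lte_fin.
    exact: open_ereal_lt_ereal.
  move=> hr; near (0 : R)^'+ => r; exists r; split.
  - by near: r; exact: nbhs_right_gt.
  - by rewrite ltrBrDr -ltrBrDl; near: r; apply: nbhs_right_lt; rewrite subr_gt0.
  - by rewrite -ltrBrDl; near: r; apply: nbhs_right_lt; rewrite subr_gt0.
  - by near: r.
have [B [_ dB B_0 _ m]] := bump_primitive x r0.
have le1 : x - r <= x + r by lra.
have cb := smooth_continuous (smooth_bump x r).
have Bi : \int[mu]_(s in `[x - r, x + r]) bump x r s = B (x + r).
  by rewrite (@Rintegral_FTC2 R B _ _ _ le1 cb dB) (B_0 _ (lexx _)) subr0.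
have i0 : mu.-integrable `[x - r, x + r] (EFin \o g n).
  by apply: integrableS (gi n) => //; exact: measurable_itv.
have i1 : mu.-integrable `[x - r, x + r] (EFin \o (fun s => g n s - g n x)).
  apply: (@integrableB _ _ _ mu _ (measurable_itv _) (EFin \o g n) (EFin \o cst (g n x))) => //.
  by apply: continuous_itv_integrable; exact: cst_continuous.
have i2 : mu.-integrable `[x - r, x + r] (EFin \o (fun s => (g n s - g n x) * bump x r s)).
  apply: (@integrable_mul_bounded _ _ _ 1) => //; first exact: measurable_funTS.
  by move=> s _; rewrite ger0_norm ?bump_le1 ?bump_ge0.
have i3 : mu.-integrable `[x - r, x + r] (EFin \o (fun s => g n s * bump x r s)).
  apply: (@integrable_mul_bounded _ _ _ 1) => //; first exact: measurable_funTS.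
  by move=> s _; rewrite ger0_norm ?bump_le1 ?bump_ge0.
have i4 := @continuous_itv_integrable _ _ (x - r) (x + r) cb.
have i5 := @integrableZl _ _ _ mu _ (measurable_itv _) (g n x) _ i4.
have i6 := integrable_norm i1.
have e1 : \int[mu]_(s in `[x - r, x + r]) ((g n s - g n x) * bump x r s) =
    - (g n x * B (x + r)).
  transitivity (\int[mu]_(s in `[x - r, x + r]) (g n s * bump x r s - g n x * bump x r s)).
    by apply: eq_Rintegral => s _; ring.
  rewrite (@RintegralB _ _ _ mu _ _ _ (measurable_itv _) i3 i5).
  rewrite (@RintegralZl _ _ _ mu _ _ _ (measurable_itv _) i4) Bi.
  have rx : r < x by rewrite -subr_gt0; apply: lt_trans rx1; rewrite invr_gt0.
  rewrite -[X in X - _](_ : 0 = _) ?sub0r//.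
  rewrite -(key x r r0 rx); apply: eq_Rintegral => s; rewrite inE/= in_itv/= => /andP[s1 s2].
  by rewrite gE// (ltW (lt_le_trans rx1 s1)) (ltW (le_lt_trans s2 rx2)).
have e2 : `|g n x| * B (x + r) <= \int[mu]_(s in `[x - r, x + r]) `|g n s - g n x|.
  have B0' : 0 <= B (x + r) by apply: le_trans m; rewrite mulr_ge0 ?ltW// (bump_floor_gt0 R).
  rewrite -(ger0_norm B0') -normrM -normrN -e1.
  have i7 := integrable_norm i2.
  apply: le_trans (@le_normr_Rintegral _ _ _ mu _ _ (measurable_itv _) i2) _.
  apply: (@le_Rintegral _ _ _ mu _ _ _ (measurable_itv _) i7 i6).
  move=> s _; rewrite /= normrM ler_piMr// ger0_norm ?bump_le1 ?bump_ge0//.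
have : \int[mu]_(s in `[x - r, x + r]) `|g n s - g n x| < `|g n x| * bump_floor R / 2 * (r *+ 2).
  move: rd; rewrite /davg /iavg (lebesgue_measure_ball _ (ltW r0)).
  have -> : (\int[mu]_(y in ball x r) `|(((center (g n x) \o g n) y)%:E)| =
      (\int[mu]_(s in `[x - r, x + r]) `|g n s - g n x|)%:E)%E.
    have fin := @integrable_fin_num _ _ _ mu `[x - r, x + r] (measurable_itv _) _ i6.
    rewrite ball_itv/= /Rintegral (fineK fin).
    have mg : measurable_fun `[x - r, x + r] (fun s => `|g n s - g n x|%:E).
      by case/integrableP: i6.
    rewrite -(integral_itv_obnd_cbnd (f := fun s => `|g n s - g n x|%:E)).
      rewrite -(integral_itv_bndo_bndc (f := fun s => `|g n s - g n x|%:E)) //.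
      by apply: measurable_funS mg => //; exact: subset_itv_oo_cc.
    by apply: measurable_funS mg => //; exact: subset_itv_oc_cc.
  rewrite inver mulrn_eq0/= (gt_eqF r0) -EFinM lte_fin ltr_pdivrMl; first by rewrite mulrC.
  by rewrite pmulrn_lgt0.
have q0 : 0 < `|g n x| by rewrite normr_gt0.
move=> h1.
have h2 : `|g n x| * (r * bump_floor R) <= `|g n x| * B (x + r) by rewrite ler_wpM2l// ltW.
have h3 : `|g n x| * bump_floor R / 2 * (r *+ 2) = `|g n x| * (r * bump_floor R).
  by rewrite -mulr_natr; field.
by move: h1; rewrite h3 ltNge (le_trans h2 e2).
Unshelve. all: by end_near. Qed.

(** Subtracting the mean [C] against a reference bump reduces the claim to orthogonality to all
    bumps: a bump minus the right multiple of the reference one has a compactly supported primitive,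
    hence is an admissible derivative. *)
Lemma du_bois_reymond (f : R -> R) :
  (forall a b, 0 < a -> mu.-integrable `[a, b] (EFin \o f)) ->
  (forall h k a b, smooth h -> smooth k -> (forall s, is_derive s (1 : R) h (k s)) ->
     0 < a -> a < b -> (forall s, s <= a -> h s = 0) -> (forall s, b <= s -> h s = 0) ->
     \int[mu]_(s in `[a, b]) (f s * k s) = 0) ->
  exists C, {ae mu, forall s, 0 < s -> f s = C}.
Proof.
move=> fi weak.
have mb x r := continuous_measurable_fun (smooth_continuous (smooth_bump x r)).
have fbi x r a b : 0 < a -> mu.-integrable `[a, b] (EFin \o (fun s => f s * bump x r s)).
  move=> a0; apply: (@integrable_mul_bounded _ _ _ 1) => //; first exact: fi.
    exact: measurable_funTS.
  by move=> s _; rewrite ger0_norm ?bump_le1 ?bump_ge0.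
have supp x r a b (k : R -> R) : 0 < r -> a <= x - r -> x + r <= b ->
    \int[mu]_(s in `[a, b]) (k s * bump x r s) =
    \int[mu]_(s in `[x - r, x + r]) (k s * bump x r s).
  move=> r0 ax xb; apply: Rintegral_support.
    by move=> s /=; rewrite !in_itv/= => /andP[h1 h2]; lra.
  move=> s _ /negP; rewrite /= in_itv/= negb_and -!ltNge => h.
  rewrite bump_eq0 ?mulr0// ler_normr.
  by case/orP: h => h; apply/orP; [right|left]; lra.
have [B0 [sB0 dB0 B00 B01 m0]] := @bump_primitive 2 1 ltr01.
have {}m0 : 0 < B0 (2 + 1) by have := bump_floor_gt0 R; lra.
pose C := \int[mu]_(s in `[2 - 1, 2 + 1]) (f s * bump 2 1 s) / B0 (2 + 1).
have key x r : 0 < r -> r < x ->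
    \int[mu]_(s in `[x - r, x + r]) ((f s - C) * bump x r s) = 0.
  move=> r0 rx; have [B [sB dB B_0 B_1 m]] := bump_primitive x r0.
  pose a := Num.min 1 (x - r); pose b := Num.max 3 (x + r).
  have [a1 a2] : a <= 2 - 1 /\ a <= x - r.
    by rewrite /a; split; rewrite ge_min; apply/orP; [left|right]; lra.
  have [b1 b2] : 2 + 1 <= b /\ x + r <= b.
    by rewrite /b; split; rewrite le_max; apply/orP; [left|right]; lra.
  have a0 : 0 < a by rewrite lt_min ltr01 subr_gt0.
  have Bi : \int[mu]_(s in `[x - r, x + r]) bump x r s = B (x + r).
    have le1 : x - r <= x + r by lra.
    rewrite (@Rintegral_FTC2 R B _ _ _ le1 _ dB) ?(B_0 _ (lexx _)) ?subr0//.
    exact: smooth_continuous (smooth_bump x r).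
  (* Each primitive is weighted by the final value of the other, so that the combination vanishes
     again beyond [b]. *)
  have := weak (fun s => B0 (2 + 1) * B s + (- B (x + r)) * B0 s)
    (fun s => B0 (2 + 1) * bump x r s + (- B (x + r)) * bump 2 1 s) a b.
  move=> /(_ (smooth_add (smooth_mul (smooth_cst _) sB) (smooth_mul (smooth_cst _) sB0))).
  move=> /(_ (smooth_add (smooth_mul (smooth_cst _) (smooth_bump _ _))
    (smooth_mul (smooth_cst _) (smooth_bump _ _)))).
  have -> : (fun s => f s * (B0 (2 + 1) * bump x r s + (- B (x + r)) * bump 2 1 s))
      = (fun s => B0 (2 + 1) * (f s * bump x r s) - B (x + r) * (f s * bump 2 1 s)).
    by apply/funext => s; ring.
  have i1 := fbi x r a b a0; have i2 := fbi 2 1 a b a0.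
  have j1 := @integrableZl _ _ _ mu _ (measurable_itv _) (B0 (2 + 1)) _ i1.
  have j2 := @integrableZl _ _ _ mu _ (measurable_itv _) (B (x + r)) _ i2.
  rewrite (@RintegralB _ _ _ mu _ _ _ (measurable_itv _) j1 j2).
  rewrite (@RintegralZl _ _ _ mu _ _ _ (measurable_itv _) i1).
  rewrite (@RintegralZl _ _ _ mu _ _ _ (measurable_itv _) i2).
  rewrite (supp x r) ?(supp 2 1)//.
  have -> : \int[mu]_(s in `[2 - 1, 2 + 1]) (f s * bump 2 1 s) = C * B0 (2 + 1).
    by rewrite /C divfK// gt_eqF.
  move=> h.
  have xr0 : 0 < x - r by lra.
  have c1 := @continuous_itv_integrable _ _ (x - r) (x + r)
    (smooth_continuous (smooth_bump x r)).
  have j := @integrableZl _ _ _ mu _ (measurable_itv _) C _ c1.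
  have -> : (fun s => (f s - C) * bump x r s) =
      (fun s => f s * bump x r s - C * bump x r s).
    by apply/funext => s; ring.
  rewrite (@RintegralB _ _ _ mu _ _ _ (measurable_itv _) (fbi x r _ _ xr0) j).
  rewrite (@RintegralZl _ _ _ mu _ _ _ (measurable_itv _) c1) Bi.
  have ab : a < b by lra.
  have dX s : is_derive s (1 : R) (fun s => B0 (2 + 1) * B s + (- B (x + r)) * B0 s)
      (B0 (2 + 1) * bump x r s + (- B (x + r)) * bump 2 1 s).
    by have d1 := dB s; have d2 := dB0 s; apply: is_derive_eq; rewrite /GRing.scale/=; ring.
  have Xa s : s <= a -> B0 (2 + 1) * B s + (- B (x + r)) * B0 s = 0.
    move=> sa; have s1 : s <= x - r by lra.
    have s2 : s <= 2 - 1 by lra.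
    by rewrite (B_0 _ s1) (B00 _ s2) !mulr0 addr0.
  have Xb s : b <= s -> B0 (2 + 1) * B s + (- B (x + r)) * B0 s = 0.
    move=> sb; have s1 : x + r <= s by lra.
    have s2 : 2 + 1 <= s by lra.
    by rewrite (B_1 _ s1) (B01 _ s2); ring.
  apply: (mulfI (lt0r_neq0 m0)); rewrite mulr0 -(h dX a0 ab Xa Xb).
  by ring.
exists C.
have fCi a b : 0 < a -> mu.-integrable `[a, b] (EFin \o (fun s => f s - C)).
  move=> a0; apply: (@integrableB _ _ _ mu _ (measurable_itv _) (EFin \o f) (EFin \o cst C)).
    exact: fi.
  by apply: continuous_itv_integrable; exact: cst_continuous.
have : {ae mu, forall s, 0 < s -> f s - C = 0} by exact: bump_orthogonal_ae0.
by apply: (@filterS _ _ (ae_filter_ringOfSetsType mu)) => s h s0; apply/eqP; rewrite -subr_eq0 h.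
Qed.

End DuBoisReymond.

(** * Regularity of weak solutions on the half-line *)

Section WeakRegularity.
Variable R : realType.
Notation mu := (@lebesgue_measure R).
Local Notation leb2 := (mu \x mu)%E.
Local Notation RB := (measurableTypeR R).
Local Notation R2 := (measurableTypeR R * measurableTypeR R)%type.
Implicit Types (a b s t x : R).

Lemma integrable_patch (A : set R) (f : R -> R) : measurable (A : set RB) ->
  mu.-integrable A (EFin \o f) -> mu.-integrable setT (EFin \o (f \_ A)).
Proof. by move=> mA fi; rewrite -restrict_EFin -integrable_mkcond. Qed.

Lemma continuous_itv_bounded (k : R -> R) a b : continuous k ->
  exists C, forall s, a <= s <= b -> `|k s| <= C.
Proof.
move=> ck.
have := compact_bounded (continuous_compact (continuous_subspaceT ck) (@segment_compact _ a b)).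
move=> [B [_ /(_ (`|B| + 1))]]; rewrite (le_lt_trans (ler_norm B)) ?ltrDl// => /(_ isT) hB.
by exists (`|B| + 1) => s sab; apply: hB; exists s => //; rewrite /= in_itv.
Qed.

Lemma measurable_le2 : measurable ([set z | z.1 <= z.2] : set R2).
Proof.
have mf : measurable_fun (setT : set R2) (fun z : R2 => (z.1 : RB) - z.2).
  by apply: measurable_funB; [exact: measurable_fst|exact: measurable_snd].
have := mf measurableT _ (measurable_itv `]-oo, 0%R]).
by rewrite setTI; congr measurable; apply/seteqP; split => z /=; rewrite in_itv/= subr_le0.
Qed.

(** Since [q] is merely integrable, this is Fubini on the triangle s <= t, with h(s) = - \int_s^M
    k. *)
Lemma primitive_by_parts (q k h : R -> R) (M : R) : 0 < M ->
  mu.-integrable `]0, M] (EFin \o q) -> continuous k ->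
  (forall s, is_derive s (1 : R) h (k s)) -> h M = 0 ->
  \int[mu]_(s in `]0, M]) (q s * h s) =
  - \int[mu]_(s in `]0, M]) ((\int[mu]_(t in `]0, s]) q t) * k s).
Proof.
move=> M0 qi ck dh hM.
pose D : set R := [set` `]0, M]].
have mD : measurable (D : set RB) by exact: measurable_itv.
have ki : mu.-integrable D (EFin \o k).
  apply: integrableS (continuous_itv_integrable 0 M ck) => //.
  by apply: subset_itv_oc_cc.
have qDi := integrable_patch mD qi; have kDi := integrable_patch mD ki.
pose A : set R2 := [set z | z.1 <= z.2].
pose f (z : R2) : \bar R := ((q \_ D) z.1 * (k \_ D) z.2 * \1_A z)%:E.
have mf : measurable_fun (setT : set R2) f.
  apply/measurable_EFinP; apply: measurable_funM; last exact: measurable_indic measurable_le2.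
  apply: measurable_funM.
    apply: (measurableT_comp (f := (q \_ D : RB -> R))); last exact: measurable_fst.
    by case/integrableP: qDi => /measurable_EFinP.
  apply: (measurableT_comp (f := (k \_ D : RB -> R))); last exact: measurable_snd.
  by case/integrableP: kDi => /measurable_EFinP.
have k1i := integrable_norm kDi.
pose L := \int[mu]_t `|(k \_ D) t|.
have fi : leb2.-integrable setT f.
  apply/(@integrable12ltyP _ _ _ _ _ mu mu f mf).
  apply: (@le_lt_trans _ _ (\int[mu]_s (L%:E * `|((q \_ D) s)%:E|))%E).
    apply: ge0_le_integral => //.
    - by move=> s _; exact: integral_ge0.
    - by apply: (@measurable_fun_fubini_tonelli_F _ _ _ _ _ mu (fun z => `|f z|)%E) => //; exact: measurableT_comp.
    - apply: measurable_funeM; apply: measurableT_comp => //.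
      by case/integrableP: qDi.
    - move=> s _; apply: (@le_trans _ _ (\int[mu]_t (`|(q \_ D) s|%:E * `|(k \_ D) t|%:E))%E).
        apply: ge0_le_integral => //.
        + by apply: measurableT_comp => //; apply: measurableT_comp mf _; exact: measurable_pair1.
        + apply: measurable_funeM; by case/integrableP: k1i.
        + move=> t _; rewrite /f abse_EFin -EFinM lee_fin normrM normrM ler_piMr// indicE.
          by case: (_ \in _); rewrite ?normr1 ?normr0.
      rewrite ge0_integralZl//; last by case/integrableP: k1i.
      have fin := @integrable_fin_num _ _ _ mu setT measurableT _ k1i.
      by rewrite -(fineK fin) muleC lexx.
  rewrite ge0_integralZl//.
  - apply: lte_mul_pinfty => //; first by rewrite lee_fin; apply: Rintegral_ge0.
    by case/integrableP: qDi.
  - by apply: measurableT_comp => //; case/integrableP: qDi.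
  - by rewrite lee_fin; apply: Rintegral_ge0.
have F := Fubini fi.
have DE s : (s \in D) = (0 < s <= M) by apply/idP/idP; rewrite inE /D/= in_itv.
have AE s t : ((s, t) \in A) = (s <= t) by apply/idP/idP; rewrite inE.
have CE a b t : (t \in [set` `[a, b]]) = (a <= t <= b) by apply/idP/idP; rewrite inE/= in_itv.
have OE a b t : (t \in [set` `]a, b]]) = (a < t <= b) by apply/idP/idP; rewrite inE/= in_itv.
have e1 : (\int[mu]_s \int[mu]_t f (s, t) = \int[mu]_s (((fun s => q s * - h s) \_ D) s)%:E)%E.
  apply: eq_integral => s _; rewrite patchE DE; case: ifPn => [/andP[s0 sM]|sD]; last first.
    rewrite integral0_eq// => t _; rewrite /f /= patchE DE (negbTE sD) !mul0r//.
  have kk := @continuous_itv_integrable _ _ s M ck.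
  have kj := @integrable_patch _ k (measurable_itv `[s, M]) kk.
  transitivity (\int[mu]_t ((q s)%:E * ((k \_ `[s, M]) t)%:E))%E.
    apply: eq_integral => t _; rewrite -EFinM; congr EFin.
    rewrite /= !patchE !DE s0 sM /= -mulrA; congr (_ * _).
    rewrite indicE AE CE; have [st|ts] := leP s t; last by rewrite mulr0.
    by rewrite mulr1 (lt_le_trans s0 st).
  rewrite integralZl//.
  have -> : (\int[mu]_t ((k \_ `[s, M]) t)%:E = (\int[mu]_(t in `[s, M]) k t)%:E)%E.
    rewrite Rintegral_mkcond /Rintegral fineK//.
    exact: (@integrable_fin_num _ _ _ mu setT measurableT _ kj).
  by rewrite (Rintegral_FTC2 sM ck dh) hM sub0r -EFinM.
have e2 : (\int[mu]_t \int[mu]_s f (s, t) =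
    \int[mu]_t (((fun t => (\int[mu]_(s in `]0, t]) q s) * k t) \_ D) t)%:E)%E.
  apply: eq_integral => t _; rewrite patchE DE; case: ifPn => [/andP[t0 tM]|tD]; last first.
    by rewrite integral0_eq// => s _; rewrite /f /= !patchE !DE (negbTE tD) mulr0 mul0r.
  have qk : mu.-integrable `]0, t] (EFin \o q).
    apply: integrableS qi => //; apply: subset_itvl; exact: tM.
  have qj := @integrable_patch _ q (measurable_itv `]0, t]) qk.
  transitivity (\int[mu]_s ((k t)%:E * ((q \_ `]0, t]) s)%:E))%E.
    apply: eq_integral => s _; rewrite -EFinM; congr EFin.
    rewrite /= !patchE !DE t0 tM /= [RHS]mulrC mulrAC; congr (_ * _).
    rewrite indicE AE OE; have [st|ts] := leP s t; last by rewrite mulr0 andbF.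
    by rewrite mulr1 (le_trans st tM).
  rewrite integralZl//.
  have -> : (\int[mu]_s ((q \_ `]0, t]) s)%:E = (\int[mu]_(s in `]0, t]) q s)%:E)%E.
    rewrite Rintegral_mkcond /Rintegral fineK//.
    exact: (@integrable_fin_num _ _ _ mu setT measurableT _ qj).
  by rewrite -EFinM mulrC.
have ch : continuous h by move=> s; exact: is_derive_continuous (dh s).
have [C hC] := continuous_itv_bounded 0 M ch.
have qhi : mu.-integrable D (EFin \o (fun s => q s * h s)).
  apply: (@integrable_mul_bounded R D q h C mD qi).
    exact: measurable_funTS (continuous_measurable_fun ch).
  by move=> s; rewrite /D /= in_itv/= => /andP[s0 sM]; apply: hC; rewrite ltW.
transitivity (- (\int[mu]_(s in D) (q s * - h s))).
  transitivity (- (\int[mu]_(s in D) (-1 * (q s * h s)))).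
    by rewrite (@RintegralZl _ _ _ mu _ _ _ mD qhi) mulN1r opprK.
  by congr (- _); apply: eq_Rintegral => s _; ring.
by congr (- _); rewrite [LHS]Rintegral_mkcond [RHS]Rintegral_mkcond /Rintegral -e1 -e2 F.
Qed.

Lemma is_derive_near0 (f : R -> R) a s : (forall t, t < a -> f t = 0) -> s < a ->
  is_derive s (1 : R) f 0.
Proof.
move=> f0 sa; apply: (@near_eq_is_derive _ _ _ (cst (0 : R))).
exists (a - s) => /=; first by rewrite subr_gt0.
by move=> y /=; rewrite ltr_norml => /andP[h1 h2]; rewrite f0//; lra.
Qed.

Lemma cut_continuous (w k : R -> R) a : 0 < a -> (forall s, 0 < s -> {for s, continuous w}) ->
  continuous k -> (forall s, s < a -> k s = 0) -> continuous (fun s => w s * k s).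
Proof.
move=> a0 cw ck k0 s; have [s0|s0] := ltP 0 s.
  by apply: cvgM; [exact: cw|exact: ck].
apply: (@is_derive_continuous _ _ _ 0).
by apply: (@is_derive_near0 _ a) => [t ta|]; [rewrite k0 ?mulr0|lra].
Qed.

Lemma integrable_itv_obnd_cbnd (q : R -> R) a b : mu.-integrable `]a, b] (EFin \o q) ->
  mu.-integrable `[a, b] (EFin \o q).
Proof.
move=> /integrableP[mq fq]; apply/integrableP; split.
  exact/emeasurable_fun_itv_obnd_cbndP.
by rewrite -integral_itv_obnd_cbnd//; exact: measurableT_comp.
Qed.

Lemma integrable_itv0 (q : R -> R) b : mu.-integrable `]0, +oo[ (EFin \o q) ->
  mu.-integrable `]0, b] (EFin \o q).
Proof.
move=> iq; apply: integrableS iq => //.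
by move=> s; rewrite /= !in_itv/= andbT => /andP[].
Qed.

Lemma primitive_continuous (q : R -> R) : (forall M, mu.-integrable `]0, M] (EFin \o q)) ->
  forall s, 0 < s -> {for s, continuous (fun s => \int[mu]_(t in `]0, s]) q t)}.
Proof.
move=> qi s s0; have s1 : 0 < s + 1 by lra.
have qc b := integrable_itv_obnd_cbnd (qi b).
have h := @parameterized_integral_continuous R 0 (s + 1) q (ltW s1) (qc _).
have sI : s \in `]0, (s + 1)[ by rewrite in_itv/= s0 ltrDl ltr01.
rewrite (_ : (fun s => _) = (fun x => parameterized_integral mu 0 x q)).
  exact: within_continuous_continuous s1 h sI.
apply/funext => b; rewrite /parameterized_integral.
by rewrite -Rintegral_itv_obnd_cbnd.
Qed.

(** The hypothesis is the weak form of 4 (s F')' = Q. A test X supported in [a, b] is realised as s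
    h' by putting h' = X / s and integrating from the right, so h is constant, not zero, near 0. By
    parts against P(s) = \int_0^s Q, the identity says F' = P / (4 s) without a constant of
    integration: there is no flux from the origin. In t this reads dF/dt = P / 2. *)
Lemma weak_regularity (F Q : R -> R) :
  (forall M, mu.-integrable `]0, M] (EFin \o F)) ->
  (forall M, mu.-integrable `]0, M] (EFin \o Q)) ->
  (forall (h h1 h2 : R -> R) M, smooth h -> smooth h1 -> smooth h2 ->
    (forall s, is_derive s (1 : R) h (h1 s)) -> (forall s, is_derive s (1 : R) h1 (h2 s)) ->
    0 < M -> (forall s, M <= s -> h s = 0) ->
    4 * \int[mu]_(s in `]0, M]) (F s * (h1 s + s * h2 s)) = \int[mu]_(s in `]0, M]) (Q s * h s)) ->
  exists Ft, {ae mu, forall s, 0 < s -> F s = Ft s} /\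
    forall t, is_derive t (1 : R) (fun t => Ft (expR (2 * t)))
      (2^-1 * \int[mu]_(s in `]0, expR (2 * t)]) Q s).
Proof.
move=> iF iQ weak.
pose P s := \int[mu]_(t in `]0, s]) Q t.
have cP := primitive_continuous iQ.
have ck : continuous (fun t => 2^-1 * P (expR (2 * t))).
  move=> t; apply: cvgMr; apply: (@continuous_comp _ _ _ (fun t => expR (2 * t)) P).
    exact: is_derive_continuous (is_derive_expRM 2 t).
  by apply: cP; exact: expR_gt0.
have [K dK] := continuous_primitive ck.
(* The candidate for F: composition with ln s / 2 turns a primitive of P / 2 in t into one of P / (4
   s) on s > 0. *)
pose H s := K (2^-1 * ln s).
have dH s : 0 < s -> is_derive s (1 : R) H (P s / (4 * s)).
  move=> s0; have d1 : is_derive s (1 : R) (fun s => 2^-1 * ln s) (2^-1 * s^-1).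
    by have d := is_derive1_ln s0; apply: is_derive_eq.
  have := @is_derive1_comp R K (fun s => 2^-1 * ln s) s _ _ (dK _) d1.
  have -> : expR (2 * (2^-1 * ln s)) = s by rewrite mulVKf ?lnK ?posrE.
  have -> : 2^-1 * P s * (2^-1 * s^-1) = P s / (4 * s) by have := lt0r_neq0 s0 => ?; field.
  by [].
have cH s : 0 < s -> {for s, continuous H} by move=> s0; exact: is_derive_continuous (dH s s0).
have [] := @du_bois_reymond R (fun s => F s - H s).
- move=> a b a0; apply: (@integrableB _ _ _ mu _ (measurable_itv _) (EFin \o F) (EFin \o H)).
    apply: integrableS (iF b) => //.
    by move=> s /=; rewrite !in_itv/= => /andP[h1 ->]; rewrite (lt_le_trans a0 h1).
  apply: continuous_compact_integrable; first exact: segment_compact.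
  apply: continuous_in_subspaceT => s /set_mem /=; rewrite in_itv/= => /andP[h1 _].
  by apply: cH; exact: lt_le_trans h1.
- move=> X X' a b sX sX' dX a0 ab Xa Xb.
  have X0 s : s < a -> X s = 0 by move=> sa; exact: Xa (ltW sa).
  have X'0 s : s < a -> X' s = 0.
    move=> sa; have d := @is_derive_near0 X a s X0 sa; have d' := dX s.
    by rewrite -(@derive_val _ _ _ _ _ _ _ d') (@derive_val _ _ _ _ _ _ _ d).
  have X'1 s : b < s -> X' s = 0 by exact: smooth_derive_vanishing Xb dX s.
  have b0 : 0 < b by lra.
  pose h1 s := X s / s.
  have sh1 : smooth h1 := smooth_quotient sX a0 X0.
  have [h2 sh2 dh1] := smooth_derive sh1.
  have [g dg] := continuous_primitive (smooth_continuous sh1).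
  pose h s := g s - g b.
  have dh s : is_derive s (1 : R) h (h1 s).
    by have := is_deriveD (dg s) (is_derive_cst (- g b) s (1 : R)); rewrite addr0.
  have sh : smooth h := smooth_primitive sh1 dh.
  have hb s : b <= s -> h s = 0.
    move=> bs; transitivity (h b); last by rewrite /h subrr.
    apply/eqP; rewrite eq_le; apply/andP; split.
      apply: (derive_le0_ge bs (fun z _ => dh z)) => z /andP[bz _].
      by rewrite /h1 Xb ?mul0r// ltW.
    apply: (derive_ge0_le bs (fun z _ => dh z)) => z /andP[bz _].
    by rewrite /h1 Xb ?mul0r// ltW.
  have X'E s : h1 s + s * h2 s = X' s.
    have e : X = (fun s => s * h1 s).
      apply/funext => t; rewrite /h1; have [->|t0] := eqVneq t 0; first by rewrite mul0r X0.
      by field.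
    have d1 := dh1 s; have d2 : is_derive s (1 : R) (fun s => s * h1 s) (h1 s + s * h2 s).
      by apply: is_derive_eq; rewrite /GRing.scale/=; ring.
    have d3 := dX s; rewrite -(@derive_val _ _ _ _ _ _ _ d3).
    by rewrite {1}e (@derive_val _ _ _ _ _ _ _ d2).
  have := weak h h1 h2 b sh sh1 sh2 dh dh1 b0 hb.
  rewrite (primitive_by_parts b0 (iQ b) (smooth_continuous sh1) dh (hb _ (lexx _))).
  have sub : `[a, b] `<=` `]0, b].
    by move=> s /=; rewrite !in_itv/= => /andP[k1 ->]; rewrite (lt_le_trans a0 k1).
  have nin s : s \in [set` `]0, b]] -> ~ [set` `[a, b]] s -> s < a.
    rewrite inE /= !in_itv/= => /andP[s0 ->]; rewrite andbT => /negP; by rewrite -ltNge.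
  rewrite (@Rintegral_support R [set` `[a, b]])//; last first.
    by move=> s s1 s2; rewrite X'E X'0 ?mulr0//; apply: nin => //; rewrite inE.
  rewrite [in X in _ = - X](@Rintegral_support R [set` `[a, b]])//; last first.
    by move=> s s1 s2; rewrite /h1 X0 ?mul0r ?mulr0//; apply: nin => //; rewrite inE.
  have -> : \int[mu]_(s in `[a, b]) (F s * (h1 s + s * h2 s)) = \int[mu]_(s in `[a, b]) (F s * X' s).
    by apply: eq_Rintegral => s _; rewrite X'E.
  move=> key.
  have cX' := smooth_continuous sX'.
  have c1 := cut_continuous a0 cH cX' X'0.
  have h10 s : s < a -> h1 s = 0 by move=> sa; rewrite /h1 X0 ?mul0r.
  have c2 := cut_continuous a0 cP (smooth_continuous sh1) h10.
  have i1 := continuous_itv_integrable a b c1.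
  have i2 := continuous_itv_integrable a b c2.
  have i3 := @integrableZl _ _ _ mu _ (measurable_itv _) 4^-1 _ i2.
  have ibp : \int[mu]_(s in `[a, b]) (H s * X' s + 4^-1 * (P s * h1 s)) = 0.
    have cHX : continuous (fun s => H s * X' s + 4^-1 * (P s * h1 s)).
      by move=> s; apply: cvgD; [exact: c1|apply: cvgMr; exact: c2].
    have dHX s : is_derive s (1 : R) (fun s => H s * X s) (H s * X' s + 4^-1 * (P s * h1 s)).
      have [s0|s0] := ltP 0 s.
        have d1 := dH s s0; have d2 := dX s; apply: is_derive_eq.
        by rewrite /GRing.scale/= /h1; have := lt0r_neq0 s0 => ?; field.
      have sa : s < a by lra.
      rewrite X'0// h10// !mulr0 addr0; apply: (@is_derive_near0 _ a) => // t ta.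
      by rewrite X0 ?mulr0.
    by rewrite (Rintegral_FTC2 (ltW ab) cHX dHX) Xb// Xa// !mulr0 subrr.
  move: ibp; rewrite (@RintegralD _ _ _ mu _ _ _ (measurable_itv _) i1 i3).
  rewrite (@RintegralZl _ _ _ mu _ _ _ (measurable_itv _) i2) => ibp.
  have [C hC] := continuous_itv_bounded a b cX'.
  have iFX : mu.-integrable `[a, b] (EFin \o (fun s => F s * X' s)).
    apply: (@integrable_mul_bounded R [set` `[a, b]] F X' C (measurable_itv _)).
    - by apply: integrableS (iF b).
    - exact: measurable_funTS (continuous_measurable_fun cX').
    - by move=> s; rewrite /= in_itv/=; exact: hC.
  transitivity (\int[mu]_(s in `[a, b]) (F s * X' s - H s * X' s)).
    by apply: eq_Rintegral => s _; ring.
  rewrite (@RintegralB _ _ _ mu _ _ _ (measurable_itv _) iFX i1).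
  move: key ibp; rewrite -/P; lra.
move=> C hC; exists (fun s => H s + C); split.
  by apply: (@filterS _ _ (ae_filter_ringOfSetsType mu)) hC => s h s0; rewrite -(h s0); ring.
move=> t; have := is_deriveD (dK t) (is_derive_cst C t (1 : R)); rewrite addr0.
apply: near_eq_is_derive; near=> z.
by rewrite /H expRK mulKf.
Unshelve. all: by end_near. Qed.

End WeakRegularity.

(** * Radial form of the equation *)

Section RadialWeakForm.
Variable R : realType.
Notation mu := (@lebesgue_measure R).
Local Notation leb2 := (mu \x mu)%E.
Local Notation RB := (measurableTypeR R).
Local Notation R2 := (measurableTypeR R * measurableTypeR R)%type.
Implicit Types (s t : R) (x : R * R).

(** The argument is s = |x|^2, so ln s / 2 is ln |x|. *)
Definition rgreen (lambda s : R) : R := glog lambda (2^-1 * ln s).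

Lemma sqrt_expR s : 0 < s -> Num.sqrt s = expR (2^-1 * ln s).
Proof.
move=> s0; rewrite -{1}(lnK (_ : s \in Num.pos)) ?posrE//.
rewrite [X in expR X](_ : ln s = 2^-1 * ln s + 2^-1 * ln s); last by field.
by rewrite expRD -expr2 sqrtr_sqr ger0_norm ?expR_ge0.
Qed.

Lemma enorm_sqnorm x : enorm x = Num.sqrt (sqnorm x).
Proof. by []. Qed.

Lemma sqnorm_gt0 x : x != 0 -> 0 < sqnorm x.
Proof. by move=> x0; rewrite lt_neqAle sqnorm_ge0 andbT eq_sym sqnorm_eq0. Qed.

Lemma greenE lambda x : x != 0 -> green lambda x = rgreen lambda (sqnorm x).
Proof.
move=> x0; rewrite /green /rgreen /glog besselK_0 enorm_sqnorm (sqrt_expR (sqnorm_gt0 x0)).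
reflexivity.
Qed.

Lemma measurable_rgreen lambda : 0 < lambda -> measurable_fun (setT : set RB) (rgreen lambda : RB -> RB).
Proof.
move=> l0; apply: (measurableT_comp (f := (glog lambda : RB -> RB))).
  apply: continuous_measurable_fun => t; apply: is_derive_continuous (is_derive_glog l0 t).
by apply: measurable_funM => //; exact: measurable_ln.
Qed.

Lemma ReD (z w : R[i]) : complex.Re (z + w) = complex.Re z + complex.Re w.
Proof. by case: z => a b; case: w. Qed.

Lemma Re_mulr_real (z : R[i]) (r : R) : complex.Re (z * r%:C%C) = complex.Re z * r.
Proof. by case: z => a b /=; rewrite mulr0 subr0. Qed.

Lemma Re_nonlin p (z : R[i]) :
  complex.Re (nonlin p z) = Normc.normc z `^ (p - 1) * complex.Re z.
Proof. by case: z => a b /=; rewrite mul0r subr0. Qed.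

Section RadialSolution.
Variables (p alpha lambda : R) (u : R * R -> R[i]).
Hypotheses (l0 : 0 < lambda) (pos : positive_off0 u) (rad : radial u).

Definition radial_profile s : R := complex.Re (u (Num.sqrt s, 0)).

Lemma radial_profileE x : x != 0 -> u x = (radial_profile (sqnorm x))%:C%C.
Proof.
move=> x0; have -> : u x = u (Num.sqrt (sqnorm x), 0).
  apply: rad; rewrite !enorm_sqnorm {2}/sqnorm /= expr0n addr0 sqr_sqrtr//.
  exact: sqnorm_ge0.
have : 0 < u (Num.sqrt (sqnorm x), 0).
  apply: pos; rewrite -sqnorm_eq0 {1}/sqnorm /= expr0n addr0 sqr_sqrtr ?sqnorm_ge0//.
  by rewrite sqnorm_eq0.
rewrite ltcE /radial_profile; case: (u _) => a b /= /andP[/eqP -> _].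
by [].
Qed.

Lemma radial_profile_gt0 s : 0 < s -> 0 < radial_profile s.
Proof.
move=> s0; have : 0 < u (Num.sqrt s, 0).
  by apply: pos; rewrite -sqnorm_eq0 /sqnorm /= expr0n addr0 sqr_sqrtr ?ltW// gt_eqF.
by rewrite ltcE => /andP[].
Qed.

Lemma measurable_radial_profile : cmeasurable u ->
  measurable_fun (setT : set RB) (radial_profile : RB -> RB).
Proof.
move=> [mu1 _]; apply: (measurableT_comp (f := (fun x : R2 => complex.Re (u x) : RB))).
  exact: mu1.
apply: measurable_fun_pair => //; apply: continuous_measurable_fun; exact: sqrt_continuous.
Qed.

Local Notation U := radial_profile.
Local Notation G := (rgreen lambda).

(** Testing with h(|x|^2) + d G. The weak gradient of f is paired with the partial derivatives K_i
    of h(|x|^2), which are themselves test functions with divergence 4 (h' + s h''); polar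
    integration does the rest. As U, G and the tests are real, the identity sees the coefficient of
    G through its real part. *)
Theorem radial_weak_form : is_solution p alpha lambda u ->
  exists c : R, let F s := U s - c * G s in
  mu.-integrable `]0, +oo[ (EFin \o (fun s => F s ^+ 2)) /\
  forall (h h1 h2 : R -> R) M d, smooth h -> smooth h1 -> smooth h2 ->
    (forall s, is_derive s (1 : R) h (h1 s)) -> (forall s, is_derive s (1 : R) h1 (h2 s)) ->
    (forall s, M <= s -> h s = 0) ->
    polar_const R * (- 4 * (\int[mu]_(s in `]0, +oo[) (F s * (h1 s + s * h2 s)))
      + lambda * \int[mu]_(s in `]0, +oo[) (F s * h s)) + (alpha + beta_ lambda) * c * d =
    polar_const R * \int[mu]_(s in `]0, +oo[) (U s `^ p * (h s + d * G s)).
Proof.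
move=> [f [df [c [[mu1 [[f2 f2'] fdf] fE] weak]]]].
exists (complex.Re c); set a := complex.Re c; move=> F.
have mU := measurable_radial_profile mu1; have mG := measurable_rgreen l0.
have mF : measurable_fun (setT : set RB) (F : RB -> RB).
  by apply: measurable_funB => //; exact: measurable_funM.
have mFq : measurable_fun (setT : set R2) (fun x : R2 => F (sqnorm x)).
  by apply: (measurableT_comp mF); exact: measurable_sqnorm.
have reF : {ae leb2, forall x, complex.Re (f x) = F (sqnorm x)}.
  apply: (@filterS2 _ _ (ae_filter_ringOfSetsType leb2)) (@ae_neq0 R) fE => x x0.
  rewrite radial_profileE// greenE// /F => e.
  have : complex.Re (radial_profile (sqnorm x))%:C%C =
    complex.Re (f x + c * (G (sqnorm x))%:C%C) by rewrite e.
  by rewrite ReD Re_mulr_real /= => ->; rewrite addrK.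
have mRf : measurable_fun (setT : set R2) (fun x => complex.Re (f x)).
  by move: f2; rewrite inE => /andP[+ _]; rewrite inE.
split.
  have mF2 : measurable_fun (setT : set RB) (fun s => F s ^+ 2 : RB) by exact: measurable_sqr_fun mF.
  apply: (polar_integrable mF2).1.
  apply: (@ae_eq_integrable _ _ _ leb2 (fun x => complex.Re (f x) ^+ 2)).
  - exact: measurable_sqr_fun mRf.
  - exact: measurable_sqr_fun mFq.
  - by apply: (@filterS _ _ (ae_filter_ringOfSetsType leb2)) reF => x ->.
  - exact: Lfun2_integrable_sqr.
move=> h h1 h2 M d sh sh1 sh2 dh dh1 hM.
(* Derivatives are known to vanish only strictly beyond the bound, so each one costs a margin. *)
pose M' := M + 1.
have hM' s : M' <= s -> h s = 0 by move=> Ms; apply: hM; rewrite /M' in Ms; lra.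
have h1M' s : M' <= s -> h1 s = 0.
  by move=> Ms; apply: (smooth_derive_vanishing hM dh); rewrite /M' in Ms; lra.
have h2M s : M' + 1 <= s -> h2 s = 0.
  by move=> Ms; apply: (smooth_derive_vanishing h1M' dh1); lra.
have Hg := radial_H1_grad sh sh1 dh hM' h1M'.
pose K (i : 'I_2) x := 2 * (if i == ord0 then x.1 else x.2) * h1 (sqnorm x).
pose w x : R[i] := (h (sqnorm x) + d * G (sqnorm x))%:C%C.
have mh : measurable_fun (setT : set RB) (h : RB -> RB).
  exact: continuous_measurable_fun (smooth_continuous sh).
have mw1 : measurable_fun (setT : set RB) (fun s => h s + d * G s : RB).
  by apply: measurable_funD => //; exact: measurable_funM.
have mw : cmeasurable w.
  split => //=; apply: (measurableT_comp mw1); exact: measurable_sqnorm.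
have Hw : H1alpha_dec lambda w (fun x => (h (sqnorm x))%:C%C) (fun i x => (K i x)%:C%C) d%:C%C.
  split => //; apply: (@filterS _ _ (ae_filter_ringOfSetsType leb2)) (@ae_neq0 R) => x x0.
  by rewrite greenE// /w rmorphD rmorphM.
have key := weak _ _ _ _ Hw.
have sK i : smooth2 (K i).
  apply: smooth2_mul; last exact: smooth2_radial.
  by apply: smooth2_mul; [exact: smooth2_cst|exact: smooth2_coord].
have K0 i x : M' <= sqnorm x -> K i x = 0 by move=> Mx; rewrite /K h1M'// mulr0.
pose E (i : 'I_2) x := 2 * h1 (sqnorm x) + 4 * (if i == ord0 then x.1 else x.2) ^+ 2 * h2 (sqnorm x).
have sE i : smooth2 (E i).
  apply: smooth2_add; apply: smooth2_mul; try exact: smooth2_radial; first exact: smooth2_cst.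
  apply: smooth2_mul; first exact: smooth2_cst.
  by under eq_fun do rewrite expr2; apply: smooth2_mul; exact: smooth2_coord.
have E0 i x : M' + 1 <= sqnorm x -> E i x = 0.
  by move=> Mx; rewrite /E h1M' ?h2M ?mulr0 ?addr0//; lra.
have dK i x : is_derive x (basis_vec R i) (K i) (E i x).
  have d1 := is_derive_radial i x dh1; have d2 := is_derive_coord i x.
  have dd := is_deriveM (is_deriveM (is_derive_cst (2 : R) x (basis_vec R i)) d2) d1.
  apply: (@is_derive_eq _ _ _ _ _ _ _ _ dd).
  pose y := if i == ord0 then x.1 else x.2.
  change ((2 * y) * (2 * y * h2 (sqnorm x)) + h1 (sqnorm x) * (2 * 1 + y * 0) =
    2 * h1 (sqnorm x) + 4 * y ^+ 2 * h2 (sqnorm x)); ring.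
have L2K i : K i \in Lfun leb2 2%:E.
  exact: (vanishing_Lfun2 (smooth2_continuous (sK i)) (K0 i)).
have L2E i : E i \in Lfun leb2 2%:E.
  exact: (vanishing_Lfun2 (smooth2_continuous (sE i)) (E0 i)).
have ibp i : \int[leb2]_x (complex.Re (df i x) * K i x) =
    - \int[leb2]_x (complex.Re (f x) * E i x).
  have := (fdf i).2 (K i) (test_function_smooth2 (sK i) (K0 i)).
  move=> /(congr1 (@complex.Re R)) /= e.
  have e1 : \int[leb2]_x (complex.Re (f x) * E i x) =
      \int[leb2]_x complex.Re (f x * ('D_(basis_vec R i) (K i) x)%:C%C).
    apply: eq_Rintegral => x _; rewrite Re_mulr_real; congr (_ * _).
    by have d1 := dK i x; rewrite derive_val.
  rewrite e1; move: e; rewrite /cint /= => ->; rewrite opprK.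
  by apply: eq_Rintegral => x _; rewrite Re_mulr_real.
(* A quarter of the Laplacian of h(|x|^2). *)
pose W x := h1 (sqnorm x) + sqnorm x * h2 (sqnorm x).
have sW : smooth2 W.
  apply: smooth2_add; first exact: smooth2_radial.
  by apply: smooth2_mul; [exact: smooth2_sqnorm|exact: smooth2_radial].
have W0 x : M' + 1 <= sqnorm x -> W x = 0.
  by move=> Mx; rewrite /W h1M' ?h2M ?mulr0 ?addr0//; lra.
have L2W : W \in Lfun leb2 2%:E by exact: (vanishing_Lfun2 (smooth2_continuous sW) W0).
have EW x : E ord0 x + E (lift ord0 ord0) x = 4 * W x.
  by rewrite /E /W /=; move: (h1 (sqnorm x)) (h2 (sqnorm x)) => A B; rewrite /sqnorm; ring.
have int2 f1 g1 : f1 \in Lfun leb2 2%:E -> g1 \in Lfun leb2 2%:E ->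
    leb2.-integrable setT (EFin \o (fun x => f1 x * g1 x)).
  by move=> k1 k2; apply: (@Lfun1_integrable _ _ _ leb2 (f1 \* g1)).1; exact: Lfun2_mul_Lfun1.
have L : alpha_form alpha lambda f df c (fun x => (h (sqnorm x))%:C%C) (fun i x => (K i x)%:C%C) d%:C%C =
    \int[leb2]_x (complex.Re (df ord0 x) * K ord0 x + complex.Re (df (lift ord0 ord0) x) * K (lift ord0 ord0) x)
    + lambda * \int[leb2]_x (complex.Re (f x) * h (sqnorm x)) + (alpha + beta_ lambda) * a * d.
  rewrite /alpha_form !ReD; congr (_ + _ + _).
  - apply: eq_Rintegral => x _.
    by rewrite big_ord_recl big_ord1 ReD !conjc_real !Re_mulr_real.
  - rewrite mulrC Re_mulr_real mulrC; congr (_ * _).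
    by apply: eq_Rintegral => x _; rewrite conjc_real Re_mulr_real.
  - by rewrite conjc_real Re_mulr_real (mulrC (_%:C)%C) Re_mulr_real /a; ring.
have e1 : \int[leb2]_x (complex.Re (df ord0 x) * K ord0 x +
      complex.Re (df (lift ord0 ord0) x) * K (lift ord0 ord0) x) =
    - (4 * \int[leb2]_x (complex.Re (f x) * W x)).
  have j i := int2 _ _ (fdf i).1.1 (L2K i).
  rewrite (@RintegralD _ _ _ leb2 _ _ _ measurableT (j _) (j _)) !ibp -opprD.
  have k i := int2 _ _ f2 (L2E i).
  rewrite -(@RintegralD _ _ _ leb2 _ _ _ measurableT (k _) (k _)).
  have kW := int2 _ _ f2 L2W.
  rewrite -(@RintegralZl _ _ _ leb2 _ _ 4 measurableT kW).
  by congr (- _); apply: eq_Rintegral => x _; rewrite -mulrDr EW; ring.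
have mfq (q : R -> R) : continuous q -> measurable_fun (setT : set RB) (fun s => F s * q s : RB).
  by move=> cq; exact: measurable_mul_fun mF (continuous_measurable_fun cq).
have cW : continuous (fun s => h1 s + s * h2 s).
  move=> s; apply: cvgD; first exact: smooth_continuous.
  by apply: cvgM; [exact: cvg_id|exact: smooth_continuous].
have e2 (q : R -> R) : continuous q -> \int[leb2]_x (complex.Re (f x) * q (sqnorm x)) =
    polar_const R * \int[mu]_(s in `]0, +oo[) (F s * q s).
  move=> cq; rewrite -(polar_Rintegral (mfq q cq)); apply: (@ae_eq_Rintegral _ _ _ leb2).
  - apply: measurable_mul_fun mRf _.
    by apply: (measurableT_comp (continuous_measurable_fun cq)); exact: measurable_sqnorm.
  - exact: (measurableT_comp (mfq q cq) (@measurable_sqnorm R)).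
  - by apply: (@filterS _ _ (ae_filter_ringOfSetsType leb2)) reF => x ->.
have mUp : measurable_fun (setT : set RB) (fun s => U s `^ p * (h s + d * G s) : RB).
  apply: measurable_mul_fun mw1.
  exact: (measurableT_comp (measurable_powR p) mU).
have e3 : complex.Re (cint (fun x => nonlin p (u x) * (w x)^*%C)) =
    polar_const R * \int[mu]_(s in `]0, +oo[) (U s `^ p * (h s + d * G s)).
  rewrite -(polar_Rintegral mUp).
  transitivity (\int[leb2]_x (Normc.normc (u x) `^ (p - 1) * complex.Re (u x) * (h (sqnorm x) + d * G (sqnorm x)))).
    by apply: eq_Rintegral => x _; rewrite /w conjc_real Re_mulr_real Re_nonlin.
  apply: (@ae_eq_Rintegral _ _ _ leb2).
  - apply: measurable_mul_fun (measurableT_comp mw1 (@measurable_sqnorm R)).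
    apply: measurable_mul_fun mu1.1.
    apply: (measurableT_comp (f := (fun y : RB => y `^ (p - 1) : RB))); first exact: measurable_powR.
    rewrite (_ : (fun x => _) = (fun x => Num.sqrt (complex.Re (u x) ^+ 2 + complex.Im (u x) ^+ 2))); last first.
      by apply/funext => x; case: (u x).
    apply: (measurableT_comp (f := (Num.sqrt : RB -> RB))).
      by apply: continuous_measurable_fun; exact: sqrt_continuous.
    by apply: measurable_funD; [exact: measurable_sqr_fun mu1.1|exact: measurable_sqr_fun mu1.2].
  - exact: (measurableT_comp mUp (@measurable_sqnorm R)).
  - apply: (@filterS _ _ (ae_filter_ringOfSetsType leb2)) (@ae_neq0 R) => x x0.
    have U0 := radial_profile_gt0 (sqnorm_gt0 x0).
    rewrite radial_profileE//= expr0n addr0 sqrtr_sqr (gtr0_norm U0).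
    by rewrite -{2}(powRr1 (ltW U0)) -powRD ?subrK// (gt_eqF U0) implybT.
move: key; rewrite L e1 e3 (e2 _ cW) (e2 _ (smooth_continuous sh)) => <-.
by rewrite /F; ring.
Qed.

End RadialSolution.

End RadialWeakForm.

(** * The radial weak equation *)

Section RadialTest.
Variable R : realType.
Notation mu := (@lebesgue_measure R).
Local Notation RB := (measurableTypeR R).
Implicit Types (s t : R) (h k : R -> R).

(** No vanishing near s = 0 is imposed, so that tests see the origin. *)
Record radial_test h h1 h2 (M : R) : Prop := RadialTest {
  test_smooth : smooth h;
  test_smooth1 : smooth h1;
  test_smooth2 : smooth h2;
  test_derive : forall s, is_derive s (1 : R) h (h1 s);
  test_derive1 : forall s, is_derive s (1 : R) h1 (h2 s);
  test_vanish : forall s, M <= s -> h s = 0 }.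

(** With [d = 1] the zero function tests the equation with the Green function alone. *)
Lemma radial_test0 : radial_test (cst 0) (cst 0) (cst 0) 0.
Proof. by split => // *; try exact: smooth_cst; exact: is_derive_cst. Qed.

Lemma radial_testD h h1 h2 M k k1 k2 N : radial_test h h1 h2 M -> radial_test k k1 k2 N ->
  radial_test (fun s => h s + k s) (fun s => h1 s + k1 s) (fun s => h2 s + k2 s) (Num.max M N).
Proof.
move=> [sh sh1 sh2 dh dh1 hM] [sk sk1 sk2 dk dk1 kM]; split.
- exact: smooth_add.
- exact: smooth_add.
- exact: smooth_add.
- by move=> s; exact: is_deriveD (dh s) (dk s).
- by move=> s; exact: is_deriveD (dh1 s) (dk1 s).
- by move=> s; rewrite ge_max => /andP[Ms Ns]; rewrite hM// kM// addr0.
Qed.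

Lemma radial_test_bump x r : 0 < r ->
  exists h1 h2, radial_test (bump x r) h1 h2 (x + r).
Proof.
move=> r0; have [h1 sh1 dh1] := smooth_derive (smooth_bump x r).
have [h2 sh2 dh2] := smooth_derive sh1.
exists h1, h2; split => //; first exact: smooth_bump.
by move=> s xs; rewrite bump_eq0// ler_normr; apply/orP; left; lra.
Qed.

Lemma radial_test_vanish1 h h1 h2 M s : radial_test h h1 h2 M -> M < s -> h1 s = 0.
Proof. by move=> [_ _ _ dh _ hM]; exact: smooth_derive_vanishing hM dh s. Qed.

Lemma radial_test_vanish2 h h1 h2 M s : radial_test h h1 h2 M -> M < s -> h2 s = 0.
Proof.
move=> T Ms; have d := test_derive1 T s; rewrite -(@derive_val _ _ _ _ _ _ _ d).
rewrite (@near_eq_derive _ _ _ h1 (cst 0)) ?derive_cst ?oner_neq0//.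
by near=> t; apply: (radial_test_vanish1 T); near: t; exact: lt_nbhsr.
Unshelve. all: by end_near. Qed.

Lemma locally_integrable_mul (F q : R -> R) M :
  (forall M, mu.-integrable `]0, M] (EFin \o F)) -> continuous q ->
  (forall s, M <= s -> q s = 0) -> mu.-integrable `]0, +oo[ (EFin \o (fun s => F s * q s)).
Proof.
move=> iF cq q0; have [C hC] := continuous_itv_bounded 0 M cq.
have h : mu.-integrable `]0, M] (EFin \o (fun s => F s * q s)).
  apply: (@integrable_mul_bounded R [set` `]0, M]] F q C (measurable_itv _) (iF M)).
    exact: measurable_funTS (continuous_measurable_fun cq).
  by move=> s; rewrite /= in_itv/= => /andP[s0 sM]; apply: hC; rewrite ltW.
have := integrable_patch (measurable_itv _) h.
suff -> : (fun s => F s * q s) \_ `]0, M] = (fun s => F s * q s) \_ `]0, +oo[.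
  by move=> k; rewrite integrable_mkcond//= restrict_EFin.
apply/funext => s; rewrite !patchE.
have [|sM] := boolP (s \in [set` `]0, M]]).
  rewrite inE /= in_itv/= => /andP[s0 sM].
  by rewrite mem_set//= in_itv/= s0.
have [|//] := boolP (s \in [set` `]0, +oo[]); rewrite inE /= in_itv/= andbT => s0.
move: sM; rewrite notin_setE /= in_itv/= s0 => /negP; rewrite -ltNge => /ltW Ms.
by rewrite q0 ?mulr0.
Qed.

Lemma locally_Rintegral_mul (F q : R -> R) M : (forall s, M < s -> q s = 0) ->
  \int[mu]_(s in `]0, +oo[) (F s * q s) = \int[mu]_(s in `]0, M]) (F s * q s).
Proof.
move=> q0; apply: Rintegral_support.
  by move=> s; rewrite /= !in_itv/= andbT => /andP[].
move=> s; rewrite /= !in_itv/= andbT => -> /negP; rewrite /= -ltNge => Ms.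
by rewrite q0 ?mulr0.
Qed.

Lemma square_locally_integrable (F : R -> R) M : measurable_fun setT F ->
  mu.-integrable `]0, +oo[ (EFin \o (fun s => F s ^+ 2)) -> mu.-integrable `]0, M] (EFin \o F).
Proof.
move=> mF iF.
have i1 := integrable_itv0 M iF.
have i2 : mu.-integrable `]0, M] (EFin \o cst (1 : R)).
  apply: integrableS (@continuous_itv_integrable R (cst 1) 0 M _) => //.
    exact: subset_itv_oc_cc.
  exact: cst_continuous.
apply: le_integrable (@integrableD _ _ _ mu _ (measurable_itv _) _ _ i1 i2) => //.
  by apply/measurable_EFinP; exact: measurable_funTS.
move=> s _; change (`|(F s)%:E| <= `|(F s ^+ 2 + 1)%:E|)%E; rewrite !lee_fin.
rewrite [leRHS]ger0_norm ?addr_ge0 ?sqr_ge0// -(real_normK (num_real (F s))).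
have := sqr_ge0 (`|F s| - 1); nra.
Qed.

Lemma Rintegral_gt0 (f : R -> R) a b : a < b -> mu.-integrable `]0, +oo[ (EFin \o f) ->
  0 <= a -> (forall s, 0 < s -> 0 <= f s) -> (forall s, a < s < b -> 0 < f s) ->
  0 < \int[mu]_(s in `]0, +oo[) f s.
Proof.
move=> ab fi a0 f0 f1; rewrite lt_neqAle Rintegral_ge0 ?andbT; last first.
  by move=> s; rewrite /= in_itv/= andbT; exact: f0.
apply/negP => /eqP e.
have fin := @integrable_fin_num _ _ _ mu `]0, +oo[ (measurable_itv _) _ fi.
have e0 : (\int[mu]_(s in `]0%R, +oo[) `|(EFin \o f) s| = 0)%E.
  transitivity ((\int[mu]_(s in `]0, +oo[) f s)%:E); last by rewrite -e.
  rewrite /Rintegral (fineK fin); apply: eq_integral => s.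
  rewrite inE /= in_itv/= andbT => s0; rewrite ger0_norm//; exact: f0.
have mf := measurable_int _ fi.
have [N [mN N0 hN]] := (@ae_eq_integral_abs _ _ _ mu _ (measurable_itv _) _ mf).1 e0.
have : (mu `]a, b[ <= mu N)%E.
  apply: le_measure; rewrite ?inE//.
  move=> s; rewrite /= in_itv/= => sab; apply: hN => /= h.
  have s0 : 0 < s by move/andP: sab => [sa _]; exact: le_lt_trans a0 sa.
  have : (f s)%:E = 0%E by apply: h; rewrite /= in_itv/= s0.
  by case=> fs; have := f1 s sab; rewrite fs ltxx.
by rewrite N0 lebesgue_measure_itv/= lte_fin ab -EFinB lee_fin; lra.
Qed.

Lemma ae_itv_exists (P : R -> Prop) a b : a < b -> {ae mu, forall s, P s} ->
  exists2 s, a < s < b & P s.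
Proof.
move=> ab [N [mN N0 hN]]; apply: contrapT => h.
have : (mu `]a, b[ <= mu N)%E.
  apply: le_measure; rewrite ?inE//.
  move=> s; rewrite /= in_itv/= => sab; apply: hN => /= Ps; apply: h.
  by exists s.
by rewrite N0 lebesgue_measure_itv/= lte_fin ab -EFinB lee_fin; lra.
Qed.

End RadialTest.

(** * Convergence of the nonlinear integrals *)

Section RadialSolution.
Variable R : realType.
Notation mu := (@lebesgue_measure R).
Local Notation RB := (measurableTypeR R).
Implicit Types (s t : R) (h k : R -> R).
Variables (p lambda c m : R) (U G : R -> R).
Hypotheses (p1 : 1 < p) (l0 : 0 < lambda).
Hypotheses (mU : measurable_fun (setT : set RB) (U : RB -> RB)) (U0 : forall s, 0 < s -> 0 < U s).
Hypotheses (mG : measurable_fun (setT : set RB) (G : RB -> RB)) (G0 : forall s, 0 < s -> 0 < G s).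
Hypothesis cG : forall s, 0 < s -> {for s, continuous G}.
Let F s := U s - c * G s.
Hypothesis iF2 : mu.-integrable `]0, +oo[ (EFin \o (fun s => F s ^+ 2)).
Hypothesis weak : forall h h1 h2 M d, radial_test h h1 h2 M ->
  - 4 * (\int[mu]_(s in `]0, +oo[) (F s * (h1 s + s * h2 s)))
    + lambda * \int[mu]_(s in `]0, +oo[) (F s * h s) + m * d =
  \int[mu]_(s in `]0, +oo[) (U s `^ p * (h s + d * G s)).

Let mF : measurable_fun (setT : set RB) (F : RB -> RB).
Proof. by apply: measurable_funB => //; exact: measurable_funM. Qed.

Let mUp : measurable_fun (setT : set RB) (fun s => U s `^ p : RB).
Proof. exact: (measurableT_comp (measurable_powR p) mU). Qed.

Let iF M : mu.-integrable `]0, M] (EFin \o F).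
Proof. exact: square_locally_integrable. Qed.

Let form h h1 h2 : R := - 4 * (\int[mu]_(s in `]0, +oo[) (F s * (h1 s + s * h2 s)))
    + lambda * \int[mu]_(s in `]0, +oo[) (F s * h s).

Let test_continuous h h1 h2 M : radial_test h h1 h2 M -> continuous (fun s => h1 s + s * h2 s).
Proof.
move=> [_ sh1 sh2 _ _ _] s; apply: cvgD; first exact: smooth_continuous.
by apply: cvgM; [exact: cvg_id|exact: smooth_continuous].
Qed.

Let int_test1 h h1 h2 M : radial_test h h1 h2 M ->
  mu.-integrable `]0, +oo[ (EFin \o (fun s => F s * (h1 s + s * h2 s))).
Proof.
move=> T; apply: (@locally_integrable_mul _ _ _ (M + 2) iF (test_continuous T)).
by move=> s Ms; rewrite (radial_test_vanish1 T) ?(radial_test_vanish2 T) ?mulr0 ?addr0//; lra.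
Qed.

Let int_test h h1 h2 M : radial_test h h1 h2 M ->
  mu.-integrable `]0, +oo[ (EFin \o (fun s => F s * h s)).
Proof.
move=> T; apply: (@locally_integrable_mul _ _ _ M iF) (test_vanish T).
exact: smooth_continuous (test_smooth T).
Qed.

Let formD h h1 h2 M k k1 k2 N : radial_test h h1 h2 M -> radial_test k k1 k2 N ->
  form (fun s => h s + k s) (fun s => h1 s + k1 s) (fun s => h2 s + k2 s) = form h h1 h2 + form k k1 k2.
Proof.
move=> T S; rewrite /form.
have e1 := @RintegralD _ _ _ mu _ _ _ (measurable_itv `]0, +oo[) (int_test1 T) (int_test1 S).
have e2 := @RintegralD _ _ _ mu _ _ _ (measurable_itv `]0, +oo[) (int_test T) (int_test S).
have -> : \int[mu]_(s in `]0, +oo[) (F s * (h1 s + k1 s + s * (h2 s + k2 s))) =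
    \int[mu]_(s in `]0, +oo[) (F s * (h1 s + s * h2 s)) + \int[mu]_(s in `]0, +oo[) (F s * (k1 s + s * k2 s)).
  by rewrite -e1; apply: eq_Rintegral => s _; ring.
have -> : \int[mu]_(s in `]0, +oo[) (F s * (h s + k s)) =
    \int[mu]_(s in `]0, +oo[) (F s * h s) + \int[mu]_(s in `]0, +oo[) (F s * k s).
  by rewrite -e2; apply: eq_Rintegral => s _; ring.
ring.
Qed.

Let weak0 h h1 h2 M : radial_test h h1 h2 M ->
  form h h1 h2 = \int[mu]_(s in `]0, +oo[) (U s `^ p * h s).
Proof.
move=> T; have := weak 0 T; rewrite mulr0 addr0 /form => ->.
by apply: eq_Rintegral => s _; rewrite mul0r addr0.
Qed.

Let mtest h h1 h2 M : radial_test h h1 h2 M -> measurable_fun (setT : set RB) (fun s => U s `^ p * h s : RB).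
Proof.
move=> T; apply: measurable_mul_fun mUp _.
exact: continuous_measurable_fun (smooth_continuous (test_smooth T)).
Qed.

Let form_eq0 h h1 h2 M : radial_test h h1 h2 M ->
  ~ mu.-integrable `]0, +oo[ (EFin \o (fun s => U s `^ p * h s)) -> form h h1 h2 = 0.
Proof. by move=> T nT; rewrite (weak0 T); apply: Rintegral_nonintegrable => //; exact: measurable_funTS (mtest T). Qed.

Let regular (Q : R -> R) : (forall M, mu.-integrable `]0, M] (EFin \o Q)) ->
  (forall h h1 h2 M, radial_test h h1 h2 M -> 0 < M ->
     4 * \int[mu]_(s in `]0, M]) (F s * (h1 s + s * h2 s)) = \int[mu]_(s in `]0, M]) (Q s * h s)) ->
  exists Ft, {ae mu, forall s, 0 < s -> F s = Ft s} /\
    forall t, is_derive t (1 : R) (fun t => Ft (expR (2 * t)))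
      (2^-1 * \int[mu]_(s in `]0, expR (2 * t)]) Q s).
Proof.
move=> iQ wQ; apply: weak_regularity => // h h1 h2 M sh sh1 sh2 dh dh1 M0 hM.
by apply: (wQ _ _ _ _ _ M0); split.
Qed.

Let local1 h h1 h2 M : radial_test h h1 h2 M ->
  \int[mu]_(s in `]0, +oo[) (F s * (h1 s + s * h2 s)) =
  \int[mu]_(s in `]0, M]) (F s * (h1 s + s * h2 s)).
Proof.
move=> T; apply: (@locally_Rintegral_mul R F (fun s => h1 s + s * h2 s)) => s Ms.
by rewrite (radial_test_vanish1 T Ms) (radial_test_vanish2 T Ms) mulr0 addr0.
Qed.

Let local0 (q : R -> R) h h1 h2 M : radial_test h h1 h2 M ->
  \int[mu]_(s in `]0, +oo[) (q s * h s) = \int[mu]_(s in `]0, M]) (q s * h s).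
Proof.
by move=> T; apply: locally_Rintegral_mul => s Ms; rewrite (test_vanish T)// ltW.
Qed.

Let bump_form h1 h2 : radial_test (bump 2 1) h1 h2 (2 + 1) ->
  mu.-integrable `]0, +oo[ (EFin \o (fun s => U s `^ p * bump 2 1 s)) ->
  0 < form (bump 2 1) h1 h2.
Proof.
move=> T i; rewrite (weak0 T); apply: (@Rintegral_gt0 _ _ 1 3) => //; first lra.
- by move=> s s0; rewrite mulr_ge0 ?powR_ge0 ?bump_ge0.
- move=> s /andP[s1 s3]; rewrite mulr_gt0 ?powR_gt0 ?U0//; first lra.
  by apply: bump_gt0 => //; rewrite ltr_norml; lra.
Qed.

(** U^p is locally bounded up to null sets once U agrees almost everywhere with a function
    continuous on s > 0. *)
Let bump_integrable (Ft : R -> R) : {ae mu, forall s, 0 < s -> F s = Ft s} ->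
  continuous (fun t => Ft (expR (2 * t))) ->
  mu.-integrable `]0, +oo[ (EFin \o (fun s => U s `^ p * bump 2 1 s)).
Proof.
move=> FFt cFt; pose z t := Ft (expR (2 * t)) + c * G (expR (2 * t)).
have cz : continuous z.
  move=> t; apply: cvgD; first exact: cFt.
  apply: cvgMr; apply: (@continuous_comp _ _ _ (fun t => expR (2 * t)) G).
    exact: is_derive_continuous (is_derive_expRM 2 t).
  by apply: cG; exact: expR_gt0.
(* This interval for t corresponds to 1 <= s <= 3, the support of the bump. *)
have [C hC] := continuous_itv_bounded 0 (2^-1 * ln 3) cz.
have ln3 : 0 <= 2^-1 * ln 3 :> R by rewrite mulr_ge0// ln_ge0// ler1n.
have C0 : 0 <= C by apply: le_trans (hC 0 _); rewrite ?normr_ge0// lexx.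
have sm := smooth_continuous (smooth_bump (2 : R) 1).
have off s : s \notin [set` `[1, 3]] -> bump 2 1 s = 0.
  rewrite notin_setE /= in_itv/= => /negP; rewrite negb_and -!ltNge => h.
  rewrite bump_eq0// ler_normr; apply/orP.
  by case/orP: h => h; [right|left]; lra.
(* On the support of the bump, cutting U off at [C] changes it only on a null set, and it gives a
   bounded integrand. *)
pose f2 s := Num.min (U s) C `^ p * bump 2 1 s.
have mf2 : measurable_fun (setT : set RB) (f2 : RB -> RB).
  apply: measurable_mul_fun (continuous_measurable_fun sm).
  apply: (measurableT_comp (measurable_powR p)).
  exact: measurable_minr.
have mf1 : measurable_fun (setT : set RB) (fun s => U s `^ p * bump 2 1 s : RB).
  exact: measurable_mul_fun mUp (continuous_measurable_fun sm).
have i2 : mu.-integrable setT (EFin \o f2).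
  have i3 := integrable_patch (measurable_itv `[1, 3]) (continuous_itv_integrable 1 3 sm).
  have i4 := @integrableZl _ _ _ mu _ measurableT (C `^ p) _ i3.
  apply: le_integrable i4 => //; first exact/measurable_EFinP.
  move=> s _; change (`|(f2 s)%:E| <= `|(C `^ p * (bump 2 1 \_ `[1, 3]) s)%:E|)%E.
  rewrite !lee_fin /f2 patchE; case: ifPn => [|s13]; last by rewrite off// mulr0 normr0.
  rewrite inE /= in_itv/= => /andP[s1 s3].
  have bs0 := bump_ge0 2 1 s.
  rewrite ger0_norm; last by apply: mulr_ge0 bs0; exact: powR_ge0.
  rewrite ger0_norm; last by apply: mulr_ge0 bs0; exact: powR_ge0.
  apply: ler_wpM2r bs0 _ _ _; apply: ge0_ler_powR; rewrite ?nnegrE//.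
  - by have := p1; lra.
  - by rewrite le_min C0 andbT ltW// U0//; lra.
  - by rewrite ge_min lexx orbT.
have i1 : mu.-integrable setT (EFin \o (fun s => U s `^ p * bump 2 1 s)).
  apply: (ae_eq_integrable mf2 mf1 _ i2).
  apply: (@filterS _ _ (ae_filter_ringOfSetsType mu)) FFt => s hs; rewrite /f2.
  have [|s13] := boolP (s \in [set` `[1, 3]]); last by rewrite off// !mulr0.
  rewrite inE /= in_itv/= => /andP[s1 s3]; congr (_ `^ _ * _).
  have s0 : 0 < s by apply: lt_le_trans s1.
  apply: min_idPl; rewrite (_ : U s = z (2^-1 * ln s)).
    apply: le_trans (ler_norm _) (hC _ _).
    rewrite mulr_ge0 ?ln_ge0//= ler_wpM2l// ler_ln ?posrE//; exact: lt_le_trans s3.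
  rewrite /z (_ : 2 * (2^-1 * ln s) = ln s) ?lnK ?posrE//; last by rewrite mulVKf.
  by rewrite -hs// /F subrK.
by apply: integrableS i1.
Qed.

(* A divergent integral is 0 by convention. If it occurred for some test
   function, the right-hand side of the equation would vanish for all of them:
   U would be almost everywhere continuous, contradicting U > 0. *)
Let integrable_test h h1 h2 M : radial_test h h1 h2 M ->
  mu.-integrable `]0, +oo[ (EFin \o (fun s => U s `^ p * h s)).
Proof.
move=> T; apply: contrapT => nT.
have form0 k k1 k2 N : radial_test k k1 k2 N -> form k k1 k2 = 0.
  move=> S; have [iS|nS] := pselect (mu.-integrable `]0, +oo[ (EFin \o (fun s => U s `^ p * k s))); last exact: form_eq0 S nS.
  (* If the integral for [k] converges, the one for [h + k] diverges; the form vanishes on the sum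
     and on [h], hence on [k]. *)
  have TS := radial_testD T S.
  have : form (fun s => h s + k s) (fun s => h1 s + k1 s) (fun s => h2 s + k2 s) = 0.
    apply: (form_eq0 TS) => iTS; apply: nT.
    have := @integrableB _ _ _ mu _ (measurable_itv _) _ _ iTS iS.
    congr (mu.-integrable _ _); apply/funext => s /=; rewrite -EFinB; congr EFin; ring.
  by rewrite (formD T S) (form_eq0 T nT) add0r.
have [||Ft [FFt dFt]] := @regular (fun s => lambda * F s).
- by move=> N; exact: (@integrableZl _ _ _ mu _ (measurable_itv _) lambda _ (iF N)).
- move=> k k1 k2 N S N0; have := form0 _ _ _ _ S; rewrite /form (local1 S) (local0 F S).
  have -> : \int[mu]_(s in `]0, N]) (lambda * F s * k s) = lambda * \int[mu]_(s in `]0, N]) (F s * k s).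
    rewrite -RintegralZl//; first by apply: eq_Rintegral => s _; ring.
    exact: integrable_itv0 (int_test S).
  lra.
have [k1 [k2 S]] := @radial_test_bump R 2 1 ltr01.
have := bump_form S (bump_integrable FFt (fun t => is_derive_continuous (dFt t))).
by rewrite (form0 _ _ _ _ S) ltxx.
Qed.

(** Otherwise the right-hand side diverges for every test h + G, so the form equals - m on all h.
    The zero test gives m = 0, and this contradicts the positivity of the form on a bump. *)
Let integrable_green : mu.-integrable `]0, +oo[ (EFin \o (fun s => U s `^ p * G s)).
Proof.
apply: contrapT => nG.
have form0 k k1 k2 N : radial_test k k1 k2 N -> form k k1 k2 + m = 0.
  move=> S; have := weak 1 S; rewrite mulr1 => ->; apply: Rintegral_nonintegrable => //.
    apply: measurable_funTS; apply: measurable_mul_fun mUp _.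
    apply: measurable_funD; first exact: continuous_measurable_fun (smooth_continuous (test_smooth S)).
    exact: measurable_funM.
  move=> i; apply: nG; have := @integrableB _ _ _ mu _ (measurable_itv _) _ _ i (integrable_test S).
  congr (mu.-integrable _ _); apply/funext => s /=; rewrite -EFinB; congr EFin; ring.
have m0 : m = 0.
  have := form0 _ _ _ _ (radial_test0 R).
  have -> : form (cst 0) (cst 0) (cst 0) = 0; last by rewrite add0r.
  rewrite (weak0 (radial_test0 R)) /Rintegral integral0_eq// => s _.
  by rewrite /cst mulr0.
have [k1 [k2 S]] := @radial_test_bump R 2 1 ltr01.
have := bump_form S (integrable_test S).
by have := form0 _ _ _ _ S; rewrite m0 addr0 => ->; rewrite ltxx.
Qed.

Let mE : m = \int[mu]_(s in `]0, +oo[) (U s `^ p * G s).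
Proof.
have := weak 1 (radial_test0 R); rewrite mulr1.
have -> : - 4 * (\int[mu]_(s in `]0, +oo[) (F s * (cst 0 s + s * cst 0 s)))
    + lambda * \int[mu]_(s in `]0, +oo[) (F s * cst 0 s) = 0.
  rewrite -[LHS]/(form (cst 0) (cst 0) (cst 0)) (weak0 (radial_test0 R)) /Rintegral integral0_eq// => s _.
  by rewrite /cst mulr0.
by rewrite add0r => ->; apply: eq_Rintegral => s _; rewrite /cst add0r mul1r.
Qed.

Let m_gt0 : 0 < m.
Proof.
rewrite mE; apply: (@Rintegral_gt0 _ _ 1 2) => //; first lra.
- by move=> s s0; rewrite mulr_ge0 ?powR_ge0// ltW// G0.
- move=> s /andP[s1 s2]; have s0 : 0 < s by lra.
  by rewrite mulr_gt0 ?powR_gt0 ?U0 ?G0.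
Qed.

(** The bump is centred at the origin and wide enough for ]0, M] to lie in the middle half of its
    support, so integrability reaches down to s = 0. *)
Let iUp M : mu.-integrable `]0, M] (EFin \o (fun s => U s `^ p)).
Proof.
have m1 : 0 < `|M| + 1 by have := normr_ge0 M; lra.
have m2 : 0 < 2 * (`|M| + 1) by lra.
have [k1 [k2 S]] := @radial_test_bump R 0 (2 * (`|M| + 1)) m2.
have i0 : mu.-integrable `]0, M] (EFin \o (fun s => U s `^ p * bump 0 (2 * (`|M| + 1)) s)).
  exact: integrable_itv0 (integrable_test S).
have i1 := @integrableZl _ _ _ mu _ (measurable_itv _) (bump_floor R)^-1 _ i0.
apply: le_integrable i1 => //.
  apply/measurable_EFinP; exact: measurable_funTS mUp.
move=> s; rewrite /= in_itv/= => /andP[s0 sM].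
change (`|(U s `^ p)%:E| <= `|((bump_floor R)^-1 * (U s `^ p * bump 0 (2 * (`|M| + 1)) s))%:E|)%E.
have b0 := bump_floor_gt0 R.
rewrite !lee_fin ger0_norm ?powR_ge0// [leRHS]ger0_norm; last first.
  by rewrite mulr_ge0 ?invr_ge0 ?(ltW b0)// mulr_ge0 ?powR_ge0 ?bump_ge0.
rewrite ler_pdivlMl// mulrC ler_wpM2l ?powR_ge0//.
apply: bump_floor_le => //; rewrite subr0 (gtr0_norm s0).
have := ler_norm M; lra.
Qed.

(** Testing with the Green function identifies [m], the coefficient of the singular part in the
    equation, with the integral of U^p G; hence its positivity. *)
Theorem radial_regularity :
  [/\ forall M, mu.-integrable `]0, M] (EFin \o (fun s => U s `^ p)),
      mu.-integrable `]0, +oo[ (EFin \o (fun s => U s `^ p * G s)),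
      0 < m, m = \int[mu]_(s in `]0, +oo[) (U s `^ p * G s) &
  exists Ft, {ae mu, forall s, 0 < s -> U s - c * G s = Ft s} /\
    forall t, is_derive t (1 : R) (fun t => Ft (expR (2 * t)))
      (2^-1 * \int[mu]_(s in `]0, expR (2 * t)]) (lambda * (U s - c * G s) - U s `^ p))].
Proof.
split; [exact: iUp|exact: integrable_green|exact: m_gt0|exact: mE|].
have iQ1 M := @integrableZl _ _ _ mu _ (measurable_itv _) lambda _ (iF M).
apply: (@regular (fun s => lambda * F s - U s `^ p)).
  by move=> M; exact: (@integrableB _ _ _ mu _ (measurable_itv _) _ _ (iQ1 M) (iUp M)).
move=> h h1 h2 M T M0; have := weak0 T; rewrite /form (local1 T) (local0 F T) (local0 (fun s => U s `^ p) T).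
have i1 : mu.-integrable `]0, M] (EFin \o (fun s => F s * h s)).
  exact: integrable_itv0 (int_test T).
have i2 : mu.-integrable `]0, M] (EFin \o (fun s => U s `^ p * h s)).
  exact: integrable_itv0 (integrable_test T).
have i3 := @integrableZl _ _ _ mu _ (measurable_itv _) lambda _ i1.
have -> : \int[mu]_(s in `]0, M]) ((lambda * F s - U s `^ p) * h s) =
    lambda * \int[mu]_(s in `]0, M]) (F s * h s) - \int[mu]_(s in `]0, M]) (U s `^ p * h s).
  rewrite -(@RintegralZl _ _ _ mu _ _ _ (measurable_itv _) i1).
  rewrite -(@RintegralB _ _ _ mu _ _ _ (measurable_itv _) i3 i2).
  by apply: eq_Rintegral => s _; ring.
lra.
Qed.

End RadialSolution.

(** * From weak to classical solutions *)

Section HalfLineIntegral.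
Variable R : realType.
Notation mu := (@lebesgue_measure R).
Local Notation RB := (measurableTypeR R).
Implicit Types (s t : R) (f q w v : R -> R).

(** Zeros of [w] must be allowed: the differential equation is established for w >= 0 before it can
    yield w > 0. *)
Lemma powR_continuous_ge0 w (a : R) : 0 < a -> continuous w -> (forall t, 0 <= w t) ->
  continuous (fun t => w t `^ a).
Proof.
move=> a0 cw w0 t; have := w0 t; rewrite le_eqVlt => /predU1P[wt|wt]; last first.
  apply: (@continuous_comp _ _ _ w (fun y => y `^ a)); first exact: cw.
  exact: (is_derive_continuous (is_derive1_powR a wt)).
rewrite /continuous_at -wt powR0 ?gt_eqF//; apply/cvgrPdist_le => e e0.
have ea : 0 < e `^ a^-1 by rewrite powR_gt0.
have := cw t; rewrite /continuous_at -wt => /cvgrPdist_lt/(_ _ ea); apply: filterS => z.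
rewrite !sub0r !normrN (ger0_norm (w0 z)) (ger0_norm (powR_ge0 _ _)) => h.
have := w0 z; rewrite le_eqVlt => /predU1P[<-|wz]; first by rewrite powR0 ?gt_eqF// ltW.
exact: powR_le_root.
Qed.

Lemma is_derive_int0 q s : 0 < s -> mu.-integrable `]0, s + 1] (EFin \o q) ->
  {for s, continuous q} -> is_derive s (1 : R) (fun x => \int[mu]_(t in `]0, x]) q t) (q s).
Proof.
move=> s0 iq cq; have s1 : s < s + 1 by rewrite ltrDl.
have [d e] := @continuous_FTC1 R q (BRight 0) s (s + 1) s1 iq s0 cq.
by rewrite -e derive1E; exact: derivableP.
Qed.

Lemma is_derive_int0_expR q t : (forall M, mu.-integrable `]0, M] (EFin \o q)) ->
  {for expR (2 * t), continuous q} ->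
  is_derive t (1 : R) (fun t => \int[mu]_(s in `]0, expR (2 * t)]) q s)
    (2 * expR (2 * t) * q (expR (2 * t))).
Proof.
move=> iq cq; rewrite mulrC.
exact: (@is_derive1_comp R (fun x => \int[mu]_(s in `]0, x]) q s) (fun t => expR (2 * t)) t _ _
  (is_derive_int0 (expR_gt0 _) (iq _) cq) (is_derive_expRM 2 t)).
Qed.

Lemma cvgNy_expR2 : expR (2 * t) @[t --> -oo] --> (0 : R).
Proof.
apply/cvgrPdist_lt => e e0.
exists (2^-1 * ln e); split; first exact: num_real.
move=> t te; rewrite sub0r normrN gtr0_norm ?expR_gt0// -[ltRHS](lnK (x := e)) ?posrE//.
by rewrite ltr_expR -ltr_pdivlMl.
Qed.

Lemma int0_expR_cvgNy q : (forall M, mu.-integrable `]0, M] (EFin \o q)) ->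
  \int[mu]_(s in `]0, expR (2 * t)]) q s @[t --> -oo] --> (0 : R).
Proof.
move=> iq; have i1 := integrable_itv_obnd_cbnd (iq 1).
have h := parameterized_integral_cvg_left ltr01 i1.
have := cvg_comp _ _ cvgNy_expR2 h.
rewrite (_ : _ \o _ = fun t => \int[mu]_(s in `]0, expR (2 * t)]) q s)//.
by apply/funext => t; rewrite /parameterized_integral /= -Rintegral_itv_obnd_cbnd.
Qed.

(** Monotone convergence. Integer points suffice: in [H_cvgNy] the limit along the whole line is
    already known to exist and only has to be identified. *)
Lemma int0_expR_cvg_nat q : mu.-integrable `]0, +oo[ (EFin \o q) -> (forall s, 0 < s -> 0 <= q s) ->
  \int[mu]_(s in `]0, expR (2 * n%:R)]) q s @[n --> \oo] --> \int[mu]_(s in `]0, +oo[) q s.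
Proof.
move=> iq q0; pose E (n : nat) : set RB := [set` `]0, expR (2 * n%:R)]].
have mE i : measurable (E i) by exact: measurable_itv.
have nd : nondecreasing_seq E.
  move=> i j ij; apply/subsetPset => s; rewrite /E /= !in_itv/= => /andP[-> h].
  by apply: le_trans h _; rewrite ler_expR ler_pM2l// ler_nat.
have EU : \bigcup_i E i = [set` `]0, +oo[].
  apply/seteqP; split => s.
    by move=> [i _]; rewrite /E /= !in_itv/= andbT => /andP[].
  rewrite /= in_itv/= andbT => s0; exists (Num.truncn `|ln s|).+1 => //=.
  rewrite /E /= in_itv/= s0/= -[leLHS](lnK (x := s)) ?posrE// ler_expR.
  have /andP[_ h] := truncn_itv (normr_ge0 (ln s)).
  have := ler_norm (ln s); have := normr_ge0 (ln s); lra.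
have mq i : measurable_fun (E i) (EFin \o q).
  have := measurable_int _ iq; apply: measurable_funS => //.
  by rewrite -EU; exact: bigcup_sup.
have q0' i s : E i s -> (0 <= (EFin \o q) s)%E.
  by rewrite /E /= in_itv/= => /andP[s0 _]; rewrite lee_fin q0.
have := @ge0_nondecreasing_set_cvg_integral _ _ _ E (EFin \o q) mu nd mE mq q0'.
rewrite EU.
have fin := @integrable_fin_num _ _ _ mu `]0, +oo[ (measurable_itv _) _ iq.
by rewrite -(fineK fin) => /fine_cvgP[_].
Qed.

(** A Gronwall argument: (w^2 + v^2) e^{-(1 + C) t} is nonincreasing, since 2 |w v| <= w^2 + v^2. *)
Lemma linear_ode_zero w v q (C a b : R) : a <= b ->
  (forall t, is_derive t (1 : R) w (v t)) -> (forall t, is_derive t (1 : R) v (q t * w t)) ->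
  (forall t, a <= t <= b -> `|q t| <= C) -> w a = 0 -> v a = 0 ->
  forall t, a <= t <= b -> w t = 0.
Proof.
move=> ab dw dv qC wa va t /andP[at_ tb].
pose E t := (w t ^+ 2 + v t ^+ 2) * expR ((- (1 + C)) * t).
have dE s : is_derive s (1 : R) E
    ((2 * (1 + q s) * w s * v s - (1 + C) * (w s ^+ 2 + v s ^+ 2)) * expR ((- (1 + C)) * s)).
  have d1 := dw s; have d2 := dv s; have d3 := is_derive_expRM (- (1 + C)) s.
  by rewrite /E; apply: is_derive_eq; rewrite /GRing.scale/=; ring.
have : E t <= E a.
  apply: (derive_le0_ge at_ (fun z _ => dE z)) => z /andP[az zt].
  rewrite mulr_le0_ge0 ?expR_ge0// subr_le0.
  have qz : `|q z| <= C by apply: qC; rewrite ltW//= ltW// (lt_le_trans zt).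
  move: qz; rewrite ler_norml => /andP[q1 q2].
  have := sqr_ge0 (w z - v z); have := sqr_ge0 (w z + v z); nra.
rewrite /E wa va expr0n /= addr0 mul0r pmulr_lle0 ?expR_gt0// => h.
by apply/eqP; rewrite -sqrf_eq0 eq_le sqr_ge0 andbT; have := sqr_ge0 (v t); lra.
Qed.

End HalfLineIntegral.

(** * Positivity, the singularity at -oo and the Wronskian with the Green function *)

Section RadialEmden.
Variable R : realType.
Notation mu := (@lebesgue_measure R).
Local Notation RB := (measurableTypeR R).
Implicit Types (s t : R).
Variables (p lambda c m : R) (U Ft : R -> R).
Hypotheses (p1 : 1 < p) (l0 : 0 < lambda) (c0 : c != 0).
Local Notation g := (glog lambda).
Local Notation dg := (dglog lambda).
Local Notation G := (rgreen lambda).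
Hypotheses (mU : measurable_fun (setT : set RB) (U : RB -> RB)) (U0 : forall s, 0 < s -> 0 < U s).
Let F s := U s - c * G s.
Hypothesis iF2 : mu.-integrable `]0, +oo[ (EFin \o (fun s => F s ^+ 2)).
Hypothesis iUp : forall M, mu.-integrable `]0, M] (EFin \o (fun s => U s `^ p)).
Hypothesis iUG : mu.-integrable `]0, +oo[ (EFin \o (fun s => U s `^ p * G s)).
Hypothesis mE : m = \int[mu]_(s in `]0, +oo[) (U s `^ p * G s).
Hypothesis FFt : {ae mu, forall s, 0 < s -> F s = Ft s}.
Hypothesis dFt : forall t, is_derive t (1 : R) (fun t => Ft (expR (2 * t)))
  (2^-1 * \int[mu]_(s in `]0, expR (2 * t)]) (lambda * F s - U s `^ p)).

Let f t := Ft (expR (2 * t)).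
Let w t := f t + c * g t.

Let cf : continuous f.
Proof. by move=> t; exact: is_derive_continuous (dFt t). Qed.

Let cg : continuous g.
Proof. by move=> t; exact: is_derive_continuous (is_derive_glog l0 t). Qed.

Let cw : continuous w.
Proof. by move=> t; apply: cvgD; [exact: cf|apply: cvgMr; exact: cg]. Qed.

Let half_ln s : 0 < s -> expR (2 * (2^-1 * ln s)) = s.
Proof. by move=> s0; rewrite mulVKf ?lnK ?posrE. Qed.

Let half_lnE t : 2^-1 * ln (expR (2 * t)) = t.
Proof. by rewrite expRK mulKf. Qed.

Let UE : {ae mu, forall s, 0 < s -> U s = w (2^-1 * ln s)}.
Proof.
apply: (@filterS _ _ (ae_filter_ringOfSetsType mu)) FFt => s h s0.
by rewrite /w /f half_ln// -h// /F subrK.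
Qed.

Let w_pos_dense a b : a < b -> exists2 t, a < t < b & 0 < w t.
Proof.
move=> ab; have ab' : expR (2 * a) < expR (2 * b) by rewrite ltr_expR ltr_pM2l.
have [s /andP[as_ sb] h] := ae_itv_exists ab' UE.
have s0 : 0 < s by apply: lt_trans as_; exact: expR_gt0.
exists (2^-1 * ln s); last by rewrite -h// U0.
have e := half_ln s0; set y := 2^-1 * ln s in e *.
have ay : expR (2 * a) < expR (2 * y) by rewrite e.
have yb : expR (2 * y) < expR (2 * b) by rewrite e.
by move: ay yb; rewrite !ltr_expR; lra.
Qed.

Let w_ge0 t : 0 <= w t.
Proof.
rewrite leNgt; apply/negP => wt.
have : \forall z \near t, w z < 0.
  have e : 0 < - w t by lra.
  have := @cw t; rewrite /continuous_at => /cvgrPdist_lt/(_ _ e).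
  apply: filterS => z; rewrite ltr_norml opprK => /andP[+ _].
  by move: (w t) (w z) => x y; lra.
move=> [e /= e0 he]; have [z /andP[z1 z2]] := @w_pos_dense (t - e) (t + e) ltac:(lra).
rewrite ltNge => /negP; apply; apply: ltW; apply: he; rewrite /= ltr_norml; lra.
Qed.

Let wp_continuous (a : R) : 0 < a -> continuous (fun t => w t `^ a).
Proof. by move=> a0; exact: powR_continuous_ge0 a0 cw w_ge0. Qed.

Let half_ln_continuous (k : R -> R) s : continuous k -> 0 < s ->
  {for s, continuous (fun s => k (2^-1 * ln s))}.
Proof.
move=> ck s0; apply: (@continuous_comp _ _ _ (fun s => 2^-1 * ln s) k); last exact: ck.
by apply: cvgMr; exact: continuous_ln.
Qed.

Let half_ln_measurable (k : R -> R) : continuous k ->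
  measurable_fun (setT : set RB) (fun s => k (2^-1 * ln s) : RB).
Proof.
move=> ck; apply: (measurableT_comp (continuous_measurable_fun ck)).
by apply: measurable_funM => //; exact: measurable_ln.
Qed.

(** The integrand is replaced by its continuous representative, which leaves the integrals unchanged
    and makes them differentiable at every point. *)
Let is_derive_int_ae (q : R -> R) (k : R -> R) : (forall M, mu.-integrable `]0, M] (EFin \o q)) ->
  continuous k -> {ae mu, forall s, 0 < s -> q s = k (2^-1 * ln s)} ->
  forall t, is_derive t (1 : R) (fun t => \int[mu]_(s in `]0, expR (2 * t)]) q s)
    (2 * expR (2 * t) * k t).
Proof.
move=> iq ck qk t; pose k' s := k (2^-1 * ln s).
have qk' M : ae_eq mu `]0, M]%classic (EFin \o q) (EFin \o k').
  apply: (@filterS _ _ (ae_filter_ringOfSetsType mu)) qk => s h.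
  by rewrite /= in_itv/= => /andP[s0 _]; rewrite h.
have mk M : measurable_fun (`]0, M]%classic : set RB) (EFin \o k').
  apply: measurable_funTS; apply/measurable_EFinP; exact: half_ln_measurable.
have mq M : measurable_fun (`]0, M]%classic : set RB) (EFin \o q) := measurable_int _ (iq M).
have e M : \int[mu]_(s in `]0, M]) q s = \int[mu]_(s in `]0, M]) k' s.
  by congr fine; apply: ae_eq_integral.
have ik M : mu.-integrable `]0, M] (EFin \o k').
  apply/integrableP; split => //; have /integrableP[_] := iq M.
  congr (_ < _)%E; apply: ae_eq_integral => //; [exact: measurableT_comp|exact: measurableT_comp|].
  by apply: (@filterS _ _ (ae_filter_ringOfSetsType mu)) (qk' M) => s h Ds; rewrite (h Ds).
under eq_fun do rewrite e.
have := is_derive_int0_expR ik (half_ln_continuous ck (expR_gt0 (2 * t))).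
by rewrite /k' half_lnE.
Qed.

Let F2i : forall M, mu.-integrable `]0, M] (EFin \o (fun s => F s ^+ 2)).
Proof. by move=> M; exact: integrable_itv0. Qed.

Let mF : measurable_fun (setT : set RB) (F : RB -> RB).
Proof. by apply: measurable_funB => //; apply: measurable_funM => //; exact: measurable_rgreen. Qed.

Let v t := 2^-1 * \int[mu]_(s in `]0, expR (2 * t)]) (lambda * F s - U s `^ p) + c * dg t.

Let iQ M : mu.-integrable `]0, M] (EFin \o (fun s => lambda * F s - U s `^ p)).
Proof.
have i1 := square_locally_integrable M mF iF2.
have i2 := @integrableZl _ _ _ mu _ (measurable_itv _) lambda _ i1.
exact: (@integrableB _ _ _ mu _ (measurable_itv _) _ _ i2 (iUp M)).
Qed.

Let dw t : is_derive t (1 : R) w (v t).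
Proof.
have d1 := dFt t; have d2 := is_derive_glog l0 t.
rewrite /w /f; apply: is_derive_eq; rewrite /v /GRing.scale/=; ring.
Qed.

Let p0 : 0 < p.
Proof. by have := p1; lra. Qed.

Let dv t : is_derive t (1 : R) v (expR (2 * t) * (lambda * w t - w t `^ p)).
Proof.
have ck : continuous (fun t => lambda * f t - w t `^ p).
  by move=> z; apply: cvgB; [apply: cvgMr; exact: cf|exact: wp_continuous p0 z].
have d1 : is_derive t (1 : R) (fun t => \int[mu]_(s in `]0, expR (2 * t)]) (lambda * F s - U s `^ p))
    (2 * expR (2 * t) * (lambda * f t - w t `^ p)).
  apply: (is_derive_int_ae iQ ck); apply: (@filterS2 _ _ (ae_filter_ringOfSetsType mu)) FFt UE => s h1 h2 s0.
  by rewrite h1// h2// /f half_ln.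
have d2 := is_derive_dglog l0 t.
by rewrite /v; apply: is_derive_eq; rewrite /w /GRing.scale/=; field.
Qed.

(** A zero is a minimum, so v vanishes there too. With the nonlinearity written as a continuous
    potential times w, the equation is linear, and uniqueness for the initial value problem forces w
    = 0 on an interval, where [w_pos_dense] provides a positive value. *)
Let w_gt0 t : 0 < w t.
Proof.
rewrite lt_neqAle w_ge0 andbT; apply/eqP => wt.
have vt : v t = 0.
  have dt : is_derive t (1 : R) w 0.
    apply: (@derive1_at_min _ w (t - 1) (t + 1)); first lra.
    - by move=> z _; have d := dw z; exact: ex_derive.
    - by rewrite in_itv/=; lra.
    - by move=> z _; rewrite -wt; exact: w_ge0.
  by have dt' := dw t; rewrite -(@derive_val _ _ _ _ _ _ _ dt') (@derive_val _ _ _ _ _ _ _ dt).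
pose q t := expR (2 * t) * (lambda - w t `^ (p - 1)).
have q1 : 0 < p - 1 by have := p1; lra.
have cq : continuous q.
  move=> z; apply: cvgM; first exact: is_derive_continuous (is_derive_expRM 2 z).
  by apply: cvgB; [exact: cvg_cst|exact: wp_continuous q1 z].
have dvq z : is_derive z (1 : R) v (q z * w z).
  have := dv z; congr is_derive; rewrite /q; have := w_ge0 z; rewrite le_eqVlt => /predU1P[<-|w0].
    by rewrite powR0 ?gt_eqF// !mulr0 subr0 mulr0.
  by rewrite (powR_split p1 w0).1; ring.
have [C qC] := continuous_itv_bounded t (t + 1) cq.
have t1 : t <= t + 1 by lra.
have z0 := linear_ode_zero t1 dw dvq qC (esym wt) vt.
have [z /andP[z1 z2]] := @w_pos_dense t (t + 1) ltac:(lra).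
by rewrite z0 ?ltxx// ltW//= ltW.
Qed.

Let emden_w : emden_sol p lambda w v.
Proof. by split; [exact: w_gt0|exact: dw|exact: dv]. Qed.

(** The bounded function that the decay estimates ask for, from (f + c g)^2 <= 2 f^2 + 2 c^2 g^2:
    the first part is controlled by the L^2 norm of the H^1 component, the second by
    [glog_sqr_primitive]. *)
Let I t := 2 * (2^-1 * \int[mu]_(s in `]0, expR (2 * t)]) (F s ^+ 2)) + 2 * c ^+ 2 * glog_sqr_primitive lambda t.

Let D t := 2 * expR (2 * t) * f t ^+ 2 + 2 * c ^+ 2 * (expR (2 * t) * g t ^+ 2).

Let dI t : is_derive t (1 : R) I (D t).
Proof.
have ck : continuous (fun t => f t ^+ 2).
  by move=> z; apply: (@continuous_comp _ _ _ f (fun y => y ^+ 2)); [exact: cf|exact: exprn_continuous].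
have d1 : is_derive t (1 : R) (fun t => \int[mu]_(s in `]0, expR (2 * t)]) (F s ^+ 2))
    (2 * expR (2 * t) * f t ^+ 2).
  apply: (is_derive_int_ae F2i ck); apply: (@filterS _ _ (ae_filter_ringOfSetsType mu)) FFt => s h1 s0.
  by rewrite h1// /f half_ln.
have d2 := is_derive_glog_sqr_primitive l0 t.
by rewrite /I /D; apply: is_derive_eq; rewrite /GRing.scale/=; field.
Qed.

Let wD t : expR (2 * t) * w t ^+ 2 <= D t.
Proof.
have e0 := expR_gt0 (2 * t); rewrite /D /w.
have -> : 2 * expR (2 * t) * f t ^+ 2 + 2 * c ^+ 2 * (expR (2 * t) * g t ^+ 2) =
  expR (2 * t) * (2 * f t ^+ 2 + 2 * (c * g t) ^+ 2) by ring.
rewrite ler_wpM2l ?expR_ge0//; have := sqr_ge0 (f t - c * g t); nra.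
Qed.

Let I_bounded t : I t <= \int[mu]_(s in `]0, +oo[) (F s ^+ 2).
Proof.
have h1 : \int[mu]_(s in `]0, expR (2 * t)]) (F s ^+ 2) <= \int[mu]_(s in `]0, +oo[) (F s ^+ 2).
  apply: fine_le.
  - exact: (@integrable_fin_num _ _ _ mu `]0, expR (2 * t)] (measurable_itv _) _ (F2i _)).
  - exact: (@integrable_fin_num _ _ _ mu `]0, +oo[ (measurable_itv _) _ iF2).
  apply: ge0_subset_integral => //.
  - by case/integrableP: iF2.
  - by move=> s _; rewrite lee_fin sqr_ge0.
  - by move=> s; rewrite /= !in_itv/= andbT => /andP[].
have h2 := glog_sqr_primitive_le0 l0 t; have h3 := sqr_ge0 c.
by rewrite /I mulVKf// -[leRHS]addr0 lerD// mulr_ge0_le0// mulr_ge0.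
Qed.

Let v_cvgNy : v t @[t --> -oo] --> - (c / (2 * pi)).
Proof.
rewrite (_ : - (c / (2 * pi)) = 2^-1 * 0 + c * (- (2 * pi)^-1)); last by ring.
apply: cvgD; apply: cvgMr; first exact: int0_expR_cvgNy iQ.
exact: dglog_cvgNy.
Qed.

Let pi2_gt0 : 0 < 2 * pi :> R.
Proof. by rewrite mulr_gt0// pi_gt0. Qed.

(** For c < 0 the limit of v at -oo would be positive, and w would become negative far to the
    left. *)
Let c_gt0 : 0 < c.
Proof.
rewrite lt_neqAle eq_sym c0/= leNgt; apply/negP => cneg.
pose e := - (c / (2 * pi)) / 2.
have L0 : 0 < - (c / (2 * pi)) by rewrite oppr_gt0 pmulr_llt0 ?invr_gt0.
have e0 : 0 < e by rewrite /e divr_gt0.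
have /near_ninftyS[T hT] : \forall t \near -oo, e <= v t.
  have /cvgrPdist_lt/(_ e e0) := v_cvgNy; apply: filterS => t.
  rewrite ltr_norml => /andP[_]; rewrite ltrBlDr -ltrBlDl => h; apply: ltW; apply: le_lt_trans h.
  by rewrite /e; set y := - _; rewrite {2}[y]splitr addrK.
(* The line of slope [e] that meets the graph of w at [T] has the value - e at [a]. *)
pose a := T - w T / e - 1.
have aT : a <= T.
  by rewrite /a -addrA gerDl -opprD oppr_le0 addr_ge0// divr_ge0 ?ltW ?w_gt0.
have dy t : is_derive t (1 : R) (fun t => w t - e * t) (v t - e).
  have d := dw t; have d2 : is_derive t (1 : R) (fun t => e * t) e.
    by apply: is_derive_eq; rewrite /GRing.scale/= mulr1.
  exact: is_deriveB d d2.
have : w a - e * a <= w T - e * T.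
  apply: (derive_ge0_le aT (fun z _ => dy z)) => z /andP[_ zT].
  by rewrite subr_ge0 hT// ltW.
have -> : e * a = e * T - w T - e by rewrite /a; field; rewrite gt_eqF.
rewrite leNgt => /negP; apply.
have lt_aux (x y z T' : R) : 0 < y -> 0 < z -> x - z * T' < y - (z * T' - x - z) by lra.
exact: lt_aux (w_gt0 a) e0.
Qed.

(** The Wronskian of w with the Green function. The linear terms cancel in its derivative, which is
    also that of [J]. *)
Let H t := dg t * w t - v t * g t.

Let J t := 2^-1 * \int[mu]_(s in `]0, expR (2 * t)]) (U s `^ p * G s).

Let iUG' M : mu.-integrable `]0, M] (EFin \o (fun s => U s `^ p * G s)).
Proof. exact: integrable_itv0. Qed.

Let dJ t : is_derive t (1 : R) J (expR (2 * t) * (w t `^ p * g t)).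
Proof.
have ck : continuous (fun t => w t `^ p * g t).
  by move=> z; apply: cvgM; [exact: wp_continuous p0 z|exact: cg].
have d1 : is_derive t (1 : R) (fun t => \int[mu]_(s in `]0, expR (2 * t)]) (U s `^ p * G s))
    (2 * expR (2 * t) * (w t `^ p * g t)).
  apply: (is_derive_int_ae iUG' ck); apply: (@filterS _ _ (ae_filter_ringOfSetsType mu)) UE => s h1 s0.
  by rewrite h1.
by rewrite /J; apply: is_derive_eq; rewrite /GRing.scale/=; field.
Qed.

Let dH t : is_derive t (1 : R) H (expR (2 * t) * (w t `^ p * g t)).
Proof.
have d1 := dw t; have d2 := dv t; have d3 := is_derive_glog l0 t; have d4 := is_derive_dglog l0 t.
by rewrite /H; apply: is_derive_eq; rewrite /GRing.scale/=; ring.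
Qed.

Let HJ t : H t - J t = H 0 - J 0.
Proof.
apply: (@derive_eq0_cst R (fun t => H t - J t)) => z.
have d1 := dH z; have d2 := dJ z; have := is_deriveB d1 d2; by rewrite subrr.
Qed.

Let J_cvgNy : J t @[t --> -oo] --> (0 : R).
Proof. by rewrite -[X in _ --> X](mulr0 2^-1); apply: cvgMr; exact: int0_expR_cvgNy iUG'. Qed.

Let H_cvgy : H t @[t --> +oo] --> (0 : R).
Proof.
have [_ v0 _ _] := emden_decay p1 l0 emden_w dI wD I_bounded.
have w0 := emden_cvg0 p1 l0 emden_w dI wD I_bounded.
rewrite (_ : (0 : R) = 0 * 0 - 0 * 0); last by rewrite mulr0 subrr.
by apply: cvgB; apply: cvgM => //; [exact: dglog_cvg0|exact: glog_cvg0].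
Qed.

(** [H - J] is constant. At +oo [H] tends to 0, by the decay of both functions, and [J] to m / 2, so
    the constant is - m / 2; at -oo [J] tends to 0. The factor 1/2 comes from ds = 2 e^{2t} dt. *)
Let H_cvgNy : H t @[t --> -oo] --> - (m / 2).
Proof.
have e : H 0 - J 0 = - (m / 2).
  have h1 : J n%:R @[n --> \oo] --> m / 2.
    rewrite mulrC mE; apply: cvgMr; apply: int0_expR_cvg_nat => // s s0.
    by rewrite mulr_ge0 ?powR_ge0 ?ltW ?glog_gt0.
  have h2 : (H t - (H 0 - J 0)) @[t --> +oo] --> 0 - (H 0 - J 0).
    by apply: cvgB; [exact: H_cvgy|exact: cvg_cst].
  have h3 : J n%:R @[n --> \oo] --> 0 - (H 0 - J 0).
    rewrite (_ : (fun n : nat => J n%:R) = (fun t => H t - (H 0 - J 0)) \o (fun n : nat => n%:R)).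
      by apply: cvg_comp h2; exact: cvgr_idn.
    have aux (x y z : R) : x - y = z -> y = x - z by move=> <-; rewrite subKr.
    by apply/funext => n; exact: aux (HJ n%:R).
  have := cvg_unique _ h1 h3 => ->; [by rewrite sub0r opprK|exact: Rhausdorff].
rewrite (_ : H = fun t => J t + - (m / 2)); last by apply/funext => t; rewrite -e -(HJ t) subrKC.
by rewrite -[X in _ --> X]add0r; apply: cvgD; [exact: J_cvgNy|exact: cvg_cst].
Qed.

Theorem radial_emden : exists w v I D : R -> R, exists M : R,
  [/\ emden_sol p lambda w v, {ae mu, forall s, 0 < s -> U s = w (2^-1 * ln s)},
      forall t, is_derive t (1 : R) I (D t), forall t, expR (2 * t) * w t ^+ 2 <= D t &
      forall t, I t <= M] /\
  [/\ 0 < c, v t @[t --> -oo] --> - (c / (2 * pi)) &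
      (dg t * w t - v t * g t) @[t --> -oo] --> - (m / 2)].
Proof.
exists w, v, I, D, (\int[mu]_(s in `]0, +oo[) (F s ^+ 2)); split; split.
- exact: emden_w.
- exact: UE.
- exact: dI.
- exact: wD.
- exact: I_bounded.
- exact: c_gt0.
- exact: v_cvgNy.
- exact: H_cvgNy.
Qed.

End RadialEmden.

(** * Uniqueness of the positive radial solution *)

Section Uniqueness.
Variable R : realType.
Notation mu := (@lebesgue_measure R).
Local Notation leb2 := (mu \x mu)%E.
Local Notation RB := (measurableTypeR R).

Lemma dglog_lt0 (lambda t : R) : 0 < lambda -> dglog lambda t < 0.
Proof.
move=> l0; have z0 : 0 < Num.sqrt lambda * expR t by rewrite mulr_gt0 ?sqrtr_gt0 ?expR_gt0.
by rewrite oppr_lt0 mulr_gt0 ?invr_gt0 ?mulr_gt0 ?pi_gt0 ?besselK1_gt0// ?expR_gt0 ?sqrtr_gt0.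
Qed.

(** The limits are combined through (G' w1 - v1 G) v2 - (G' w2 - v2 G) v1 = G' (w1 v2 - v1 w2); on
    the left both products tend to the same multiple of k c1 c2. The common [k] expresses a boundary
    condition at the origin shared by the two solutions. *)
Lemma wronskian_cvgNy0 (lambda k c1 c2 : R) (w1 v1 w2 v2 : R -> R) : 0 < lambda ->
  v1 t @[t --> -oo] --> - (c1 / (2 * pi)) -> v2 t @[t --> -oo] --> - (c2 / (2 * pi)) ->
  (dglog lambda t * w1 t - v1 t * glog lambda t) @[t --> -oo] --> - (k * c1 / 2) ->
  (dglog lambda t * w2 t - v2 t * glog lambda t) @[t --> -oo] --> - (k * c2 / 2) ->
  wronskian w1 v1 w2 v2 t @[t --> -oo] --> (0 : R).
Proof.
move=> l0 h1 h2 W1 W2.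
have pi0 : - (2 * pi)^-1 != 0 :> R by rewrite oppr_eq0 invr_eq0 mulf_neq0// gt_eqF// pi_gt0.
have h := cvgM (cvgB (cvgM W1 h2) (cvgM W2 h1)) (cvgV pi0 (dglog_cvgNy l0)).
rewrite (_ : _ * _ = 0) in h; last first.
  by rewrite (_ : _ - _ = 0) ?mul0r//; ring.
rewrite (_ : wronskian _ _ _ _ = fun t => ((dglog lambda t * w1 t - v1 t * glog lambda t) * v2 t
  - (dglog lambda t * w2 t - v2 t * glog lambda t) * v1 t) * (dglog lambda t)^-1); first exact: h.
apply/funext => t; have := dglog_lt0 t l0; rewrite /wronskian.
move: (dglog lambda t) (glog lambda t) => y z y0; field; rewrite lt_eqF//.
Qed.

Lemma solution_emden (p alpha lambda : R) (u : R * R -> R[i]) : 1 < p -> 0 < lambda ->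
  is_solution p alpha lambda u -> positive_off0 u -> radial u ->
  exists w v I D : R -> R, exists M c : R,
  [/\ emden_sol p lambda w v, {ae mu, forall s, 0 < s -> radial_profile u s = w (2^-1 * ln s)},
      forall t, is_derive t (1 : R) I (D t), forall t, expR (2 * t) * w t ^+ 2 <= D t &
      forall t, I t <= M] /\
  [/\ 0 < c, v t @[t --> -oo] --> - (c / (2 * pi)) &
      (dglog lambda t * w t - v t * glog lambda t) @[t --> -oo] -->
        - ((alpha + beta_ lambda) / polar_const R * c / 2)].
Proof.
move=> p1 l0 su pu ru.
have mu1 : cmeasurable u by case: su => [? [? [? [[]]]]].
have [c [iF2 weak]] := radial_weak_form l0 pu ru su.
(* Division by the area of the unit disc puts the weak equation in one-dimensional form; the ratio m
   / c depends on the parameters only. *)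
pose m := (alpha + beta_ lambda) / polar_const R * c.
have K0 := polar_const_gt0 R.
have mU := measurable_radial_profile mu1.
have U0 := radial_profile_gt0 pu.
have mG := measurable_rgreen l0.
have G0 s : 0 < s -> 0 < rgreen lambda s by move=> _; exact: glog_gt0.
have cG s : 0 < s -> {for s, continuous (rgreen lambda)}.
  move=> s0; apply: (@continuous_comp _ _ _ (fun s => 2^-1 * ln s) (glog lambda)).
    by apply: cvgMr; exact: continuous_ln.
  exact: is_derive_continuous (is_derive_glog l0 _).
have weak' h h1 h2 M d : radial_test h h1 h2 M ->
    - 4 * (\int[mu]_(s in `]0, +oo[) ((radial_profile u s - c * rgreen lambda s) * (h1 s + s * h2 s)))
    + lambda * \int[mu]_(s in `]0, +oo[) ((radial_profile u s - c * rgreen lambda s) * h s) + m * d =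
    \int[mu]_(s in `]0, +oo[) (radial_profile u s `^ p * (h s + d * rgreen lambda s)).
  move=> [sh sh1 sh2 dh dh1 hM].
  have := weak h h1 h2 M d sh sh1 sh2 dh dh1 hM.
  move=> e; apply: (mulfI (lt0r_neq0 K0)); rewrite -e /m mulrDr; congr (_ + _).
  by field; rewrite gt_eqF.
have [iUp iUG m0 mE [Ft [FFt dFt]]] := radial_regularity p1 mU U0 mG G0 cG iF2 weak'.
(* A solution without singular part would have m = 0, whereas m is positive. *)
have c0 : c != 0 by apply/eqP => c0; move: m0; rewrite /m c0 mulr0 ltxx.
have [w [v [I [D [M h]]]]] := radial_emden p1 l0 c0 mU U0 iF2 iUp iUG mE FFt dFt.
by exists w, v, I, D, M, c.
Qed.

End Uniqueness.

Theorem theorem1p2 (R : realType) (p alpha lambda : R)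
  (hp : 1 < p) (hlambda : `|e_ alpha| < lambda)
  (u1 u2 : R * R -> R[i])
  (hu1 : is_solution p alpha lambda u1)
  (hu2 : is_solution p alpha lambda u2)
  (pos1 : positive_off0 u1) (pos2 : positive_off0 u2)
  (rad1 : radial u1) (rad2 : radial u2) :
  {ae @leb2 R, forall x, u1 x = u2 x}.
Proof.
have l0 : 0 < lambda by apply: le_lt_trans hlambda.
have [w1 [v1 [I1 [D1 [M1 [c1 [[s1 e1 dI1 D1w I1M] [c10 v1c W1]]]]]]]] := solution_emden hp l0 hu1 pos1 rad1.
have [w2 [v2 [I2 [D2 [M2 [c2 [[s2 e2 dI2 D2w I2M] [c20 v2c W2]]]]]]]] := solution_emden hp l0 hu2 pos2 rad2.
have pi20 : 0 < 2 * pi :> R by rewrite mulr_gt0// pi_gt0.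
have w12 : w1 = w2.
  apply: (@emden_unique R p lambda hp l0 w1 v1 w2 v2 I1 D1 I2 D2 (Num.max M1 M2)
    (c1 / (2 * pi)) (c2 / (2 * pi))) => //.
  - by move=> t; rewrite le_max I1M.
  - by move=> t; rewrite le_max I2M orbT.
  - exact: divr_gt0.
  - exact: divr_gt0.
  - exact: wronskian_cvgNy0 l0 v1c v2c W1 W2.
have : {ae @lebesgue_measure R, forall s, 0 < s -> radial_profile u1 s = radial_profile u2 s}.
  apply: (@filterS2 _ _ (ae_filter_ringOfSetsType (@lebesgue_measure R))) e1 e2 => s h1 h2 s0.
  by rewrite h1// h2// w12.
move=> /polar_ae; apply: (@filterS2 _ _ (ae_filter_ringOfSetsType (@leb2 R))) (@ae_neq0 R) => x x0 h.
by rewrite (radial_profileE pos1 rad1 x0) (radial_profileE pos2 rad2 x0) h.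
Qed.
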